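(* Let $P\subseteq M_{\mathbb R}$ be a $d$-dimensional simplicial reflexive polytope such that the dual polytope $P^*$ contains a vertex $u\in\mathcal V(P^* )$ with $-u\in P^*$. Then $$|\mathcal V(P)|\le\begin{cases}3d,& d\text{ even},\\ 3d-1,& d\text{ odd}.\end{cases}$$ For $d$ even, equality holds if and only if $P^*\cong(\mathcal Z_2)^{d/2}$ as lattice polytopes, i.e. $X(M,\Sigma_P)\cong(S_3)^{d/2}$.
   Context: Let $M\cong\mathbb Z^d$ be a lattice with dual lattice $N$. A reflexive polytope is a $d$-dimensional lattice polytope $P\subseteq M_{\mathbb R}$ (vertices in $M$) with $0\in\mathrm{int}\,P$ whose dual $P^*=\{y\in N_{\mathbb R}:\langle x,y\rangle\ge -1\ \forall x\in P\}$ is a lattice polytope. $\mathcal V(\cdot)$ denotes the set of vertices. $P$ is simplicial if every facet is a simplex. An isomorphism of lattice polytopes is an isomorphism of the lattices whose real linear extension maps one polytope onto the other. $\mathcal Z_2:=\mathrm{conv}([0,1]^2\cup(-[0,1]^2))\subseteq\mathbb R^2$ is a hexagon, with lattice $\mathbb Z^2$; powers are Cartesian products. $\Sigma_P=\{\mathrm{pos}(F):F\le P\}$ is the fan of cones over faces of $P$, and $X(M,\Sigma_P)$ is the complex toric variety of this fan in $M_{\mathbb R}$ (so $M$ is the lattice containing the ray generators). $S_3$ is the toric surface of the fan $\Sigma_{\mathcal Z_2}$, i.e. the blow-up of $\mathbb P^2$ in the three torus-invariant points. *)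

(* Defs.v *)
From HB Require Import structures.
From mathcomp Require Import all_boot all_order all_algebra complex.
From mathcomp Require Import all_classical all_reals all_analysis.

Set Implicit Arguments.
Unset Strict Implicit.
Unset Printing Implicit Defensive.

Import Order.TTheory GRing.Theory Num.Theory numFieldNormedType.Exports.

Local Open Scope classical_set_scope.
Local Open Scope ring_scope.

(* The lattices M and N are both taken to be Z^d, embedded in R^d as the
   integral row vectors, and dual to each other through [pairing]. *)
Definition pairing (K : pzRingType) d (x y : 'rV[K]_d) : K :=
  \sum_i x ord0 i * y ord0 i.

Definition to_real (R : realType) d (m : 'rV[int]_d) : 'rV[R]_d :=
  map_mx intr m.

Section ConvexGeometry.
Variable R : realType.

Definition hull d (A : set 'rV[R]_d) : set 'rV[R]_d :=
  smallest (@convex_set R 'rV[R]_d) A.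

Definition pos d (A : set 'rV[R]_d) : set 'rV[R]_d :=
  [set x | exists n (c : 'I_n -> R) (p : 'I_n -> 'rV[R]_d),
     (forall i, 0 <= c i) /\ (forall i, A (p i)) /\
     x = \sum_i c i *: p i].

Definition aff_indep d n (p : 'I_n -> 'rV[R]_d) : Prop :=
  forall c : 'I_n -> R,
    \sum_i c i = 0 -> \sum_i c i *: p i = 0 -> forall i, c i = 0.

Definition has_dim d (A : set 'rV[R]_d) (k : nat) : Prop :=
  (exists p : 'I_k.+1 -> 'rV[R]_d, aff_indep p /\ forall i, A (p i)) /\
  (forall p : 'I_k.+2 -> 'rV[R]_d, (forall i, A (p i)) -> ~ aff_indep p).

Definition polytope d (P : set 'rV[R]_d) : Prop :=
  exists2 A : set 'rV[R]_d, finite_set A & P = hull A.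

(* Both the empty face and [P] itself are faces. *)
Definition face d (P F : set 'rV[R]_d) : Prop :=
  exists (a : 'rV[R]_d) (b : R),
    (forall x, P x -> pairing x a <= b) /\
    F = [set x | P x /\ pairing x a = b].

Definition vertices d (P : set 'rV[R]_d) : set 'rV[R]_d :=
  [set v | face P [set v]].

Definition facet d (P F : set 'rV[R]_d) : Prop :=
  face P F /\ exists2 k, has_dim P k.+1 & has_dim F k.

Definition simplex d (S : set 'rV[R]_d) : Prop :=
  exists n (p : 'I_n -> 'rV[R]_d), aff_indep p /\ S = hull (range p).

Definition simplicial d (P : set 'rV[R]_d) : Prop :=
  forall F, facet P F -> simplex F.

Definition lattice_polytope d (P : set 'rV[R]_d) : Prop :=
  polytope P /\ vertices P `<=` range (@to_real R d).

Definition dual d (P : set 'rV[R]_d) : set 'rV[R]_d :=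
  [set y | forall x, P x -> -1 <= pairing x y].

Definition reflexive_polytope d (P : set 'rV[R]_d) : Prop :=
  [/\ has_dim P d, lattice_polytope P, interior P 0 &
      lattice_polytope (dual P)].

(* The ambient dimensions are kept apart because [d./2 * 2] and [d] are not
   convertible; the two matrices are inverse lattice isomorphisms. *)
Definition lattice_iso d e (P : set 'rV[R]_d) (Q : set 'rV[R]_e) : Prop :=
  exists (A : 'M[int]_(d, e)) (B : 'M[int]_(e, d)),
    [/\ A *m B = 1%:M, B *m A = 1%:M &
        [set x *m map_mx intr A | x in P] = Q].

(* A vector of R^(k * d) is read as k consecutive vectors of R^d. *)
Definition set_power d (Q : set 'rV[R]_d) k : set 'rV[R]_(k * d) :=
  [set x | forall i : 'I_k, Q (row i (vec_mx x))].

Definition Z2 : set 'rV[R]_2 :=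
  let square := [set x : 'rV[R]_2 | forall i, 0 <= x ord0 i <= 1] in
  hull (square `|` [set - x | x in square]).

(* Only proper faces are used: [pos P] is the whole space as soon as 0 is an
   interior point of [P], and is not a cone of the fan. The empty face yields
   the cone {0}. *)
Definition face_fan d (P : set 'rV[R]_d) : set (set 'rV[R]_d) :=
  [set pos F | F in [set F | face P F /\ F <> P]].

End ConvexGeometry.
Arguments set_power {R d} Q k.
Arguments Z2 R : clear implicits.

(* A classical (pre)variety over an algebraically closed field, presented by
   affine charts: [dom i] is the i-th chart as a set of closed points, and
   [coord i] its coordinate ring, as functions whose values outside [dom i] are
   irrelevant. *)
Record prevariety (C : fieldType) := Prevariety {
  pt : Type;
  chart : Type;
  dom : chart -> set pt;
  coord : chart -> set (pt -> C)
}.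

Section Prevarieties.
Variable C : fieldType.

Definition basic_open (X : prevariety C) (i : chart X) (h : pt X -> C) :
  set (pt X) := [set x | dom i x /\ h x != 0].

Definition zariski_open (X : prevariety C) (V : set (pt X)) : Prop :=
  forall x, V x -> exists (i : chart X) (h : pt X -> C),
    [/\ coord i h, basic_open i h x & basic_open i h `<=` V].

Definition regular_on (X : prevariety C) (V : set (pt X)) (f : pt X -> C) :
  Prop :=
  forall x, V x -> exists (i : chart X) (g h : pt X -> C),
    [/\ coord i g, coord i h, basic_open i h x, basic_open i h `<=` V &
        forall y, basic_open i h y -> f y = g y / h y].

Definition is_morphism (X Y : prevariety C) (phi : pt X -> pt Y) : Prop :=
  forall V : set (pt Y), zariski_open V ->
    zariski_open (phi @^-1` V) /\
    forall f, regular_on V f -> regular_on (phi @^-1` V) (f \o phi).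

Definition isomorphic (X Y : prevariety C) : Prop :=
  exists (phi : pt X -> pt Y) (psi : pt Y -> pt X),
    [/\ is_morphism phi, is_morphism psi, cancel phi psi & cancel psi phi].

(* The product of affine charts has as coordinate ring the tensor product of
   the coordinate rings, i.e. the span of the products of functions pulled back
   from the factors. *)
Definition variety_power (X : prevariety C) (k : nat) : prevariety C :=
  @Prevariety C ('I_k -> pt X) ('I_k -> chart X)
    (fun i => [set x | forall l, dom (i l) (x l)])
    (fun i => [set f | exists n (c : 'I_n -> C) (g : 'I_n -> 'I_k -> pt X -> C),
       (forall j l, coord (i l) (g j l)) /\
       f = fun x => \sum_j c j * \prod_l g j l (x l)]).

End Prevarieties.

(* The complex toric variety of a fan [Sigma] in M_R, M being the lattice that
   contains the ray generators and N the lattice of characters. *)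
Section ToricVariety.
Variable R : realType.

Definition dual_cone d (sigma : set 'rV[R]_d) : set 'rV[int]_d :=
  [set m | forall x, sigma x -> 0 <= pairing x (to_real R m)].

Definition orthogonal_lattice d (sigma : set 'rV[R]_d) : set 'rV[int]_d :=
  [set m | forall x, sigma x -> pairing x (to_real R m) = 0].

(* The affine chart of sigma is Hom(sigma^vee \cap N, C), with C the
   multiplicative monoid of the complex numbers; for tau a face of sigma, the
   chart of tau is glued into it by restriction along the inclusion of
   sigma^vee \cap N in tau^vee \cap N. Every point of the glued space comes from
   a smallest chart, that of some tau, where it is a homomorphism gamma
   vanishing outside tau^perp. A point is encoded as this unique pair
   (tau, gamma), with gamma extended by 0 to all of N. *)
Definition toric_point d (Sigma : set (set 'rV[R]_d))
    (p : set 'rV[R]_d * ('rV[int]_d -> R[i])) : Prop :=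
  [/\ Sigma p.1,
      p.2 0 = 1,
      forall m m', dual_cone p.1 m -> dual_cone p.1 m' ->
        p.2 (m + m') = p.2 m * p.2 m' &
      forall m, p.2 m != 0 -> orthogonal_lattice p.1 m].

(* The chart of sigma has coordinate ring C[sigma^vee \cap N]; it contains the
   point (tau, gamma) exactly when tau is a face of sigma, which for two cones
   of a fan amounts to inclusion. *)
Definition toric_variety d (Sigma : set (set 'rV[R]_d)) : prevariety R[i] :=
  @Prevariety R[i] {p | toric_point Sigma p} {sigma | Sigma sigma}
    (fun sigma => [set p | (sval p).1 `<=` sval sigma])
    (fun sigma => [set f | exists n (c : 'I_n -> R[i]) (m : 'I_n -> 'rV[int]_d),
       (forall j, dual_cone (sval sigma) (m j)) /\
       f = fun p => \sum_j c j * (sval p).2 (m j)]).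

Definition S3 : prevariety R[i] := toric_variety (face_fan (Z2 R)).

End ToricVariety.

(* Main.v *)
Require Import Defs.
From mathcomp Require Import all_boot all_order all_algebra complex.
From mathcomp Require Import all_classical all_reals all_analysis.
From mathcomp Require Import ring lra zify.

(** Let u be a vertex of P^* with - u in P^*, and call - <v, u> the height of a vertex v of P.
    By reflexivity the height is an integer, and it lies between -1 and 1 because u and - u
    are in P^*. As P is simplicial, the vertices of height 1 are the d vertices e_1, ..., e_d
    of the facet dual to u. Those of height -1 lie on a common facet as well, so there are at
    most d of them. A vertex of height 0 has a negative coordinate i in the basis of the e_i;
    integrality then forces it to be the vertex by which the neighbouring facet across the
    ridge opposite to e_i differs from the given one, so again there are at most d
    ([size_vert]).

    If P has 3d vertices, all these bounds are attained and the facet of the vertices of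
    height -1 is opposite to the first one. Comparing the d neighbouring facets of both shows
    that the vertices of height 0 are e_(s i) - e_i for an involution s without fixed points,
    that those of height -1 are the - e_i, and that the e_i are a basis of the lattice
    ([extremal_vertices]). Each orbit of s spans a plane in which P has the six vertices of
    the hexagon Z2 with respect to the basis e_i, - e_(s i). So d is even, and P is a free sum
    of d/2 hexagons ([extremal_hexhull]). Its dual is the product of the dual hexagons, which
    are isomorphic to Z2 ([hexhull_lattice_iso]), and conversely P is recovered from such a
    dual by biduality ([lattice_iso_hexhull]). The face fan of the free sum is the product of
    the fans of the hexagons, whence the isomorphism with a power of S3 ([hexhull_variety]).

    It remains to bound the number of vertices of P from below by 3d when its variety X is
    merely isomorphic, as an abstract variety, to a power of S3, that is to the variety Y of
    the standard free sum. A one-parameter subgroup mu of the torus of X yields a vector field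
    on Y. Let n be a character orthogonal to v, where v and - v span rays of the fan of Y. The
    logarithmic derivative of n along the vector field is regular on the projective line that
    compactifies the orbit of a torus point under v, hence constant there ([logder_ray]). The
    fan of Y contains enough such lines to make all logarithmic derivatives constant on the
    torus ([logder_const]). These constants are eigenvalues of rational functions under the
    field s d/ds, hence integers, and they form a matrix A through which the isomorphism
    intertwines the two tori ([xi_matrix], [phi_orbit]). Limit points along the rays of Y can
    now be pulled back to X: the cone of such a preimage is the ray that corresponds to v
    under A ([ray_images]). So the fan of X has at least as many rays as that of Y, which has
    3d ([variety_power_vertices]). *)

Import Order.TTheory GRing.Theory Num.Theory numFieldNormedType.Exports.
Set Implicit Arguments.
Unset Strict Implicit.
Unset Printing Implicit Defensive.
Local Open Scope classical_set_scope.
Local Open Scope card_scope.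
Local Open Scope ring_scope.

(** * Facet bases and the exchange step *)

Lemma seq_argmin (R : realFieldType) (T : eqType) (f : T -> R) (s : seq T) :
  s != [::] -> exists2 x, x \in s & forall y, y \in s -> f x <= f y.
Proof.
elim: s => // a s IH _.
case: (eqVneq s [::]) => [->|/IH [x xs xmin]].
  by exists a; rewrite ?mem_head // => y; rewrite inE => /eqP->.
have [le_ax|le_xa] := lerP (f a) (f x).
  exists a; first exact: mem_head.
  move=> y; rewrite inE => /orP[/eqP->//|/xmin]; exact: le_trans.
exists x; first by rewrite inE xs orbT.
move=> y; rewrite inE => /orP[/eqP->|/xmin//]; exact: ltW.
Qed.

Lemma count_lt (T : eqType) (a b : pred T) (s : seq T) x :
  {in s, forall y, a y -> b y} -> x \in s -> ~~ a x -> b x ->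
  (count a s < count b s)%N.
Proof.
move=> ab xs ax bx; rewrite -(size_filter b) -(count_predC a) !count_filter.
have -> : count (predI a b) s = count a s.
  apply: eq_in_count => y ys /=; apply/andb_idr; exact: ab.
rewrite -addn1 leq_add2l -has_count; apply/hasP; exists x => //=.
by rewrite ax.
Qed.

Section FacetBasis.
Variables (R : realFieldType) (d : nat).
Implicit Types (E : 'M[R]_d) (x y v : 'rV[R]_d).

Definition coords E x : 'rV[R]_d := x *m invmx E.
(** The linear form equal to 1 on the rows of E. When these rows are the vertices of a
    facet with 0 on its inner side, - level E is the vertex of the dual polytope that
    corresponds to the facet. *)
Definition level E x : R := \sum_i coords E x 0 i.

Lemma coordsD E x y i : coords E (x + y) 0 i = coords E x 0 i + coords E y 0 i.
Proof. by rewrite /coords mulmxDl mxE. Qed.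
Lemma coordsN E x i : coords E (- x) 0 i = - coords E x 0 i.
Proof. by rewrite /coords mulNmx mxE. Qed.
Lemma coordsZ E a x i : coords E (a *: x) 0 i = a * coords E x 0 i.
Proof. by rewrite /coords -scalemxAl mxE. Qed.
Lemma coords0 E i : coords E 0 0 i = 0.
Proof. by rewrite /coords mul0mx mxE. Qed.
Lemma coords_sumE E n (f : 'I_n -> 'rV[R]_d) i :
  coords E (\sum_k f k) 0 i = \sum_k coords E (f k) 0 i.
Proof. by rewrite /coords mulmx_suml summxE. Qed.

Lemma levelD E x y : level E (x + y) = level E x + level E y.
Proof. by rewrite -big_split; apply: eq_bigr => i _; rewrite coordsD. Qed.
Lemma levelN E x : level E (- x) = - level E x.
Proof. by rewrite -sumrN; apply: eq_bigr => i _; rewrite coordsN. Qed.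
Lemma levelZ E a x : level E (a *: x) = a * level E x.
Proof. by rewrite mulr_sumr; apply: eq_bigr => i _; rewrite coordsZ. Qed.
Lemma level0 E : level E 0 = 0.
Proof. by rewrite -[0 in LHS](scale0r 0) levelZ mul0r. Qed.
Lemma level_sum E n (f : 'I_n -> 'rV[R]_d) :
  level E (\sum_k f k) = \sum_k level E (f k).
Proof.
rewrite exchange_big; apply: eq_bigr => i _; exact: coords_sumE.
Qed.

Lemma coords_row E i k : E \in unitmx -> coords E (row i E) 0 k = (i == k)%:R.
Proof. by move=> uE; rewrite /coords -row_mul mulmxV // !mxE. Qed.

Lemma coords_row_id E i : E \in unitmx -> coords E (row i E) 0 i = 1.
Proof. by move=> uE; rewrite coords_row // eqxx. Qed.

Lemma coords_row_neq E i k : E \in unitmx -> i != k -> coords E (row i E) 0 k = 0.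
Proof. by move=> uE /negPf ik; rewrite coords_row // ik. Qed.

Lemma level_row E i : E \in unitmx -> level E (row i E) = 1.
Proof.
move=> uE; rewrite /level (bigD1 i) //= coords_row // eqxx big1 ?addr0 // => k ki.
by rewrite coords_row // eq_sym (negPf ki).
Qed.

Lemma coordsK E x : E \in unitmx -> x = \sum_i coords E x 0 i *: row i E.
Proof. by move=> uE; rewrite -mulmx_sum_row /coords mulmxKV. Qed.

Lemma coords_inj E x y : E \in unitmx ->
  (forall i, coords E x 0 i = coords E y 0 i) -> x = y.
Proof.
by move=> uE h; rewrite (coordsK x uE) (coordsK y uE); apply: eq_bigr => i _; rewrite h.
Qed.

Lemma coords_uniq E x (c : 'I_d -> R) : E \in unitmx ->
  x = \sum_i c i *: row i E -> forall i, coords E x 0 i = c i.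
Proof.
move=> uE -> i; rewrite coords_sumE (bigD1 i) //= coordsZ coords_row // eqxx mulr1.
by rewrite big1 ?addr0 // => k ki; rewrite coordsZ coords_row // (negPf ki) mulr0.
Qed.

Lemma row_inj E : E \in unitmx -> injective (fun i => row i E).
Proof.
move=> uE i j eij; have := coords_row i j uE; rewrite eij coords_row // eqxx.
by case: eqP => // _ /eqP; rewrite oner_eq0.
Qed.

Lemma levelE E (z : 'cV[R]_d) x : E \in unitmx ->
  (forall i, (row i E *m z) 0 0 = 1) -> (x *m z) 0 0 = level E x.
Proof.
move=> uE h; rewrite [in LHS](coordsK x uE) mulmx_suml summxE; apply: eq_bigr => i _.
by rewrite -scalemxAl mxE h mulr1.
Qed.

Lemma level_form E : exists z : 'cV[R]_d, forall x, level E x = (x *m z) 0 0.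
Proof.
exists (invmx E *m const_mx 1) => x; rewrite mulmxA mxE; apply: eq_bigr => i _.
by rewrite [const_mx 1 _ _]mxE mulr1.
Qed.

Lemma level_rows E G a x : G \in unitmx ->
  (forall i, level E (row i G) = a) -> level E x = a * level G x.
Proof.
move=> uG h; rewrite [in LHS](coordsK x uG) level_sum mulr_sumr; apply: eq_bigr => i _.
by rewrite levelZ h mulrC.
Qed.

(** The pivot of the simplex method: it crosses the ridge opposite to the vertex row i E. *)
Definition exchange E i v : 'M[R]_d :=
  \matrix_k (if k == i then v else row k E).

Lemma row_exchange E i v k : row k (exchange E i v) = if k == i then v else row k E.
Proof. exact: rowK. Qed.

Lemma exchange_sum E i v x : E \in unitmx -> coords E v 0 i != 0 ->
  x = \sum_k (if k == i then coords E x 0 i / coords E v 0 i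
              else coords E x 0 k - coords E v 0 k * (coords E x 0 i / coords E v 0 i))
       *: row k (exchange E i v).
Proof.
move=> uE vi; set t := coords E x 0 i / coords E v 0 i.
rewrite (bigD1 i) //= row_exchange eqxx.
rewrite (eq_bigr (fun k => coords E x 0 k *: row k E - t *: (coords E v 0 k *: row k E))); last first.
  by move=> k /negPf ki; rewrite row_exchange ki scalerBl scalerA [t * _]mulrC.
rewrite sumrB -scaler_sumr [in t *: v](coordsK v uE) (bigD1 i) //= scalerDr -addrA.
by rewrite [t *: _ + (_ - _)]addrC subrK scalerA divfK // {1}(coordsK x uE) (bigD1 i).
Qed.

Lemma exchange_unit E i v : E \in unitmx -> coords E v 0 i != 0 -> exchange E i v \in unitmx.
Proof.
move=> uE vi; rewrite -row_full_unit -sub1mx; apply/rV_subP => x _.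
rewrite (exchange_sum x uE vi); apply: summx_sub => k _; apply: scalemx_sub.
exact: row_sub.
Qed.

Lemma coords_exchange E i v x k : E \in unitmx -> coords E v 0 i != 0 ->
  coords (exchange E i v) x 0 k =
  if k == i then coords E x 0 i / coords E v 0 i
  else coords E x 0 k - coords E v 0 k * (coords E x 0 i / coords E v 0 i).
Proof.
move=> uE vi.
exact: (coords_uniq (exchange_unit uE vi) (exchange_sum x uE vi)).
Qed.

(** The new form agrees with the old one on the ridge, where the i-th coordinate
    vanishes; the factor of that coordinate is fixed by the value 1 at v. *)
Lemma level_exchange E i v x : E \in unitmx -> coords E v 0 i != 0 ->
  level (exchange E i v) x =
  level E x + (1 - level E v) * (coords E x 0 i / coords E v 0 i).
Proof.
move=> uE vi; set t := _ / _.
rewrite /level (bigD1 i) //= coords_exchange // eqxx -/t.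
rewrite (eq_bigr (fun k => coords E x 0 k - coords E v 0 k * t)); last first.
  by move=> k /negPf ki; rewrite coords_exchange // ki.
rewrite sumrB -mulr_suml [in RHS](bigD1 i) //= [\sum_i coords E v _ _](bigD1 i) //=.
have -> : coords E x 0 i = coords E v 0 i * t by rewrite mulrC divfK.
ring.
Qed.

End FacetBasis.

Section Polar.
Variables (R : realFieldType) (d : nat) (V : seq 'rV[R]_d).
Implicit Types (E : 'M[R]_d) (x y v : 'rV[R]_d).

Definition facet_basis E : Prop :=
  [/\ E \in unitmx, forall i, row i E \in V & forall v, v \in V -> level E v <= 1].

(** This says that 0 is interior to the convex hull of V, in the form that a theorem of
    the alternative can use. *)
Definition positively_spans : Prop :=
  forall z : 'cV[R]_d, z != 0 -> exists2 v, v \in V & (v *m z) 0 0 < 0.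

Hypothesis Vspan : positively_spans.

(** The ratio test of the simplex method: when the hyperplane of the facet is tilted about
    the ridge opposite to row i, the vertex that it meets first is the one that minimizes
    the ratio below. *)
Lemma facet_neighbor E i : facet_basis E ->
  exists v, [/\ v \in V, coords E v 0 i < 0 & facet_basis (exchange E i v)].
Proof.
move=> [uE VE leE].
have formE x : (x *m col i (invmx E)) 0 0 = coords E x 0 i.
  by rewrite colE mulmxA -colE mxE.
have [|v0 v0V] := @Vspan (col i (invmx E)).
  apply/eqP => h; have := formE (row i E); rewrite h mulmx0 mxE coords_row // eqxx.
  by move/eqP; rewrite eq_sym oner_eq0.
rewrite formE => v0i.
pose f v := (1 - level E v) / - coords E v 0 i.
pose s := [seq v <- V | coords E v 0 i < 0].
have [|v] := @seq_argmin _ _ f s.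
  apply/eqP => s0; have : v0 \in s by rewrite mem_filter v0i.
  by rewrite s0.
rewrite mem_filter => /andP[vi vV] vmin.
have vi0 : coords E v 0 i != 0 by rewrite lt_eqF.
exists v; split=> //; split; first exact: exchange_unit.
  by move=> k; rewrite row_exchange; case: ifP.
move=> w wV; rewrite level_exchange // mulrCA.
have fv : 0 <= f v by rewrite divr_ge0 ?subr_ge0 ?oppr_ge0 ?leE // ltW.
have -> : (1 - level E v) / coords E v 0 i = - f v by rewrite /f invrN mulrN opprK.
have [wi|wi] := ltP (coords E w 0 i) 0; last first.
  apply: le_trans (leE w wV); rewrite gerDl mulrN oppr_le0; exact: mulr_ge0.
have : f v <= f w by apply: vmin; rewrite mem_filter wi.
rewrite {2}/f ler_pdivlMr ?oppr_gt0 //; lra.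
Qed.

(** As long as the tight vertices do not span the space, the form can be moved along a
    direction that vanishes on them until one more vertex becomes tight. *)
Lemma face_in_facet (z : 'cV[R]_d) : (forall v, v \in V -> (v *m z) 0 0 <= 1) ->
  exists2 E, facet_basis E & forall v, v \in V -> (v *m z) 0 0 = 1 -> level E v = 1.
Proof.
pose tight (z : 'cV[R]_d) := [seq v <- V | (v *m z) 0 0 == 1].
have [n] := ubnP (size V - size (tight z))%N.
elim: n z => // n IH z lt_n le_z.
pose s := tight z; pose M := \matrix_(i < size s) tnth (in_tuple s) i.
have sP v : v \in s = ((v *m z) 0 0 == 1) && (v \in V) by rewrite mem_filter.
have rowM i : row i M \in s by rewrite rowK mem_tnth.
have [fullM|nfull] := boolP (row_full M).
  pose f := fullrankfun fullM; pose E := rowsub f M.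
  have uE : E \in unitmx by exact: fullrowsub_unit.
  have rowE i : row i E \in s.
    have -> : row i E = row (f i) M by apply/rowP => j; rewrite !mxE.
    exact: rowM.
  have lE x : (x *m z) 0 0 = level E x.
    by apply: levelE => // i; have := rowE i; rewrite sP => /andP[/eqP].
  exists E; last by move=> v _ <-; rewrite lE.
  split=> // [i|v vV]; first by have := rowE i; rewrite sP => /andP[].
  by rewrite -lE le_z.
have [k Mk k0] : exists2 k : 'cV_d, M *m k = 0 & k != 0.
  have : cokermx M != 0.
    apply: contra nfull => /eqP h; rewrite -sub1mx.
    by rewrite submxE h mulmx0.
  move=> h; have [j hj] : exists j, col j (cokermx M) != 0.
    apply/existsP; apply: contraNT h; rewrite negb_exists => /forallP h.
    apply/eqP/matrixP => i j; have := h j; rewrite negbK => /eqP/colP/(_ i).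
    by rewrite !mxE.
  by exists (col j (cokermx M)); rewrite // colE mulmxA mulmx_coker mul0mx.
have [|v0 v0V v0k] := @Vspan (- k); first by rewrite oppr_eq0.
have {v0k} v0k : 0 < (v0 *m k) 0 0 by move: v0k; rewrite mulmxN mxE oppr_lt0.
pose g v := (1 - (v *m z) 0 0) / (v *m k) 0 0.
pose r := [seq v <- V | 0 < (v *m k) 0 0].
have [|v] := @seq_argmin _ _ g r.
  apply/eqP => r0; have : v0 \in r by rewrite mem_filter v0k.
  by rewrite r0.
rewrite mem_filter => /andP[vk vV] vmin.
have g0 : 0 <= g v by rewrite divr_ge0 ?subr_ge0 ?le_z // ltW.
pose z' := z + g v *: k.
have z'E x : (x *m z') 0 0 = (x *m z) 0 0 + g v * (x *m k) 0 0.
  by rewrite mulmxDr -scalemxAr !mxE.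
have tk w : w \in s -> (w *m k) 0 0 = 0.
  move=> ws; suff -> : w *m k = 0 by rewrite mxE.
  have [i ->] : exists i, w = row i M.
    by case/(tnthP (in_tuple s)): (ws) => i ->; exists i; rewrite rowK.
  by rewrite -row_mul Mk; apply/rowP => j; rewrite !mxE.
have tight' w : w \in V -> (w *m z) 0 0 = 1 -> (w *m z') 0 0 = 1.
  by move=> wV wz; rewrite z'E wz tk ?mulr0 ?addr0 // sP wz eqxx.
have vz' : (v *m z') 0 0 = 1 by rewrite z'E /g divfK ?gt_eqF //; lra.
have vz : (v *m z) 0 0 != 1.
  by apply/eqP => h; have := vk; rewrite tk ?ltxx // sP h eqxx.
have [||E fE hE] := IH z'.
- have le_V : (size (tight z') <= size V)%N by rewrite size_filter count_size.
  suff lt_s : (size (tight z) < size (tight z'))%N.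
    by rewrite -ltnS (leq_trans _ lt_n) // ltnS ltn_sub2l // (leq_trans lt_s).
  rewrite /tight !size_filter; apply: (@count_lt _ _ _ _ v) => //; last exact/eqP.
  by move=> w wV /eqP wz; rewrite tight'.
- move=> w wV; rewrite z'E.
  have [wk|wk] := ltP 0 ((w *m k) 0 0).
    have : g v <= g w by apply: vmin; rewrite mem_filter wk.
    rewrite {2}/g ler_pdivlMr //; lra.
  have := le_z w wV; have := mulr_ge0_le0 g0 wk; lra.
- by exists E => // w wV /(tight' w wV)/(hE w wV).
Qed.

End Polar.

(** * At most d vertices at each of the heights 1, 0 and -1 *)

Definition isint (R : numDomainType) (x : R) : Prop := exists z : int, x = z%:~R.

Lemma isintD (R : numDomainType) (x y : R) : isint x -> isint y -> isint (x + y).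
Proof. by move=> [a ->] [b ->]; exists (a + b); rewrite intrD. Qed.
Lemma isintN (R : numDomainType) (x : R) : isint x -> isint (- x).
Proof. by move=> [a ->]; exists (- a); rewrite intrN. Qed.
Lemma isint_lt1 (R : realFieldType) (x : R) : isint x -> x < 1 -> x <= 0.
Proof. by move=> [z ->]; rewrite ltrz1 lerz0; lia. Qed.
Lemma isint_gt0 (R : realFieldType) (x : R) : isint x -> 0 < x -> 1 <= x.
Proof. by move=> [z ->]; rewrite ltr0z ler1z; lia. Qed.

Lemma size_split3 (T : eqType) (a b c : pred T) (s : seq T) :
  {in s, forall x, a x + b x + c x = 1}%N ->
  size s = (count a s + count b s + count c s)%N.
Proof.
elim: s => //= x s IH h; rewrite IH; last by move=> y ys; apply: h; rewrite inE ys orbT.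
by have := h x (mem_head _ _); lia.
Qed.

Section SimplicialReflexive.
Variables (R : realFieldType) (d : nat) (V : seq 'rV[R]_d) (lat : 'rV[R]_d -> Prop).
Implicit Types (E G : 'M[R]_d) (x y v w : 'rV[R]_d).

(** What the counting uses of a simplicial reflexive polytope with vertices V. Reflexivity
    is [lat_level]: the vertices of the dual take integral values on the lattice.
    Simpliciality is [facet_rows]: a facet has only the d vertices of its basis. *)
Record simplicial_reflexive : Prop := SimplicialReflexive {
  vert_span : positively_spans V;
  vert_uniq : uniq V;
  vert_neq0 : 0 \notin V;
  vert_lat : forall v, v \in V -> lat v;
  lat_add : forall x y, lat x -> lat y -> lat (x + y);
  lat_level : forall E x, facet_basis V E -> lat x -> isint (level E x);
  facet_rows : forall E v, facet_basis V E -> v \in V -> level E v = 1 ->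
    exists i, v = row i E
}.

Hypothesis VP : simplicial_reflexive.

Lemma level_le0 E v : facet_basis V E -> v \in V -> level E v != 1 -> level E v <= 0.
Proof.
move=> fE vV v1; apply: isint_lt1; first exact: (lat_level VP fE (vert_lat VP vV)).
by have [_ _ /(_ v vV)] := fE; rewrite lt_neqAle v1.
Qed.

Definition neighbor E i v : Prop :=
  [/\ v \in V, coords E v 0 i < 0 & facet_basis V (exchange E i v)].

Lemma neighbor_le0 E i v : facet_basis V E -> neighbor E i v -> level E v <= 0.
Proof.
move=> fE [vV vi _]; apply: level_le0 => //; apply/eqP => v1.
have [k vk] := facet_rows VP fE vV v1; case: fE => uE _ _.
by move: vi; rewrite vk coords_row // ltNge ler0n.
Qed.

Lemma neighbor_level E i v x : facet_basis V E -> neighbor E i v ->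
  level E x = 0 -> coords E x 0 i < 0 -> 0 < level (exchange E i v) x.
Proof.
move=> fE nv x0 xi; have v0 := neighbor_le0 fE nv; case: nv fE => _ vi _ [uE _ _].
rewrite level_exchange ?lt_eqF // x0 add0r mulr_gt0 //; first lra.
by rewrite -mulrNN -invrN divr_gt0 // oppr_gt0.
Qed.

Definition inhull x : Prop := forall E, facet_basis V E -> level E x <= 1.

Lemma vert_inhull v : v \in V -> inhull v.
Proof. by move=> vV E [_ _ ->]. Qed.

Lemma neighbor_level1 E i v x : facet_basis V E -> neighbor E i v ->
  lat x -> inhull x ->
  level E x = 0 -> coords E x 0 i < 0 -> level (exchange E i v) x = 1.
Proof.
move=> fE nv xl xP x0 xi; have fE' : facet_basis V (exchange E i v) by case: nv.
apply: le_anti; rewrite xP //=.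
by apply: isint_gt0; [exact: (lat_level VP fE')|exact: neighbor_level].
Qed.

(** Such a vertex has positive level on the neighbouring facet, hence level 1 by
    integrality, hence belongs to that facet, whose only vertex off E is v. *)
Lemma neighbor_unique E i v x : facet_basis V E -> neighbor E i v ->
  x \in V -> level E x = 0 -> coords E x 0 i < 0 -> x = v.
Proof.
move=> fE nv xV x0 xi; have fE' : facet_basis V (exchange E i v) by case: nv.
have [k] := facet_rows VP fE' xV
  (neighbor_level1 fE nv (vert_lat VP xV) (vert_inhull xV) x0 xi).
rewrite row_exchange; case: eqP => // _ xk; have [uE _ _] := fE.
by move: x0; rewrite xk level_row // => /eqP; rewrite oner_eq0.
Qed.

Lemma neighborP E i : facet_basis V E -> exists v, neighbor E i v.
Proof. exact: (facet_neighbor (vert_span VP)). Qed.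

(** Otherwise x would lie beyond the neighbouring facet across the ridge where the k-th
    coordinate vanishes. *)
Lemma facet_coords_ge0 E x k : facet_basis V E -> inhull x -> level E x = 1 ->
  0 <= coords E x 0 k.
Proof.
move=> fE xP x1; have [v nv] := neighborP k fE.
rewrite leNgt; apply/negP => xk.
have v0 := neighbor_le0 fE nv; have [vV vk fE'] := nv; have [uE _ _] := fE.
have := xP _ fE'; rewrite level_exchange ?lt_eqF // x1.
rewrite gerDl leNgt mulr_gt0 //; first lra.
by rewrite -mulrNN -invrN divr_gt0 // oppr_gt0.
Qed.

(** The argument of [neighbor_unique] for a lattice point of the polytope: it lies on the
    neighbouring facet, so it is a convex combination of the vertices of that facet, and
    level 0 leaves no weight for those of level 1. *)
Lemma neighbor_lattice_unique E i v x : facet_basis V E -> neighbor E i v ->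
  level E v = 0 -> lat x -> inhull x -> level E x = 0 -> coords E x 0 i < 0 -> x = v.
Proof.
move=> fE nv v0 xl xP x0 xi; have x1 := neighbor_level1 fE nv xl xP x0 xi.
have [vV vi fE'] := nv; have [uE' _ _] := fE'; have [uE _ _] := fE.
set E' := exchange E i v in fE' uE' x1.
have c0 k : 0 <= coords E' x 0 k by exact: facet_coords_ge0.
have ck k : k != i -> coords E' x 0 k = 0.
  have : level E x = \sum_(k | k != i) coords E' x 0 k.
    rewrite [in LHS](coordsK x uE') level_sum (bigD1 i) //=.
    rewrite levelZ row_exchange eqxx v0 mulr0 add0r; apply: eq_bigr => j /negPf ji.
    by rewrite levelZ row_exchange ji level_row // mulr1.
  rewrite x0 => /esym/eqP; rewrite psumr_eq0 // => /allP h ki.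
  by apply/eqP; have := h k (mem_index_enum _); rewrite ki.
have ci : coords E' x 0 i = 1.
  by rewrite -x1 /level (bigD1 i) //= big1 ?addr0 // => k /ck.
rewrite (coordsK x uE') (bigD1 i) //= big1 => [|k /ck ->]; last by rewrite scale0r.
by rewrite ci scale1r addr0 row_exchange eqxx.
Qed.

Lemma level0_neg_coord E x : E \in unitmx -> level E x = 0 -> x != 0 ->
  exists i, coords E x 0 i < 0.
Proof.
move=> uE x0 xn0; apply/existsP; apply: contraNT xn0; rewrite negb_exists => /forallP h.
have c0 i : 0 <= coords E x 0 i by rewrite leNgt h.
apply/eqP; apply: (coords_inj uE) => i; rewrite coords0; apply/eqP.
move/eqP: x0; rewrite psumr_eq0 // => /allP/(_ i); rewrite mem_index_enum; exact.
Qed.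

Definition neighbors E (nb : 'I_d -> 'rV[R]_d) : Prop := forall i, neighbor E i (nb i).

Lemma neighborsP E : facet_basis V E -> exists nb, neighbors E nb.
Proof. by move=> fE; apply: fin_all_exists => i; exact: neighborP. Qed.

Definition slice E a := [seq v <- V | level E v == a].

Lemma slice_uniq E a : uniq (slice E a).
Proof. exact: filter_uniq (vert_uniq VP). Qed.

Lemma sliceP E a v : v \in slice E a = (level E v == a) && (v \in V).
Proof. exact: mem_filter. Qed.

Lemma slice1_sub E : facet_basis V E -> {subset slice E 1 <= codom (fun i => row i E)}.
Proof.
move=> fE v; rewrite sliceP => /andP[/eqP v1 vV].
by have [i ->] := facet_rows VP fE vV v1; exact: codom_f.
Qed.

(** A nonzero vector of level 0 has a negative coordinate, so [neighbor_unique] applies. *)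
Lemma slice0_sub E nb : facet_basis V E -> neighbors E nb ->
  {subset slice E 0 <= codom nb}.
Proof.
move=> fE nbE v; rewrite sliceP => /andP[/eqP v0 vV]; have [uE _ _] := fE.
have [|i vi] := level0_neg_coord uE v0.
  by apply: contraNneq (vert_neq0 VP) => <-.
by rewrite (neighbor_unique fE (nbE i) vV v0 vi); exact: codom_f.
Qed.

Lemma size_codom_ord (f : 'I_d -> 'rV[R]_d) : size (codom f) = d.
Proof. by rewrite size_codom card_ord. Qed.

Lemma size_slice1 E : facet_basis V E -> (size (slice E 1%R) <= d)%N.
Proof.
move=> fE; have := uniq_leq_size (slice_uniq E 1) (slice1_sub fE).
by rewrite size_codom_ord.
Qed.

Lemma size_slice0 E : facet_basis V E -> (size (slice E 0%R) <= d)%N.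
Proof.
move=> fE; have [nb nbE] := neighborsP fE.
by have := uniq_leq_size (slice_uniq E 0) (slice0_sub fE nbE); rewrite size_codom_ord.
Qed.

(** For u = - level E this says that - u lies in the dual polytope. *)
Definition opposed E : Prop := forall v, v \in V -> -1 <= level E v.

(** The vertices of level -1 are those where the point - u of the dual is tight: they form
    a face, which is contained in some facet. *)
Lemma opposite_facet E : facet_basis V E -> opposed E ->
  exists2 G, facet_basis V G & forall v, v \in V -> level E v = -1 -> level G v = 1.
Proof.
move=> fE oE; have [z zE] := level_form E.
have [|G fG hG] := face_in_facet (vert_span VP) (z := - z).
  by move=> v vV; rewrite mulmxN mxE -zE; have := oE v vV; lra.
by exists G => // v vV v1; apply: hG => //; rewrite mulmxN mxE -zE v1 opprK.
Qed.

Lemma size_sliceN1 E : facet_basis V E -> opposed E -> (size (slice E (-1)%R) <= d)%N.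
Proof.
move=> fE oE; have [G fG hG] := opposite_facet fE oE.
apply: leq_trans (size_slice1 fG); apply: uniq_leq_size (slice_uniq _ _) _ => v.
by rewrite !sliceP => /andP[/eqP v1 vV]; rewrite hG ?eqxx.
Qed.

Lemma level_cases E v : facet_basis V E -> opposed E -> v \in V ->
  [\/ level E v = 1, level E v = 0 | level E v = -1].
Proof.
move=> fE oE vV; have [z vz] := lat_level VP fE (vert_lat VP vV).
have := oE v vV; have [_ _ /(_ v vV)] := fE; rewrite vz.
rewrite -[-1 in X in _ -> X]/((-1)%:~R) lerz1 ler_int => h1 h2.
have : z = 1 \/ z = 0 \/ z = -1 by lia.
by case=> [->|[->|->]]; [constructor 1|constructor 2|constructor 3].
Qed.

Lemma size_slices E : facet_basis V E -> opposed E ->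
  size V = (size (slice E 1%R) + size (slice E 0%R) + size (slice E (-1)%R))%N.
Proof.
move=> fE oE; rewrite !size_filter.
have ne (x y : R) : x < y -> ((x == y) = false) * ((y == x) = false).
  by move=> xy; rewrite lt_eqF // gt_eqF.
have [[n01 n10] [n0m nm0]] := (ne 0 1 ltr01, ne (-1) 0 (ltrN10 R)).
have [n1m nm1] := ne (-1) 1 (lt_trans (ltrN10 R) ltr01).
apply: size_split3 => v vV.
by case: (level_cases fE oE vV) => ->; rewrite eqxx ?n01 ?n10 ?n0m ?nm0 ?n1m ?nm1.
Qed.

Lemma size_vert E : facet_basis V E -> opposed E -> (size V <= 3 * d)%N.
Proof.
move=> fE oE; rewrite (size_slices fE oE).
have := size_slice1 fE; have := size_slice0 fE; have := size_sliceN1 fE oE; lia.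
Qed.

End SimplicialReflexive.

(** * Polytopes with d vertices at height 0 *)

Section FullZeroSlice.
Variables (R : realFieldType) (d : nat) (V : seq 'rV[R]_d) (lat : 'rV[R]_d -> Prop).
Implicit Types (E G : 'M[R]_d) (x y v w : 'rV[R]_d).
Hypothesis VP : simplicial_reflexive V lat.

(** If d vertices have level 0, they are exactly the neighbours of the facet E across its d
    ridges. *)
Record full_slice0 E (nb : 'I_d -> 'rV[R]_d) : Prop := FullSlice0 {
  full_facet : facet_basis V E;
  full_nb : neighbors V E nb;
  full_level : forall i, level E (nb i) = 0;
  full_inj : injective nb;
  full_onto : forall v, v \in V -> level E v = 0 -> exists i, v = nb i
}.

Lemma full_slice0P E : facet_basis V E -> size (slice V E 0%R) = d ->
  exists nb, full_slice0 E nb.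
Proof.
move=> fE szE; have [nb nbE] := neighborsP VP fE; exists nb.
have sub := slice0_sub VP fE nbE.
have le : (size (codom nb) <= size (slice V E 0%R))%N by rewrite size_codom_ord szE.
have [_ eqm] := uniq_min_size (slice_uniq VP E 0) sub le.
split=> // [i||v vV v0].
- have : nb i \in slice V E 0 by rewrite eqm codom_f.
  by rewrite sliceP => /andP[/eqP].
- apply/injectiveP; exact: (leq_size_uniq (slice_uniq VP E 0) sub le).
- have : v \in codom nb by rewrite -eqm sliceP v0 eqxx.
  by move/codomP.
Qed.

Section OneFacet.
Variables (E : 'M[R]_d) (nb : 'I_d -> 'rV[R]_d).
Hypothesis full : full_slice0 E nb.

Let fE := full_facet full.
Let uE : E \in unitmx. Proof. by case: fE. Qed.
Let nbV i : nb i \in V. Proof. by case: (full_nb full i). Qed.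
Let rowV i : row i E \in V. Proof. by case: fE. Qed.

Lemma neg_coord_nb i k : coords E (nb i) 0 k < 0 -> k = i.
Proof.
move=> h; apply: (full_inj full); apply/esym.
exact: (neighbor_unique VP fE (full_nb full k) (nbV i) (full_level full i) h).
Qed.

(** By [level_exchange_nb], passing from E to its i-th neighbour lowers the level by depth i
    times the i-th coordinate, so these multiples are integers on the lattice. *)
Definition depth i : R := - (coords E (nb i) 0 i)^-1.

Lemma depth_gt0 i : 0 < depth i.
Proof. by rewrite oppr_gt0 invr_lt0; case: (full_nb full i). Qed.

Lemma depthV i : coords E (nb i) 0 i = - (depth i)^-1.
Proof. by rewrite /depth invrN opprK invrK. Qed.

Lemma level_exchange_nb i x :
  level (exchange E i (nb i)) x = level E x - depth i * coords E x 0 i.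
Proof.
have [_ h _] := full_nb full i.
by rewrite level_exchange ?lt_eqF // full_level // subr0 mul1r mulNr opprK mulrC.
Qed.

Lemma facet_nb i : facet_basis V (exchange E i (nb i)).
Proof. by case: (full_nb full i). Qed.

Lemma depth_int i x : lat x -> isint (depth i * coords E x 0 i).
Proof.
move=> xl; have -> : depth i * coords E x 0 i =
  level E x - level (exchange E i (nb i)) x by rewrite level_exchange_nb; ring.
apply: isintD; [|apply: isintN]; apply: (lat_level VP) => //; exact: facet_nb.
Qed.

Lemma depth_ge1 i : 1 <= depth i.
Proof.
apply: isint_gt0 (depth_gt0 i).
by have := depth_int i (vert_lat VP (rowV i)); rewrite coords_row // eqxx mulr1.
Qed.

(** The neighbouring facet has vertices of level 0 and 1 only, so a vertex w of level -1 is
    not on it and has level at most 0 there. *)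
Lemma opposite_coord_ge i w : w \in V -> level E w = -1 -> -1 <= depth i * coords E w 0 i.
Proof.
move=> wV w1; suff : level (exchange E i (nb i)) w <= 0.
  rewrite level_exchange_nb w1; lra.
apply: (level_le0 VP (facet_nb i) wV); apply/eqP => h.
have [k] := facet_rows VP (facet_nb i) wV h.
rewrite row_exchange; case: ifP => _ wk; move: w1; rewrite wk ?full_level ?level_row //; lra.
Qed.

Lemma lattice_slice0 x : lat x -> inhull V x -> level E x = 0 -> x != 0 ->
  exists i, x = nb i.
Proof.
move=> xl xP x0 xn0; have [i xi] := level0_neg_coord uE x0 xn0; exists i.
exact: (neighbor_lattice_unique VP fE (full_nb full i) (full_level full i)).
Qed.

(** The neighbour nb i lies in the direction of the edge from row i to row k. *)
Definition edge_step i k : Prop :=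
  k != i /\ nb i = (depth i)^-1 *: (row k E - row i E).

Lemma coords_edge i k l : edge_step i k ->
  coords E (nb i) 0 l = (depth i)^-1 * ((k == l)%:R - (i == l)%:R).
Proof. by case=> _ ->; rewrite coordsZ coordsD coordsN !coords_row. Qed.

(** A positive coordinate k of nb i is at least 1 / depth k, and the positive coordinates
    add up to 1 / depth i. If depth i is maximal there is room for only one of them. *)
Lemma max_depth_edge i : (forall k, depth k <= depth i) ->
  exists k, edge_step i k /\ depth k = depth i.
Proof.
move=> maxi; pose c k := coords E (nb i) 0 k.
have c0 k : k != i -> 0 <= c k.
  by move=> ki; rewrite leNgt; apply: contra ki => /neg_coord_nb ->.
have sumc : \sum_(k | k != i) c k = (depth i)^-1.
  have := full_level full i; rewrite /level (bigD1 i) //= depthV => h.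
  by rewrite -/(c) /c; apply/eqP; rewrite -subr_eq0 addrC h.
have [k /andP[ki ck]] : exists k, (k != i) && (0 < c k).
  apply/existsP; apply: contraT; rewrite negb_exists => /forallP h.
  have : 0 < (depth i)^-1 by rewrite invr_gt0 depth_gt0.
  rewrite -sumc big1 ?ltxx // => k ki; apply/eqP; rewrite eq_le c0 // andbT leNgt.
  by have := h k; rewrite ki.
have ck1 : (depth k)^-1 <= c k.
  have := isint_gt0 (depth_int k (vert_lat VP (nbV i))) (mulr_gt0 (depth_gt0 k) ck).
  by rewrite -/(c k) -ler_pdivrMl ?depth_gt0 // mulr1.
have dki : (depth i)^-1 <= (depth k)^-1 by rewrite lef_pV2 ?posrE ?depth_gt0.
have rest : \sum_(l | (l != i) && (l != k)) c l = (depth i)^-1 - c k.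
  by rewrite -sumc [in RHS](bigD1 k) //= addrAC subrr add0r.
have rest0 : 0 <= \sum_(l | (l != i) && (l != k)) c l.
  by apply: sumr_ge0 => l /andP[/c0].
have ckE : c k = (depth i)^-1 by lra.
have dkE : (depth k)^-1 = (depth i)^-1 by lra.
exists k; split; last by apply: invr_inj.
split=> //; apply: (coords_inj uE) => l; rewrite coordsZ coordsD coordsN !coords_row //.
rewrite [LHS]/(c l) ![_ == l]eq_sym.
have [->|li] := eqVneq l i; first by rewrite /c depthV eq_sym (negPf ki) sub0r mulrN1.
have [->|lk] := eqVneq l k; first by rewrite subr0 mulr1.
rewrite subrr mulr0; apply/eqP.
have : \sum_(l | (l != i) && (l != k)) c l == 0 by rewrite rest ckE subrr.
rewrite psumr_eq0; last by move=> m /andP[/c0].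
by move/allP/(_ l (mem_index_enum _)); rewrite li lk.
Qed.

(** If m differs from k, then on the facet obtained from E by exchanging row m for nb m both
    w and nb i have level 0 and a negative i-th coordinate. By [neighbor_unique] they
    coincide, although their levels on E are -1 and 0. *)
Lemma edge_step_sum i k m w : edge_step i k -> w \in V -> level E w = -1 ->
  row i E + w = nb m -> m = k.
Proof.
move=> ik wV w1 zm; have [ki nbi] := ik.
have wE : w = nb m - row i E by rewrite -zm addrC addKr.
have mi : m != i.
  apply/eqP => mi; have := opposite_coord_ge i wV w1.
  rewrite wE mi coordsD coordsN depthV coords_row_id // mulrDr mulrN divff ?gt_eqF ?depth_gt0 //.
  by have := depth_gt0 i; lra.
apply/eqP; apply: contraT => mk; pose F := exchange E m (nb m).
have fF : facet_basis V F := facet_nb m; have uF : F \in unitmx by case: fF.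
have rowF l : l != m -> row l F = row l E by move=> /negPf lm; rewrite row_exchange lm.
have rowm : row m F = nb m by rewrite row_exchange eqxx.
have im : i != m by rewrite eq_sym.
have km : k != m by rewrite eq_sym.
have [v nv] := neighborP VP i fF.
have w0 : level F w = 0 by rewrite wE -rowm -(rowF i) // levelD levelN !level_row // subrr.
have nbi0 : level F (nb i) = 0.
  by rewrite nbi -(rowF i) // -(rowF k) // levelZ levelD levelN !level_row // subrr mulr0.
have wi : coords F w 0 i < 0.
  rewrite wE -rowm -(rowF i) // coordsD coordsN coords_row_id // coords_row_neq //; lra.
have nbii : coords F (nb i) 0 i < 0.
  rewrite nbi -(rowF i) // -(rowF k) // coordsZ coordsD coordsN !coords_row // eqxx (negPf ki).
  by rewrite sub0r mulrN1 oppr_lt0 invr_gt0 depth_gt0.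
have := neighbor_unique VP fF nv wV w0 wi.
rewrite -(neighbor_unique VP fF nv (nbV i) nbi0 nbii) => wnb.
by move: w1; rewrite wnb full_level // => /eqP; rewrite eq_sym oppr_eq0 oner_eq0.
Qed.

End OneFacet.

Section TwoFacets.
Variables (E G : 'M[R]_d) (nb mb : 'I_d -> 'rV[R]_d).
Hypotheses (fullE : full_slice0 E nb) (fullG : full_slice0 G mb).
Hypothesis opp : forall x, level G x = - level E x.

Let fE := full_facet fullE.
Let fG := full_facet fullG.
Let uE : E \in unitmx. Proof. by case: fE. Qed.
Let uG : G \in unitmx. Proof. by case: fG. Qed.
Let rowEV i : row i E \in V. Proof. by case: fE. Qed.
Let rowGV i : row i G \in V. Proof. by case: fG. Qed.
Let nbV i : nb i \in V. Proof. by case: (full_nb fullE i). Qed.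
Let mbV i : mb i \in V. Proof. by case: (full_nb fullG i). Qed.

Let levelEG j : level E (row j G) = -1.
Proof. by rewrite -[level E _]opprK -opp level_row. Qed.

Let levelGE j : level G (row j E) = -1.
Proof. by rewrite opp level_row. Qed.

Let rowsNeq i j : row i E != row j G.
Proof.
apply/eqP => /(congr1 (level E)); rewrite level_row // levelEG => /eqP.
by rewrite -subr_eq0 opprK; have /gt_eqF -> : 0 < 1 + 1 :> R by lra.
Qed.

Lemma nb_mb i : exists j, nb i = mb j.
Proof. by apply: (full_onto fullG (nbV i)); rewrite opp (full_level fullE) oppr0. Qed.

(** By integrality the sum can only leave the polytope through a facet H that contains both
    vertices. The combination of the rows of E and that of the rows of G that
    represent nb i then force row i E, and all rows of G which occur, to lie on H as
    well, and the coordinates of nb i with respect to H at row k E disagree. *)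
Lemma edge_sum_inhull i k j : edge_step E nb i k -> nb i = mb j ->
  inhull V (row k E + row j G).
Proof.
move=> ik nm H fH; have [ki nbi] := ik; have [uH _ leH] := fH.
rewrite levelD.
have [ek|/(level_le0 VP fH (rowEV k)) h] := eqVneq (level H (row k E)) 1; last first.
  by have := leH _ (rowGV j); lra.
have [wj|/(level_le0 VP fH (rowGV j)) h] := eqVneq (level H (row j G)) 1; last first.
  by rewrite ek; lra.
exfalso; pose c l := coords G (mb j) 0 l.
have mbE : mb j = \sum_l c l *: row l G by exact: coordsK.
have cj : c j < 0 by case: (full_nb fullG j).
have c0 l : l != j -> 0 <= c l.
  by move=> lj; rewrite leNgt; apply: contra lj => /(neg_coord_nb fullG) ->.
have sumc : \sum_l c l = 0 by exact: (full_level fullG j).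
have slack l : 0 <= c l * (1 - level H (row l G)).
  have [->|/c0 cl] := eqVneq l j; first by rewrite wj subrr mulr0.
  by rewrite mulr_ge0 // subr_ge0 leH.
have sl : \sum_l c l * (1 - level H (row l G)) = - level H (nb i).
  rewrite (eq_bigr (fun l => c l - c l * level H (row l G))); last first.
    by move=> l _; rewrite mulrBr mulr1.
  rewrite sumrB sumc sub0r nm mbE level_sum; congr (- _).
  by apply: eq_bigr => l _; rewrite levelZ.
have dpos : 0 < (depth E nb i)^-1 by rewrite invr_gt0 (depth_gt0 fullE).
have lnb : level H (nb i) = (depth E nb i)^-1 * (1 - level H (row i E)).
  by rewrite nbi levelZ levelD levelN ek.
have lnb0 : 0 <= level H (nb i).
  by rewrite lnb mulr_ge0 ?subr_ge0 ?leH // ltW.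
have sum0 : \sum_l c l * (1 - level H (row l G)) = 0.
  by apply: le_anti; rewrite sumr_ge0 ?andbT // sl oppr_le0.
have ei : level H (row i E) = 1.
  have : level H (nb i) == 0 by rewrite -oppr_eq0 -sl sum0.
  by rewrite lnb mulf_eq0 gt_eqF //= subr_eq0 => /eqP.
have wl l : c l = 0 \/ level H (row l G) = 1.
  have : \sum_l c l * (1 - level H (row l G)) == 0 by rewrite sum0.
  rewrite psumr_eq0 // => /allP/(_ l (mem_index_enum _)).
  by rewrite mulf_eq0 subr_eq0 => /orP[/eqP|/eqP]; auto.
have [a aE] := facet_rows VP fH (rowEV k) ek.
have [b bE] := facet_rows VP fH (rowEV i) ei.
have ab : b != a.
  by apply: contraNneq ki => ba; apply/eqP; apply: (row_inj uE); rewrite /= aE bE ba.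
have : coords H (nb i) 0 a = (depth E nb i)^-1.
  by rewrite nbi coordsZ coordsD coordsN aE bE !coords_row // eqxx (negPf ab) subr0 mulr1.
rewrite nm mbE coords_sumE big1 => [h|l _]; first by move: dpos; rewrite -h ltxx.
rewrite coordsZ; case: (wl l) => [->|]; first by rewrite mul0r.
move=> /(facet_rows VP fH (rowGV l)) [e eE].
rewrite eE coords_row //; case: eqP => [ea|_]; last by rewrite mulr0.
by case/eqP: (rowsNeq k l); rewrite aE eE ea.
Qed.

(** The sum is a lattice point of the polytope of level 0, so it is 0 or some nb m by
    [lattice_slice0], and then m = l by [edge_step_sum]. *)
Lemma edge_sum_cases i k l j : edge_step E nb i k -> edge_step E nb k l -> nb i = mb j ->
  row k E + row j G = 0 \/ (row k E + row j G = nb l /\ l != i).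
Proof.
move=> ik kl nm; have zP := edge_sum_inhull ik nm; set z := _ + _ in zP *.
have [->|z0] := eqVneq z 0; [by left|right].
have zl : lat z by apply: (lat_add VP); exact: (vert_lat VP).
have lz : level E z = 0 by rewrite levelD level_row // levelEG subrr.
have [m zm] := lattice_slice0 fullE zl zP lz z0.
have ml : m = l by apply: (edge_step_sum fullE kl (rowGV j) (levelEG j)).
rewrite zm ml; split=> //; apply/eqP => li.
have kE : row k E = mb j - row j G by rewrite -nm -li -ml -zm addrK.
have := opposite_coord_ge fullG j (rowEV k) (levelGE k).
have dj := depth_gt0 fullG j.
rewrite kE coordsD coordsN (depthV G mb) coords_row_id // mulrDr mulrN divff ?gt_eqF //.
by lra.
Qed.

(** Start from a neighbour of maximal depth and follow edge steps a -> k -> l -> m along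
    neighbours of the same depth. In every case [edge_sum_cases] yields a vertex of
    level -1 with coordinate -1 at a row of maximal depth, so [opposite_coord_ge] bounds
    that depth by 1. *)
Lemma depth1 i : depth E nb i = 1.
Proof.
have [|a _ maxa] := @seq_argmin _ _ (fun k => - depth E nb k) (enum 'I_d).
  by apply/eqP => h; have := mem_enum 'I_d i; rewrite h.
have {}maxa k : depth E nb k <= depth E nb a by rewrite -lerN2 maxa // mem_enum.
suff le1 : depth E nb a <= 1.
  by apply: le_anti; rewrite (le_trans (maxa i)) //= depth_ge1.
have mx b : depth E nb b = depth E nb a -> forall k, depth E nb k <= depth E nb b.
  by move=> ->.
have [k [ak dk]] := max_depth_edge fullE maxa.
have [l [kl dl]] := max_depth_edge fullE (mx _ dk); rewrite dk in dl.
have [m [lm dm]] := max_depth_edge fullE (mx _ dl).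
have depth_le1 e w : w \in V -> level E w = -1 -> depth E nb e = depth E nb a ->
    coords E w 0 e = -1 -> depth E nb a <= 1.
  move=> wV w1 de we; have := opposite_coord_ge fullE e wV w1.
  rewrite we de; lra.
have zero e j : depth E nb e = depth E nb a -> row e E + row j G = 0 -> depth E nb a <= 1.
  move=> de /eqP; rewrite addrC addr_eq0 => /eqP wE.
  apply: (depth_le1 e (row j G)) => //.
  by rewrite wE coordsN coords_row // eqxx.
have [j aj] := nb_mb a.
have [z0|[zl la]] := edge_sum_cases ak kl aj; first exact: (zero k j).
have [mk|mk] := eqVneq m k.
  rewrite mk in lm; have [j' kj'] := nb_mb k.
  have [z0|[_]] := edge_sum_cases kl lm kj'; last by rewrite eqxx.
  exact: (zero l j').
apply: (depth_le1 k (row j G)) => //.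
have -> : row j G = nb l - row k E by rewrite -zl addrC addKr.
have [lk _] := kl.
rewrite coordsD coordsN (coords_edge fullE _ lm) coords_row // eqxx (negPf mk) (negPf lk).
by rewrite subrr mulr0 sub0r.
Qed.

End TwoFacets.
End FullZeroSlice.

Section Extremal.
Variables (R : realFieldType) (d : nat) (V : seq 'rV[R]_d) (lat : 'rV[R]_d -> Prop).
Implicit Types (E G : 'M[R]_d) (x y v w : 'rV[R]_d).
Hypothesis VP : simplicial_reflexive V lat.

(** Equality in the count leaves d vertices at each height, so those of level -1 are all the
    vertices of the facet G that contains them, and level G is - level E. *)
Lemma opposite_full E : facet_basis V E -> opposed V E -> size V = (3 * d)%N ->
  exists G nb mb, [/\ full_slice0 V E nb, full_slice0 V G mb &
    forall x, level G x = - level E x].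
Proof.
move=> fE oE szV.
have := size_slices VP fE oE; rewrite szV => sz.
have s1 := size_slice1 VP fE; have s0 := size_slice0 VP fE.
have sm := size_sliceN1 VP fE oE.
have e0 : size (slice V E 0%R) = d by lia.
have em : size (slice V E (-1)%R) = d by lia.
have [G fG hG] := opposite_facet VP fE oE; have [uG VG _] := fG.
have sub : {subset slice V E (-1) <= codom (fun i => row i G)}.
  move=> v; rewrite sliceP => /andP[/eqP vm vV].
  by have [i ->] := facet_rows VP fG vV (hG v vV vm); exact: codom_f.
have le : (size (codom (fun i => row i G)) <= size (slice V E (-1)%R))%N.
  by rewrite size_codom_ord em.
have [_ eqm] := uniq_min_size (slice_uniq VP E (-1)) sub le.
have opp x : level G x = - level E x.
  rewrite (@level_rows _ _ E G (-1)) ?mulN1r ?opprK // => i.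
  have : row i G \in slice V E (-1) by rewrite eqm (codom_f (fun i => row i G)).
  by rewrite sliceP => /andP[/eqP].
have [nb nbE] := full_slice0P VP fE e0.
have slG : slice V G 0 = slice V E 0.
  by apply: eq_filter => v; rewrite opp oppr_eq0.
have [|mb mbG] := full_slice0P VP fG; first by rewrite slG.
by exists G, nb, mb.
Qed.

(** All depths are 1, so every nb i is an edge vector row (s i) E - row i E, and every vertex
    of level -1 is some - row i E by [edge_sum_cases]. *)
Lemma extremal_vertices E :
  facet_basis V E -> opposed V E -> size V = (3 * d)%N ->
  exists s : 'I_d -> 'I_d,
  [/\ forall i, s i != i, forall i, s (s i) = i,
      forall x i, lat x -> isint (coords E x 0 i) &
      forall v, v \in V <->
        exists i, [\/ v = row i E, v = - row i E | v = row (s i) E - row i E]].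
Proof.
move=> fE oE szV; have [G [nb [mb [fullE fullG opp]]]] := opposite_full fE oE szV.
have oppE x : level E x = - level G x by rewrite opp opprK.
have dE := depth1 VP fullE fullG opp; have dG := depth1 VP fullG fullE oppE.
have [uE VE _] := fE; have [uG VG _] := full_facet fullG.
have levelEG j : level E (row j G) = -1 by rewrite oppE level_row.
have edges F nf : full_slice0 V F nf -> (forall i, depth F nf i = 1) ->
    exists s, forall i, edge_step F nf i (s i).
  move=> fullF dF; apply: fin_all_exists => i.
  have [|k []] := max_depth_edge VP fullF (i := i); first by move=> k; rewrite !dF.
  by exists k.
have [s sE] := edges E nb fullE dE; have [t tG] := edges G mb fullG dG.
have nbE i : nb i = row (s i) E - row i E.
  by have [_ ->] := sE i; rewrite dE invr1 scale1r.
have mbG j : mb j = row (t j) G - row j G.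
  by have [_ ->] := tG j; rewrite dG invr1 scale1r.
have sn i : s i != i by case: (sE i).
have nbV i : nb i \in V by case: (full_nb fullE i).
have zero i j : nb i = mb j -> row (s i) E + row j G = 0.
  move=> ij.
  case: (edge_sum_cases VP fullE fullG opp (sE i) (sE (s i)) ij) => [//|[z _]].
  have z' : row i E + row (t j) G = nb (s (s i)).
    have e : row (s i) E = row (t j) G - row j G + row i E by rewrite -mbG -ij nbE subrK.
    by rewrite -z e addrAC subrK addrC.
  have := edge_step_sum VP fullE (sE i) (VG (t j)) (levelEG (t j)) z'.
  by move=> h; have := sn (s i); rewrite h eqxx.
have opps i j : nb i = mb j -> row j G = - row (s i) E.
  by move/zero/eqP; rewrite addrC addr_eq0 => /eqP.
have oppt i j : nb i = mb j -> row (t j) G = - row i E.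
  move=> ij; have := opps _ _ ij; have := ij; rewrite nbE mbG => e r.
  by rewrite r opprK in e; apply: (addIr (row (s i) E)); rewrite -e addrC.
have NV i : - row i E \in V.
  by have [j /oppt <-] := nb_mb fullE fullG opp i.
have ss i : s (s i) = i.
  apply/eqP; apply: contraT => ssi.
  pose x := row (s (s i)) E - row i E.
  have xE : x = nb i + nb (s i) by rewrite !nbE addrC addrA subrK.
  have xE' : x = row (s (s i)) E + - row i E by [].
  have x0 : x != 0.
    by rewrite subr_eq0; apply: contra ssi => /eqP /(row_inj uE) ->.
  have lx : level E x = 0 by rewrite xE levelD !(full_level fullE) addr0.
  have latx : lat x by apply: (lat_add VP); exact: (vert_lat VP).
  (* If x = nb i + nb (s i) were nonzero, it would be a lattice point of level 0, hence
     nb i. To see that x is in the polytope: a facet containing nb i and nb (s i) would also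
     contain row (s (s i)) E and - row i E, which have the same sum, and its rows are
     independent. *)
  have inx : inhull V x.
    move=> H fH; have [uH VH leH] := fH.
    have [h1|/(level_le0 VP fH (nbV i)) h] := eqVneq (level H (nb i)) 1; last first.
      by have := leH _ (nbV (s i)); rewrite xE levelD; lra.
    have [h2|/(level_le0 VP fH (nbV (s i))) h] := eqVneq (level H (nb (s i))) 1; last first.
      by rewrite xE levelD; lra.
    have hx : level H x = 1 + 1 by rewrite xE levelD h1 h2.
    have le1 := leH _ (VE (s (s i))); have le2 := leH _ (NV i).
    have h3 : level H (row (s (s i)) E) = 1 by move: hx; rewrite xE' levelD; lra.
    have h4 : level H (- row i E) = 1 by move: hx; rewrite xE' levelD; lra.
    have [a aE] := facet_rows VP fH (nbV i) h1.
    have [b bE] := facet_rows VP fH (nbV (s i)) h2.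
    have [c cE] := facet_rows VP fH (VE (s (s i))) h3.
    have [e eE] := facet_rows VP fH (NV i) h4.
    have ba : b != a.
      by apply: contraNneq (sn i) => ab; apply/eqP/(full_inj fullE); rewrite aE bE ab.
    have ca : c != a.
      apply/eqP => ca; have := full_level fullE i; rewrite aE -ca -cE level_row //.
      by move/eqP; rewrite oner_eq0.
    have ea : e != a.
      apply/eqP => ea; have := full_level fullE i; rewrite aE -ea -eE levelN level_row //.
      by move/eqP; rewrite oppr_eq0 oner_eq0.
    have : coords H x 0 a = 1.
      by rewrite xE coordsD aE bE coords_row_id // coords_row_neq // addr0.
    rewrite xE' coordsD cE eE !coords_row_neq // addr0 => /eqP.
    by rewrite eq_sym oner_eq0.
  have [m xm] := lattice_slice0 VP fullE latx inx lx x0.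
  have im : i = m.
    apply: (neg_coord_nb VP fullE); rewrite -xm /x coordsD coordsN coords_row_id //.
    by rewrite coords_row_neq // sub0r ltrN10.
  have := xm; rewrite -im nbE /x => /addIr /(row_inj uE) h.
  by have := sn (s i); rewrite h eqxx.
exists s; split=> // [x i xl|v].
  by have := depth_int VP fullE i xl; rewrite dE mul1r.
split=> [vV|[i [->|->|->]]] //; last by rewrite -nbE.
case: (level_cases VP fE oE vV) => lv.
- by have [i vi] := facet_rows VP fE vV lv; exists i; constructor 1.
- by have [i vi] := full_onto fullE vV lv; exists i; constructor 3; rewrite vi nbE.
- have [|j vj] := facet_rows VP (full_facet fullG) vV; first by rewrite opp lv opprK.
  have [i ij] : exists i, mb j = nb i.
    apply: (full_onto fullE); first by case: (full_nb fullG j).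
    by rewrite oppE (full_level fullG) oppr0.
  by exists (s i); constructor 2; rewrite vj; apply: opps.
Qed.

End Extremal.

(** * Farkas' lemma and separation from a polytope *)

Section Pairing.
Variables (K : comPzRingType) (d : nat).
Implicit Types x y z : 'rV[K]_d.

Lemma pairingE x y : pairing x y = (x *m y^T) 0 0.
Proof. by rewrite mxE; apply: eq_bigr => i _; rewrite mxE !ord1. Qed.
Lemma pairingC x y : pairing x y = pairing y x.
Proof. by apply: eq_bigr => i _; rewrite mulrC. Qed.
Lemma pairingDl x y z : pairing (x + y) z = pairing x z + pairing y z.
Proof. by rewrite !pairingE mulmxDl mxE. Qed.
Lemma pairingZl a x y : pairing (a *: x) y = a * pairing x y.
Proof. by rewrite !pairingE -scalemxAl mxE. Qed.
Lemma pairingDr x y z : pairing x (y + z) = pairing x y + pairing x z.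
Proof. by rewrite !(pairingC x) pairingDl. Qed.
Lemma pairingZr a x y : pairing x (a *: y) = a * pairing x y.
Proof. by rewrite !(pairingC x) pairingZl. Qed.
Lemma pairing0l x : pairing 0 x = 0.
Proof. by rewrite pairingE mul0mx mxE. Qed.
Lemma pairing0r x : pairing x 0 = 0.
Proof. by rewrite pairingC pairing0l. Qed.
Lemma pairing_suml n (f : 'I_n -> 'rV_d) y : pairing (\sum_i f i) y = \sum_i pairing (f i) y.
Proof. by rewrite pairingE mulmx_suml summxE; apply: eq_bigr => i _; rewrite pairingE. Qed.
Lemma pairing_sumr n (f : 'I_n -> 'rV_d) x : pairing x (\sum_i f i) = \sum_i pairing x (f i).
Proof. by rewrite pairingC pairing_suml; apply: eq_bigr => i _; rewrite pairingC. Qed.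
End Pairing.

Lemma pairing_mulmx (K : comPzRingType) d e (A : 'M[K]_(e, d)) (x : 'rV_e) (y : 'rV_d) :
  pairing (x *m A) y = pairing x (y *m A^T).
Proof. by rewrite !pairingE trmx_mul trmxK mulmxA. Qed.

Lemma pairingNl (K : comPzRingType) d (x y : 'rV[K]_d) : pairing (- x) y = - pairing x y.
Proof. by rewrite -scaleN1r pairingZl mulN1r. Qed.
Lemma pairingNr (K : comPzRingType) d (x y : 'rV[K]_d) : pairing x (- y) = - pairing x y.
Proof. by rewrite pairingC pairingNl pairingC. Qed.
Lemma pairing_delta (K : comPzRingType) d (x : 'rV[K]_d) i : pairing x (delta_mx 0 i) = x 0 i.
Proof.
rewrite /pairing (bigD1 i) //= big1 => [|j ji]; rewrite ?mxE ?eqxx ?mulr1 ?addr0 //.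
by rewrite (negPf ji) mulr0.
Qed.

Lemma pairing_self_gt0 (R : realFieldType) d (x : 'rV[R]_d) : x != 0 -> 0 < pairing x x.
Proof.
move=> x0; have sq i : 0 <= x 0 i * x 0 i by rewrite -expr2 sqr_ge0.
rewrite lt_neqAle sumr_ge0 // andbT eq_sym; apply: contra x0 => /eqP h.
apply/eqP/rowP => i; rewrite mxE; apply/eqP.
have /eqP := psumr_eq0P (fun i _ => sq i) h (i := i) isT.
by rewrite mulf_eq0 orbb.
Qed.

Section Farkas.
Variable R : realFieldType.

Lemma form_lin m (x : 'rV[R]_m) (u v : 'cV[R]_m) k :
  (x *m (u + k *: v)) 0 0 = (x *m u) 0 0 + k * (x *m v) 0 0.
Proof. by rewrite mulmxDr -scalemxAr [LHS]mxE [X in _ + X]mxE. Qed.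

(** Induction on the number of generators. If the first n do not suffice, some z0 separates b
    from them, and z0 is negative on a n; the projection along a n onto the hyperplane
    where z0 vanishes reduces the claim to n generators. *)
Lemma farkas m n (a : nat -> 'rV[R]_m) (b : 'rV[R]_m) :
  (forall z : 'cV_m, (forall i, (i < n)%N -> 0 <= (a i *m z) 0 0) -> 0 <= (b *m z) 0 0) ->
  exists2 c : nat -> R, forall i, 0 <= c i & b = \sum_(i < n) c i *: a i.
Proof.
elim: n a b => [|n IH] a b h.
  exists (fun=> 0) => //; rewrite big_ord0.
  have := h (- b^T); move=> /(_ (fun i lti => False_ind _ (notF lti))).
  rewrite mulmxN mxE oppr_ge0 -pairingE => le0.
  by apply/eqP; apply: contraLR le0 => /pairing_self_gt0; rewrite ltNge.
have [h'|nh] := EM (forall z : 'cV_m,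
    (forall i, (i < n)%N -> 0 <= (a i *m z) 0 0) -> 0 <= (b *m z) 0 0).
  have [c c0 ->] := IH a b h'; exists (fun i => if i == n then 0 else c i).
    by move=> i; case: ifP.
  rewrite big_ord_recr /= eqxx scale0r addr0; apply: eq_bigr => i _.
  by rewrite (ltn_eqF (ltn_ord i)).
have [z0 az0 bz0] : exists2 z : 'cV_m,
    forall i, (i < n)%N -> 0 <= (a i *m z) 0 0 & (b *m z) 0 0 < 0.
  apply: contrapT => hn; apply: nh => z az; rewrite leNgt; apply/negP => bz.
  by apply: hn; exists z.
have anz : (a n *m z0) 0 0 < 0.
  rewrite ltNge; apply/negP => an; move: bz0; rewrite ltNge => /negP; apply.
  apply: h => i; rewrite ltnS leq_eqVlt => /orP[/eqP->//|]; exact: az0.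
pose t := - ((a n *m z0) 0 0)^-1.
have t0 : 0 < t by rewrite oppr_gt0 invr_lt0.
have tan : t * (a n *m z0) 0 0 = -1 by rewrite mulNr mulVf ?lt_eqF.
pose pr (x : 'rV[R]_m) := x + (t * (x *m z0) 0 0) *: a n.
have prE (x : 'rV[R]_m) (z : 'cV_m) :
    (pr x *m z) 0 0 = (x *m (z + (t * (a n *m z) 0 0) *: z0)) 0 0.
  rewrite mulmxDl mulmxDr -scalemxAl -scalemxAr !mxE; ring.
have [|c c0 prb] := IH (fun i => pr (a i)) (pr b).
  move=> z az; rewrite prE; apply: h => i; rewrite ltnS leq_eqVlt => /orP[/eqP->|/az].
    by rewrite form_lin mulrAC tan mulN1r subrr.
  by rewrite prE.
pose cn := \sum_(i < n) c i * (t * (a i *m z0) 0 0) - t * (b *m z0) 0 0.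
exists (fun i => if i == n then cn else c i).
  move=> i; case: ifP => // _; rewrite addr_ge0 //.
    by apply: sumr_ge0 => j _; rewrite !mulr_ge0 ?az0 // ltW.
  by rewrite oppr_ge0 nmulr_lle0 // ltW.
rewrite big_ord_recr /= eqxx.
rewrite (eq_bigr (fun i : 'I_n => c i *: pr (a i) - (c i * (t * (a i *m z0) 0 0)) *: a n)).
  rewrite sumrB -prb -scaler_suml /cn scalerBl /pr.
  by rewrite addrA subrK addrK.
by move=> i _; rewrite (ltn_eqF (ltn_ord i)) scalerDr scalerA addrK.
Qed.

End Farkas.

Section Hull.
Variables (R : realType) (d : nat).
Implicit Types (A : set 'rV[R]_d) (s : seq 'rV[R]_d) (x y : 'rV[R]_d).

Lemma convex_setP (M : set 'rV[R]_d) : convex_set M <->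
  forall x y (t : R), M x -> M y -> 0 <= t <= 1 -> M (t *: x + (1 - t) *: y).
Proof.
split=> [cM x y t Mx My /andP[t0 t1]|cM x y t].
  have := cM x y (Itv01 t0 t1); rewrite !inE => /(_ Mx My); exact.
rewrite !inE => Mx My; apply: (cM x y t%:num) => //.
by rewrite ge0 le1.
Qed.

Lemma hull_combination A n (c : nat -> R) (p : nat -> 'rV[R]_d) :
  (forall i, (i < n)%N -> A (p i)) -> (forall i, 0 <= c i) -> \sum_(i < n) c i = 1 ->
  hull A (\sum_(i < n) c i *: p i).
Proof.
move=> Ap c0 c1 M [/convex_setP cM AM].
elim: n c Ap c0 c1 => [|n IH] c Ap c0; first by rewrite big_ord0 => /eqP; rewrite eq_sym oner_eq0.
rewrite !big_ord_recr /= => c1; set S := \sum_(i < n) c i in c1.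
have S0 : 0 <= S by exact: sumr_ge0.
have [S0'|Sn] := eqVneq S 0.
  rewrite big1 => [|i _]; last first.
    move/eqP: S0'; rewrite psumr_eq0 // => /allP/(_ i (mem_index_enum _))/eqP ->.
    by rewrite scale0r.
  by move: c1; rewrite S0' !add0r => ->; rewrite scale1r; apply/AM/Ap.
have SE : 1 - S = c n by rewrite -c1 addrAC subrr add0r.
have -> : \sum_(i < n) c i *: p i = S *: \sum_(i < n) (S^-1 * c i) *: p i.
  by rewrite scaler_sumr; apply: eq_bigr => i _; rewrite scalerA mulrA divff // mul1r.
rewrite -SE; apply: cM.
- apply: (IH (fun i => S^-1 * c i)) => [i ltin|i|]; first by apply: Ap; exact: ltnW.
    by rewrite mulr_ge0 ?invr_ge0.
  by rewrite -mulr_sumr mulVf.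
- exact/AM/Ap.
- by rewrite S0 /=; have := c0 n; lra.
Qed.

Lemma hull_ge A y t : (forall a, A a -> t <= pairing a y) ->
  forall x, hull A x -> t <= pairing x y.
Proof.
move=> hA x /(_ [set x | t <= pairing x y]); apply; split=> //.
apply/convex_setP => u v r /= hu hv /andP[r0 r1].
rewrite pairingDl !pairingZl; have r1' : 0 <= 1 - r by lra.
by have := ler_wpM2l r0 hu; have := ler_wpM2l r1' hv; lra.
Qed.

(** This covers open half-spaces, exposed points, and lexicographic half-spaces given by one
    form and then another. *)
Lemma convex_lex (Q : set 'rV[R]_d) y t : convex_set Q ->
  convex_set [set x | t < pairing x y \/ pairing x y = t /\ Q x].
Proof.
move=> /convex_setP cQ; apply/convex_setP => a b r Ma Mb /andP[r0 r1].
have [->|rn1] := eqVneq r 1; first by rewrite subrr scale0r addr0 scale1r.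
have [->|rn0] := eqVneq r 0; first by rewrite subr0 scale0r add0r scale1r.
have {}rn0 : 0 < r by rewrite lt_neqAle eq_sym rn0.
have {}rn1 : 0 < 1 - r by rewrite subr_gt0 lt_neqAle rn1.
case: Ma Mb => [ha|[ha qa]] [hb|[hb qb]]; last first.
  by right; split; [rewrite pairingDl !pairingZl ha hb; ring|apply: cQ; rewrite ?r0].
all: left; rewrite pairingDl !pairingZl ?ha ?hb; nra.
Qed.

Lemma hull_gt A y t : (forall a, A a -> t < pairing a y) ->
  forall x, hull A x -> t < pairing x y.
Proof.
move=> hA x /(_ [set x | t < pairing x y \/ pairing x y = t /\ set0 x]).
have c0 : convex_set (set0 : set 'rV[R]_d) by apply/convex_setP.
by case=> [|//|[_ []]]; split; [exact: convex_lex|move=> a /hA; left].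
Qed.

Lemma sub_hull A : A `<=` hull A.
Proof. exact: sub_gen_smallest. Qed.

(** Farkas' lemma one dimension higher: a last coordinate 1 turns affine forms into linear
    ones, and conic combinations into convex ones. *)
Lemma hull_separation s x :
  (forall y t, (forall a, a \in s -> t <= pairing a y) -> t <= pairing x y) ->
  hull [set` s] x.
Proof.
move=> h; pose a i := row_mx (nth 0 s i) (1%:M : 'M[R]_1).
have rowE (v : 'rV[R]_d) (z : 'cV_(d + 1)) :
    (row_mx v 1%:M *m z) 0 0 = pairing v (usubmx z)^T + z (rshift d 0) 0.
  by rewrite -[z in LHS]vsubmxK mul_row_col mul1mx pairingE trmxK [LHS]mxE; congr (_ + _); rewrite mxE.
have [z az|c c0 xE] := @farkas _ _ (size s) a (row_mx x 1%:M).
  rewrite rowE -lerBlDr sub0r; apply: h => v vs.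
  have := az (index v s); rewrite index_mem => /(_ vs).
  by rewrite /a rowE nth_index // -lerBlDr sub0r.
have c1 : \sum_(i < size s) c i = 1.
  transitivity ((row_mx x (1%:M : 'M[R]_1)) 0 (rshift d 0)).
    rewrite xE summxE; apply: eq_bigr => i _.
    by rewrite mxE row_mxEr mxE eqxx mulr1.
  by rewrite row_mxEr mxE eqxx.
have -> : x = \sum_(i < size s) c i *: nth 0 s i.
  rewrite -[x](row_mxKl x (1%:M : 'M[R]_1)) xE linear_sum; apply: eq_bigr => i _.
  by rewrite linearZ /= row_mxKl.
by apply: hull_combination => // i; exact: mem_nth.
Qed.

End Hull.

Section Polytopes.
Variables (R : realType) (d : nat).
Implicit Types (A B P : set 'rV[R]_d) (s : seq 'rV[R]_d) (x y v : 'rV[R]_d).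

Lemma hull_convex A : convex_set (hull A).
Proof.
move=> x y t; rewrite !inE => hx hy M [cM AM].
by have := cM x y t; rewrite !inE; apply; [apply: hx|apply: hy].
Qed.

Lemma hull_sub A B : A `<=` hull B -> hull A `<=` hull B.
Proof. by move=> AB; apply: smallest_sub => //; exact: hull_convex. Qed.

Lemma hull_mono A B : A `<=` B -> hull A `<=` hull B.
Proof. by move=> AB; apply: hull_sub => x /AB /sub_hull. Qed.

Lemma vertices_sub P v : vertices P v -> P v.
Proof.
move=> [a [b [_ h]]]; have : [set v] v by [].
by rewrite h => -[].
Qed.

Lemma vertices_generator P A v : vertices P v -> A `<=` P -> hull A v -> A v.
Proof.
move=> [a [b [le_b eq_b]]] AP Av; apply: contrapT => nAv.
have : - b < pairing v (- a).
  apply: (hull_gt (A := A)) => // w Aw.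
  rewrite pairingNr ltrN2 lt_neqAle le_b ?andbT; last exact: AP.
  apply/eqP => h; have : [set v] w by rewrite eq_b; split; [exact: AP|].
  by move=> /= wv; apply: nAv; rewrite -wv.
rewrite pairingNr ltrN2 ltNge => /negP; apply.
have : [set v] v by [].
by rewrite eq_b => -[_ ->].
Qed.

Lemma hull_exposed s v y : v \in s ->
  (forall w, w \in s -> w != v -> pairing v y < pairing w y) -> vertices (hull [set` s]) v.
Proof.
move=> vs hs; pose M := [set x : 'rV[R]_d | pairing v y < pairing x y \/
  pairing x y = pairing v y /\ [set v] x].
have subM : hull [set` s] `<=` M.
  apply: smallest_sub => [|w /= ws]; last first.
    by have [->|wv] := eqVneq w v; [right|left; apply: hs].
  apply: convex_lex; apply/convex_setP => a b t /= -> -> _.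
  by rewrite -scalerDl addrC subrK scale1r.
exists (- y), (- pairing v y); split=> [x /subM [h|[h _]]|].
- by rewrite pairingNr lerN2 ltW.
- by rewrite pairingNr h.
apply/seteqP; split=> x /= => [->|[/subM [h|[_ ->//]]]].
  by split; [apply: sub_hull|rewrite pairingNr].
by rewrite pairingNr => /oppr_inj e; move: h; rewrite e ltxx.
Qed.

(** A shortest list of generators consists of vertices: none of its members is in the hull
    of the others, so each can be separated from them. *)
Lemma polytope_vertices P : polytope P ->
  exists s, [/\ uniq s, P = hull [set` s] & vertices P = [set` s]].
Proof.
move=> [A /finite_seqP[s0 ->] PE].
pose gen n := `[< exists2 s, size s = n & P = hull [set` s] >].
have [|n /asboolP[s sn Ps] nmin] := @ex_minnP gen.
  by exists (size s0); apply/asboolP; exists s0.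
have smin s' : P = hull [set` s'] -> (size s <= size s')%N.
  by move=> h; rewrite sn; apply: nmin; apply/asboolP; exists s'.
have us : uniq s.
  have := smin (undup s); rewrite leqNgt ltn_size_undup negbK; apply.
  by rewrite Ps; congr hull; apply/seteqP; split=> x /=; rewrite mem_undup.
exists s; split=> //; apply/seteqP; split=> [v vP|v /= vs].
  apply: (vertices_generator vP); first by rewrite Ps; exact: sub_hull.
  by rewrite -Ps; exact: vertices_sub.
rewrite Ps; have : ~ hull [set` rem v s] v.
  move=> hv; have := smin (rem v s); rewrite size_rem // leqNgt.
  have s0' : (0 < size s)%N by case: (s) vs.
  rewrite prednK // leqnn => /(_ _)/notF; apply.
  rewrite Ps; apply/seteqP; split; last by apply: hull_mono => x /=; exact: mem_rem.
  apply: hull_sub => x /= xs; have [->//|xv] := eqVneq x v.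
  by apply: sub_hull; rewrite /= mem_rem_uniq // inE xv.
move=> nh; have [y [t [hy vy]]] : exists y t,
    (forall a, a \in rem v s -> t <= pairing a y) /\ pairing v y < t.
  apply: contrapT => h; apply: nh; apply: hull_separation => y t hy.
  by rewrite leNgt; apply/negP => vy; apply: h; exists y, t.
apply: (hull_exposed (y := y)) => // w ws wv; apply: lt_le_trans vy _.
by apply: hy; rewrite mem_rem_uniq // inE wv.
Qed.

Lemma dual_hull s : dual (hull [set` s]) = [set y | forall v, v \in s -> -1 <= pairing v y].
Proof.
apply/seteqP; split=> y /= h; first by move=> v vs; apply: h; exact: sub_hull.
by apply: hull_ge => v /=; exact: h.
Qed.

Lemma positively_spansP s : positively_spans s <->
  forall y, y != 0 -> exists2 v, v \in s & pairing v y < 0.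
Proof.
split=> h y y0.
  have [|v vs] := h y^T; first by rewrite trmx_eq0.
  by rewrite -pairingE; exists v.
have [|v vs] := h y^T; first by rewrite trmx_eq0.
by rewrite pairingE trmxK; exists v.
Qed.

(** The bipolar theorem: since s spans positively, an affine form bounded below on s has a
    negative lower bound, which can be scaled to -1. *)
Lemma polar_hull s x : s != [::] -> positively_spans s ->
  (forall y, (forall v, v \in s -> -1 <= pairing v y) -> -1 <= pairing x y) ->
  hull [set` s] x.
Proof.
move=> s0 /positively_spansP sp hx; apply: hull_separation => y t ht.
have [y0|yn0] := eqVneq y 0.
  case: s s0 ht {sp hx} => // a s _ /(_ a (mem_head _ _)).
  by rewrite y0 !pairing0r.
have [v vs vy] := sp y yn0; have t0 : t < 0 := le_lt_trans (ht v vs) vy.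
have := hx ((- t)^-1 *: y); rewrite pairingZr.
have nt : 0 < - t by rewrite oppr_gt0.
rewrite -ler_pdivrMl ?invr_gt0 // invrK mulrN1 opprK; apply => w ws.
by rewrite pairingZr -ler_pdivrMl ?invr_gt0 // invrK mulrN1 opprK ht.
Qed.

Lemma interior_spans s : interior (hull [set` s]) 0 -> positively_spans s.
Proof.
move=> /nbhs_ballP[e /= e0 he]; apply/positively_spansP => y y0.
apply: contrapT => h.
have hs v : v \in s -> 0 <= pairing v y.
  by move=> vs; rewrite leNgt; apply/negP => vy; apply: h; exists v.
pose S := 1 + \sum_i `|y 0 i|.
have S0 : 0 < S by rewrite ltr_pwDl // sumr_ge0.
have yi i : `|y 0 i| < S.
  by rewrite /S (bigD1 i) //= addrCA ltrDl ltr_pwDl // sumr_ge0.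
have : hull [set` s] (- ((e / S) *: y)).
  apply: he; split=> // i j; rewrite ord1 /ball /= !mxE sub0r opprK normrM ger0_norm; last first.
    by rewrite divr_ge0 // ltW.
  by rewrite mulrAC ltr_pdivrMr // ltr_pM2l.
move/(hull_ge hs); rewrite pairingNl pairingZl oppr_ge0 pmulr_rle0 ?divr_gt0 //.
by rewrite leNgt pairing_self_gt0.
Qed.

End Polytopes.

(** * From reflexive polytopes to facet bases *)

Section Bridge.
Variables (R : realType) (d : nat).
Implicit Types (P : set 'rV[R]_d) (s : seq 'rV[R]_d) (x y v : 'rV[R]_d) (E : 'M[R]_d).

Lemma to_realD (m n : 'rV[int]_d) : to_real R (m + n) = to_real R m + to_real R n.
Proof. by apply/rowP => i; rewrite !mxE intrD. Qed.

Lemma pairing_to_real (m n : 'rV[int]_d) :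
  pairing (to_real R m) (to_real R n) = (pairing m n)%:~R.
Proof. by rewrite /pairing rmorph_sum; apply: eq_bigr => i _; rewrite !mxE rmorphM. Qed.

Lemma to_real_inj : injective (@to_real R d).
Proof.
move=> m n /rowP h; apply/rowP => i; have := h i; rewrite !mxE; exact: intr_inj.
Qed.

Lemma level_pairing E : exists y, forall x, pairing x y = - level E x.
Proof.
have [z zE] := level_form E; exists (- z^T) => x.
by rewrite pairingNr pairingE trmxK zE.
Qed.

Lemma hull_level s E x : facet_basis s E -> hull [set` s] x -> level E x <= 1.
Proof.
move=> [_ _ leE] hx; have [y yE] := level_pairing E.
have : -1 <= pairing x y by apply: (hull_ge _ hx) => v vs; rewrite yE lerN2 leE.
by rewrite yE lerN2.
Qed.

Lemma level_face s E : facet_basis s E ->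
  face (hull [set` s]) [set x | hull [set` s] x /\ level E x = 1].
Proof.
move=> fE; have [y yE] := level_pairing E; exists (- y), 1; split=> [x hx|].
  by rewrite pairingNr yE opprK (hull_level fE).
by apply/seteqP; split=> x /= []; rewrite pairingNr yE opprK.
Qed.

Section WithVertices.
Variables (P : set 'rV[R]_d) (s : seq 'rV[R]_d).
Hypotheses (PE : P = hull [set` s]) (PV : vertices P = [set` s]).

Let VP v : v \in s -> vertices P v. Proof. by rewrite PV. Qed.

Lemma level_facet E : (0 < d)%N -> has_dim P d -> facet_basis s E ->
  facet P [set x | P x /\ level E x = 1].
Proof.
move=> hd dimP fE; split; first by rewrite PE; exact: level_face.
have [uE sE _] := fE.
case: d hd P s E PE PV dimP fE uE sE => // k _ Q t F QE QV dimQ fF uF sF.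
exists k => //; split.
  exists (fun i => row i F); split=> [c _ c0 i|i]; last first.
    by rewrite /= QE; split; [apply: sub_hull; exact: sF|exact: level_row].
  have := coords_uniq (x := 0) uF (c := c); rewrite c0 => /(_ erefl i).
  by rewrite coords0.
move=> p hp ap; pose M := \matrix_i p i.
have [c cM c0] : exists2 c : 'rV_k.+2, c *m M = 0 & c != 0.
  have : kermx M != 0.
    rewrite -mxrank_eq0 mxrank_ker subn_eq0 -ltnNge.
    exact: leq_ltn_trans (rank_leq_col M) _.
  move=> /rowV0Pn[c /sub_kermxP cM c0]; by exists c.
have sump : \sum_i c 0 i *: p i = 0.
  by rewrite -[RHS]cM mulmx_sum_row; apply: eq_bigr => i _; rewrite rowK.
have sumc : \sum_i c 0 i = 0.
  rewrite -[RHS](level0 F) -[in RHS]sump level_sum; apply: eq_bigr => i _.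
  by rewrite levelZ; have [_ ->] := hp i; rewrite mulr1.
case/negP: c0; apply/eqP/rowP => i; rewrite mxE; exact: ap.
Qed.

(** The facet is a simplex, with at most d vertices because it lies in a hyperplane off the
    origin, and the d rows of E exhaust them. *)
Lemma facet_basis_rows E v : (0 < d)%N -> has_dim P d -> simplicial P ->
  facet_basis s E -> v \in s -> level E v = 1 -> exists i, v = row i E.
Proof.
move=> hd dimP simp fE vs v1; have [uE sE _] := fE.
have [n [p [ap FE]]] := simp _ (level_facet hd dimP fE).
have pF j : P (p j) /\ level E (p j) = 1.
  have : [set x | P x /\ level E x = 1] (p j) by rewrite FE; apply: sub_hull; exists j.
  exact.
have vert w : w \in s -> level E w = 1 -> exists j, p j = w.
  move=> ws w1; have [||j _ <-] := @vertices_generator _ _ P (range p) w (VP ws).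
  - by move=> _ [j _ <-]; case: (pF j).
  - rewrite -FE; split=> //; exact: (vertices_sub (VP ws)).
  - by exists j.
have /fin_all_exists[g gE] i : exists j, p j = row i E.
  by apply: vert => //; exact: level_row.
have ginj : injective g.
  by move=> i j gij; apply: (row_inj uE); rewrite /= -!gE gij.
have nd : (n <= d)%N.
  pose M := \matrix_i p i; suff : row_free M by rewrite /row_free => /eqP <-; exact: rank_leq_col.
  rewrite -kermx_eq0; apply/rowV0P => c /sub_kermxP cM.
  have sump : \sum_i c 0 i *: p i = 0.
    by rewrite -[RHS]cM mulmx_sum_row; apply: eq_bigr => i _; rewrite rowK.
  have sumc : \sum_i c 0 i = 0.
    rewrite -[RHS](level0 E) -[in RHS]sump level_sum; apply: eq_bigr => i _.
    by rewrite levelZ; have [_ ->] := pF i; rewrite mulr1.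
  by apply/rowP => i; rewrite mxE; exact: ap.
have [j jv] := vert v vs v1.
have /codomP[i ji] : j \in codom g by apply: inj_card_onto => //; rewrite !card_ord.
by exists i; rewrite -gE -ji.
Qed.

(** The sum of the rows of E is a supporting form: on the dual each row is at least -1, and
    y is the only point where all of them equal -1. *)
Lemma facet_basis_vertex E y : facet_basis s E -> (forall x, pairing x y = - level E x) ->
  vertices (dual P) y.
Proof.
move=> fE yE; have [uE sE leE] := fE.
exists (- \sum_i row i E), d%:R; rewrite PE dual_hull.
have dE z : pairing z (- \sum_i row i E) = \sum_i - pairing (row i E) z.
  by rewrite pairingNr pairing_sumr -sumrN; apply: eq_bigr => i _; rewrite pairingC.
have d1 : d%:R = \sum_(i < d) (1 : R) by rewrite sumr_const card_ord.
split=> [z hz|].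
  by rewrite dE d1; apply: ler_sum => i _; rewrite lerNl hz.
apply/seteqP; split=> z /= => [->|[hz]].
  split=> [v vs|]; first by rewrite yE lerN2 leE.
  by rewrite dE d1; apply: eq_bigr => i _; rewrite yE opprK level_row.
rewrite dE d1 => /eqP; rewrite eq_sym -subr_eq0 -sumrB psumr_eq0; last first.
  by move=> i _; have := hz _ (sE i); lra.
move=> /allP h; have rowz i : pairing (row i E) z = - 1.
  have := h i (mem_index_enum _); rewrite /= opprK addrC addr_eq0 => /eqP; exact.
have h1 i : (row i E *m - z^T) 0 0 = 1 by rewrite mulmxN mxE -pairingE rowz opprK.
have zE x : pairing x z = - level E x.
  by rewrite -(levelE x uE h1) mulmxN mxE opprK pairingE.
by apply/rowP => i; rewrite -!pairing_delta pairingC zE -yE pairingC.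
Qed.

(** The vertices of P that are tight at y lie on a facet E, so they are also tight at the dual
    vertex y' of E. If y' differed from y, then y could be moved a little further away from
    y' inside the dual, so it would not be a vertex. *)
Lemma vertex_facet_basis y : positively_spans s -> vertices (dual P) y ->
  exists2 E, facet_basis s E & forall x, pairing x y = - level E x.
Proof.
move=> sp vy; have := vertices_sub vy; rewrite PE dual_hull => hy.
have form v : (v *m - y^T) 0 0 = - pairing v y by rewrite mulmxN mxE pairingE.
have [|E fE hE] := face_in_facet sp (z := - y^T).
  by move=> v vs; rewrite form lerNl hy.
exists E => // x; have [y' y'E] := level_pairing E.
suff -> : y = y' by [].
have [uE sE leE] := fE; have [a [b [le_b eq_b]]] := vy.
have y'D : dual P y' by apply: vertices_sub; exact: (facet_basis_vertex fE y'E).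
have yD : dual P y by apply: vertices_sub.
(* Only the vertices that are not tight at y limit the step t. *)
have [t t0 ht] : exists2 t, 0 < t & forall v, v \in s -> -1 <= pairing v (y + t *: (y - y')).
  have eq1 v : v \in s -> pairing v y = -1 -> pairing v y' = -1.
    move=> vs vy1; rewrite y'E hE // form vy1 opprK //.
  pose f v := (1 + pairing v y) / (1 + `|pairing v (y - y')|).
  pose r := [seq v <- s | pairing v y != -1].
  have pos v : 0 < 1 + `|pairing v (y - y')| by rewrite ltr_pwDl.
  have main v t : v \in s -> 0 <= t -> (v \in r -> t <= f v) ->
      -1 <= pairing v (y + t *: (y - y')).
    move=> vs t0; rewrite mem_filter vs andbT pairingDr pairingZr.
    have [v1 _|v1 /(_ isT)] := eqVneq (pairing v y) (-1).
      by rewrite pairingDr pairingNr v1 (eq1 v vs v1) subrr mulr0 addr0.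
    rewrite ler_pdivlMr // mulrDr mulr1 => h.
    have := ler_norm (- pairing v (y - y')); rewrite normrN => h'.
    have := ler_wpM2l t0 h'; lra.
  have [r0|rn] := eqVneq r [::].
    by exists 1 => // v vs; apply: main => //; rewrite r0.
  have [w wr wmin] := seq_argmin f rn.
  exists (f w); last first.
    move=> v vs; apply: main => //; last exact: wmin.
    move: wr; rewrite mem_filter => /andP[_ ws].
    by apply: divr_ge0; [have := hy w ws; lra|exact: ltW].
  move: wr; rewrite mem_filter => /andP[w1 ws]; rewrite divr_gt0 //.
  have := hy w ws; rewrite le_eqVlt eq_sym (negPf w1) /=; lra.
have zD : dual P (y + t *: (y - y')) by rewrite PE dual_hull.
have ya : pairing y a = b by have : [set y] y by []; rewrite eq_b => -[].
have := le_b _ zD; rewrite pairingDl pairingZl pairingDl pairingNl ya => h1.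
have h2 := le_b _ y'D.
have h3 : t * (b - pairing y' a) <= 0 by lra.
have : b - pairing y' a <= 0 by move: h3; rewrite pmulr_rle0.
rewrite subr_le0 => h4.
have : [set y] y' by rewrite eq_b; split=> //; apply: le_anti; rewrite h2.
by [].
Qed.

Lemma level_integral E m : lattice_polytope (dual P) -> facet_basis s E ->
  isint (level E (to_real R m)).
Proof.
move=> [_ lat] fE; have [y yE] := level_pairing E.
have [n _ ny] := lat _ (facet_basis_vertex fE yE).
by exists (- pairing m n); rewrite rmorphN /= -pairing_to_real ny yE opprK.
Qed.

Lemma vertices_neq0 : (0 < d)%N -> positively_spans s -> 0 \notin s.
Proof.
move=> hd /positively_spansP sp; apply/negP => zs.
have [a [b [le_b eq_b]]] := VP zs.
have b0 : b = 0.
  have : [set (0 : 'rV[R]_d)] 0 by [].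
  by rewrite eq_b => -[_]; rewrite pairing0l.
have sP v : v \in s -> P v by move=> vs; rewrite PE; exact: sub_hull.
have [a0|an0] := eqVneq a 0.
  have [|v vs] := sp (const_mx 1).
    apply/eqP => /rowP/(_ (Ordinal hd)); rewrite !mxE => /eqP; by rewrite oner_eq0.
  have : [set (0 : 'rV[R]_d)] v by rewrite eq_b; split; [exact: sP|rewrite a0 b0 pairing0r].
  by move=> ->; rewrite pairing0l ltxx.
have [|v vs] := sp (- a); first by rewrite oppr_eq0.
by rewrite pairingNr oppr_lt0 ltNge => /negP; apply; rewrite -b0; apply/le_b/sP.
Qed.

Lemma reflexive_simplicial : (0 < d)%N -> uniq s -> reflexive_polytope P -> simplicial P ->
  simplicial_reflexive s (range (@to_real R d)).
Proof.
move=> hd us [dimP [_ latP] intP latD] simp.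
have sp : positively_spans s by apply: interior_spans; rewrite -PE.
split=> // [|v vs|_ _ [m _ <-] [n _ <-]|E _ fE [m _ <-]|E v fE vs v1].
- exact: vertices_neq0.
- exact/latP/VP.
- by exists (m + n) => //; rewrite to_realD.
- exact: level_integral.
- exact: facet_basis_rows.
Qed.

End WithVertices.
End Bridge.

(** * The hexagon and its dual *)

Section Hexagon.

Definition row2 (K : pzRingType) (a b : K) : 'rV[K]_2 := \row_j (if j == 0 then a else b).

Lemma pairing_row2 (K : comPzRingType) (a b : K) (y : 'rV_2) :
  pairing (row2 a b) y = a * y 0 0 + b * y 0 1.
Proof. by rewrite /pairing big_ord_recl big_ord1 !mxE /=; congr (_ + _ * y _ _); apply/val_inj. Qed.

Definition hexagon : seq 'rV[int]_2 :=
  [:: row2 1 0; row2 0 1; row2 1 1; row2 (-1) 0; row2 0 (-1); row2 (-1) (-1)].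

Variable R : realType.
Implicit Types (x y z : 'rV[R]_2).

Lemma to_real_row2 a b : to_real R (row2 a b) = row2 a%:~R b%:~R.
Proof. by apply/rowP => i; rewrite !mxE; case: ifP. Qed.

Lemma row2_eta x : x = row2 (x 0 0) (x 0 1).
Proof.
apply/rowP => i; rewrite mxE; case: eqP => [->//|i0]; congr (x _ _); apply/val_inj.
by move: i i0 => [[|[|]]//= h] i0; case: i0; apply/val_inj.
Qed.

(** The dual polytope of the hexagon. *)
Definition hexpolar y : Prop := forall w, w \in hexagon -> -1 <= pairing (to_real R w) y.

Lemma hexpolarP y : hexpolar y <->
  [/\ -1 <= y 0 0, y 0 0 <= 1, -1 <= y 0 1, y 0 1 <= 1 & -1 <= y 0 0 + y 0 1 <= 1].
Proof.
split=> [h|[h1 h2 h3 h4 /andP[h5 h6]] w].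
  have h1 := h (row2 1 0); have h2 := h (row2 0 1); have h3 := h (row2 1 1).
  have h4 := h (row2 (-1) 0); have h5 := h (row2 0 (-1)); have h6 := h (row2 (-1) (-1)).
  move: h1 h2 h3 h4 h5 h6; rewrite !inE !eqxx !orbT /= !to_real_row2 !pairing_row2.
  move=> /(_ isT) h1 /(_ isT) h2 /(_ isT) h3 /(_ isT) h4 /(_ isT) h5 /(_ isT) h6.
  by split; lra.
by rewrite !inE => /or4P[|||/orP[|/orP[]]] => /eqP ->;
  rewrite to_real_row2 pairing_row2; lra.
Qed.

Lemma hexagon_span y : y != 0 -> exists2 w, w \in hexagon & pairing (to_real R w) y < 0.
Proof.
move=> y0; have : (y 0 0 != 0) || (y 0 1 != 0).
  rewrite -negb_and; apply: contra y0 => /andP[/eqP a /eqP b].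
  by rewrite (row2_eta y) a b; apply/eqP/rowP => i; rewrite !mxE; case: ifP.
case/orP=> /eqP/eqP; rewrite neq_lt => /orP[] h;
  [exists (row2 1 0)|exists (row2 (-1) 0)|exists (row2 0 1)|exists (row2 0 (-1))];
  rewrite ?inE ?eqxx ?orbT // to_real_row2 pairing_row2; lra.
Qed.

Lemma hexagon_exposed w : w \in hexagon -> exists y,
  pairing (to_real R w) y < 0 /\
  forall w', w' \in hexagon -> w' != w -> pairing (to_real R w) y < pairing (to_real R w') y.
Proof.
have wit a b (y : 'rV[R]_2) : pairing (to_real R (row2 a b)) y < 0 ->
    all (fun w' => (w' == row2 a b) ||
       (pairing (to_real R (row2 a b)) y < pairing (to_real R w') y)) hexagon ->
    exists y, pairing (to_real R (row2 a b)) y < 0 /\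
    forall w', w' \in hexagon -> w' != row2 a b ->
      pairing (to_real R (row2 a b)) y < pairing (to_real R w') y.
  move=> h0 /allP h; exists y; split=> // w' /h /orP[/eqP->|//]; by rewrite eqxx.
rewrite !inE => /or4P[|||/orP[|/orP[]]] => /eqP ->;
  [apply: (wit _ _ (row2 (-2) 1))|apply: (wit _ _ (row2 1 (-2)))
  |apply: (wit _ _ (row2 (-1) (-1)))|apply: (wit _ _ (row2 2 (-1)))
  |apply: (wit _ _ (row2 (-1) 2))|apply: (wit _ _ (row2 1 1))];
  rewrite /= ?to_real_row2 ?pairing_row2 !mxE /= ?eqxx ?andbT /=; try lra.
all: by do ?[apply/andP; split]; apply/orP; (try by left); right; lra.
Qed.

Lemma Z2_hull : Z2 R = hull [set` [seq to_real R w | w <- hexagon]].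
Proof.
have in_sq a b : 0 <= a <= 1 -> 0 <= b <= 1 ->
    [set x : 'rV[R]_2 | forall i, 0 <= x ord0 i <= 1] (row2 a b).
  by move=> ha hb i; rewrite mxE; case: ifP.
rewrite /Z2; apply/seteqP; split; apply: hull_sub => x; last first.
  move=> /mapP[w hw ->]; apply: sub_hull; move: hw.
  rewrite !inE => /or4P[|||/orP[|/orP[]]] => /eqP ->; rewrite to_real_row2;
    [left|left|left|right|right|right]; try by apply: in_sq; rewrite ?lexx ?ler01.
  - exists (row2 1 0); first by apply: in_sq; rewrite ?lexx ?ler01.
    by apply/rowP => i; rewrite !mxE; case: ifP; rewrite ?oppr0.
  - exists (row2 0 1); first by apply: in_sq; rewrite ?lexx ?ler01.
    by apply/rowP => i; rewrite !mxE; case: ifP; rewrite ?oppr0.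
  - exists (row2 1 1); first by apply: in_sq; rewrite ?lexx ?ler01.
    by apply/rowP => i; rewrite !mxE; case: ifP; rewrite ?oppr0.
have main (z : 'rV[R]_2) y : (forall i, 0 <= z ord0 i <= 1) -> hexpolar y ->
    -1 <= pairing z y /\ pairing z y <= 1.
  move=> hz /hexpolarP[h1 h2 h3 h4 /andP[h5 h6]].
  rewrite (row2_eta z) pairing_row2.
  have /andP[a0 a1] := hz 0; have /andP[b0 b1] := hz 1.
  set a := z 0 0 in a0 a1 *; set b := z 0 1 in b0 b1 *.
  set u := y 0 0 in h1 h2 h5 h6 *; set v := y 0 1 in h3 h4 h5 h6 *.
  by have [u0|u0] := leP 0 u; have [v0|v0] := leP 0 v; split; nra.
have pol (z : 'rV[R]_2) : (forall y, hexpolar y -> -1 <= pairing z y) ->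
    hull [set` [seq to_real R w | w <- hexagon]] z.
  move=> h; apply: polar_hull => //.
    apply/positively_spansP => y /hexagon_span[w wh wy].
    by exists (to_real R w); rewrite ?map_f.
  by move=> y hy; apply: h => w wh; apply: hy; exact: map_f.
move=> [sx|[z sz <-]]; apply: pol => y hy; first by case: (main x y).
by rewrite pairingNl lerN2; case: (main z y).
Qed.

(** The dual of the hexagon is a hexagon again, with vertices (1, 0), (0, 1), (1, -1) and
    their negatives; this reflection carries it back. *)
Definition flip (K : pzRingType) : 'M[K]_2 := diag_mx (row2 1 (-1)).

Lemma Z2P y : Z2 R y <-> hexpolar (y *m flip R).
Proof.
have yf : y *m flip R = row2 (y 0 0) (- y 0 1).
  apply/rowP => i; rewrite mul_mx_diag !mxE; case: eqP => [->|]; first by rewrite mulr1.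
  move: i => [[|[|]]//= h] i0; first by case: i0; apply/val_inj.
  by rewrite mulrN1; congr (- y _ _); apply/val_inj.
rewrite yf hexpolarP !mxE /= Z2_hull; split=> [hy|[h1 h2 h3 h4 /andP[h5 h6]]].
  have g a b t : (forall w, w \in hexagon -> t <= pairing (to_real R w) (row2 a b)) ->
      t <= a * y 0 0 + b * y 0 1.
    move=> h; rewrite -pairing_row2 pairingC; apply: (hull_ge _ hy) => _ /mapP[w wh ->].
    exact: h.
  have hx a b : -1 <= a <= 1 -> -1 <= b <= 1 -> -1 <= a + b <= 1 ->
      -1 <= a * y 0 0 + b * y 0 1.
    move=> ha hb hab; apply: g => w wh; have : hexpolar (row2 a b); last exact.
    by apply/hexpolarP; rewrite !mxE /=; split; lra.
  have h1 := hx 1 0 ltac:(lra) ltac:(lra) ltac:(lra).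
  have h2 := hx (-1) 0 ltac:(lra) ltac:(lra) ltac:(lra).
  have h3 := hx 0 1 ltac:(lra) ltac:(lra) ltac:(lra).
  have h4 := hx 0 (-1) ltac:(lra) ltac:(lra) ltac:(lra).
  have h5 := hx 1 (-1) ltac:(lra) ltac:(lra) ltac:(lra).
  have h6 := hx (-1) 1 ltac:(lra) ltac:(lra) ltac:(lra).
  by split; lra.
apply: polar_hull => //.
  apply/positively_spansP => z /hexagon_span[w wh wz].
  by exists (to_real R w); rewrite ?map_f.
move=> z hz; have : hexpolar z by move=> w wh; apply: hz; exact: map_f.
move=> /hexpolarP[g1 g2 g3 g4 /andP[g5 g6]].
rewrite (row2_eta y) pairing_row2.
set a := y 0 0 in h1 h2 h5 h6 *; set b := y 0 1 in h3 h4 h5 h6 *.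
set u := z 0 0 in g1 g2 g5 g6 *; set v := z 0 1 in g3 g4 g5 g6 *.
have mul_ge (p q : R) : 0 <= p -> -1 <= q -> - p <= p * q.
  by move=> p0 /(ler_wpM2l p0); rewrite mulrN1.
have [a0|a0] := leP 0 a; have [b0|b0] := leP 0 b.
(* In each case (a, b) is a nonnegative combination of two adjacent vertices of the
   hexagon, and the coefficients add up to at most 1. *)
- have [ab|ba] := leP a b.
    by have := mul_ge a (u + v) ltac:(lra) ltac:(lra);
       have := mul_ge (b - a) v ltac:(lra) ltac:(lra); lra.
  by have := mul_ge b (u + v) ltac:(lra) ltac:(lra);
     have := mul_ge (a - b) u ltac:(lra) ltac:(lra); lra.
- by have := mul_ge a u ltac:(lra) ltac:(lra);
     have := mul_ge (- b) (- v) ltac:(lra) ltac:(lra); lra.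
- by have := mul_ge b v ltac:(lra) ltac:(lra);
     have := mul_ge (- a) (- u) ltac:(lra) ltac:(lra); lra.
- have [ab|ba] := leP a b.
    by have := mul_ge (- b) (- (u + v)) ltac:(lra) ltac:(lra);
       have := mul_ge (b - a) (- u) ltac:(lra) ltac:(lra); lra.
  by have := mul_ge (- a) (- (u + v)) ltac:(lra) ltac:(lra);
     have := mul_ge (a - b) (- v) ltac:(lra) ltac:(lra); lra.
Qed.

End Hexagon.

(** * Free sums of hexagons *)

Section HexDecomposition.
Variable R : realType.

Notation realmx A := (map_mx (intr : int -> R) A).

(** A decomposition of the lattice Z^d into k planes: the rows of L l are a basis of the l-th
    plane, and K l is the projection onto it. *)
Record hex_splitting k d (L : 'I_k -> 'M[int]_(2, d)) (K : 'I_k -> 'M[int]_(d, 2)) : Prop :=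
  HexSplitting {
    splitting_LK : forall l m, L l *m K m = if l == m then 1%:M else 0;
    splitting_KL : \sum_l K l *m L l = 1%:M
  }.

Definition hexverts k d (L : 'I_k -> 'M[int]_(2, d)) : seq 'rV[int]_d :=
  [seq w *m L l | l <- enum 'I_k, w <- hexagon].

Definition hexhull k d (L : 'I_k -> 'M[int]_(2, d)) : set 'rV[R]_d :=
  hull [set` [seq to_real R v | v <- hexverts L]].

Lemma to_real_mul d e (w : 'rV[int]_d) (A : 'M[int]_(d, e)) :
  to_real R (w *m A) = to_real R w *m realmx A.
Proof. exact: map_mxM. Qed.

Section OneSplitting.
Variables (k d : nat) (L : 'I_k -> 'M[int]_(2, d)) (K : 'I_k -> 'M[int]_(d, 2)).
Implicit Types (v : 'rV[int]_d) (x y : 'rV[R]_d).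

Lemma hexvertsP v : reflect (exists l w, w \in hexagon /\ v = w *m L l) (v \in hexverts L).
Proof.
apply: (iffP allpairsP) => [[[l w] [_ wh ->]]|[l [w [wh ->]]]]; first by exists l, w.
by exists (l, w); rewrite mem_enum.
Qed.

Lemma hexverts_realP x :
  reflect (exists l w, w \in hexagon /\ x = to_real R w *m realmx (L l))
          (x \in [seq to_real R v | v <- hexverts L]).
Proof.
apply: (iffP mapP) => [[v /hexvertsP[l [w [wh ->]]] ->]|[l [w [wh ->]]]].
  by exists l, w; rewrite to_real_mul.
by exists (w *m L l); rewrite ?to_real_mul //; apply/hexvertsP; exists l, w.
Qed.

(** Each vertex of the free sum lies in one plane, so it tests only one component of y. *)
Lemma hexpolar_dual y : (forall x, x \in [seq to_real R v | v <- hexverts L] -> -1 <= pairing x y)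
  <-> forall l, hexpolar (y *m (realmx (L l))^T).
Proof.
split=> h => [l w wh|x /hexverts_realP[l [w [wh ->]]]].
  by rewrite -pairing_mulmx; apply: h; apply/hexverts_realP; exists l, w.
by rewrite pairing_mulmx; apply: h.
Qed.

Hypothesis LK : hex_splitting L K.

Lemma realLK l m : realmx (L l) *m realmx (K m) = if l == m then 1%:M else 0.
Proof. by rewrite -map_mxM (splitting_LK LK); case: ifP; rewrite ?map_mx1 ?map_mx0. Qed.

Lemma realKL : \sum_l realmx (K l) *m realmx (L l) = 1%:M.
Proof.
transitivity (realmx (\sum_l K l *m L l)); last by rewrite (splitting_KL LK) map_mx1.
by rewrite map_mx_sum; apply: eq_bigr => l _; rewrite map_mxM.
Qed.

Lemma splitting_sum x : x = \sum_l x *m realmx (K l) *m realmx (L l).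
Proof.
by rewrite -[LHS]mulmx1 -realKL mulmx_sumr; apply: eq_bigr => l _; rewrite mulmxA.
Qed.

Lemma hexverts_spans : positively_spans [seq to_real R v | v <- hexverts L].
Proof.
apply/positively_spansP => y y0.
have [l yl] : exists l, y *m (realmx (L l))^T != 0.
  apply/existsP; apply: contraT; rewrite negb_exists => /forallP h.
  case/negP: y0; rewrite -[y]mulmx1 -trmx1 -realKL linear_sum /= mulmx_sumr big1 // => l _.
  have := h l; rewrite negbK => /eqP h'.
  by rewrite trmx_mul mulmxA h' mul0mx.
have [w wh wy] := hexagon_span yl; exists (to_real R w *m realmx (L l)).
  by apply/hexverts_realP; exists l, w.
by rewrite pairing_mulmx.
Qed.

Lemma hexverts_neq_nil : (0 < k)%N -> [seq to_real R v | v <- hexverts L] != [::].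
Proof.
move=> k0; apply/eqP => h.
have : to_real R (row2 1 0) *m realmx (L (Ordinal k0)) \in [seq to_real R v | v <- hexverts L].
  by apply/hexverts_realP; exists (Ordinal k0), (row2 1 0); rewrite inE eqxx.
by rewrite h.
Qed.

Lemma hexhull_dual : dual (hexhull L) = [set y | forall l, hexpolar (y *m (realmx (L l))^T)].
Proof. by rewrite dual_hull; apply/seteqP; split=> y /= /hexpolar_dual. Qed.

Lemma hexvert_exposed l w : w \in hexagon -> exists y : 'rV[R]_d,
  pairing (to_real R w *m realmx (L l)) y < 0 /\
  forall x, x \in [seq to_real R v | v <- hexverts L] -> x != to_real R w *m realmx (L l) ->
  pairing (to_real R w *m realmx (L l)) y < pairing x y.
Proof.
move=> wh; have [z [z0 zw]] := hexagon_exposed R wh.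
have E m w' : pairing (to_real R w' *m realmx (L m)) (z *m (realmx (K l))^T) =
    if m == l then pairing (to_real R w') z else 0.
  rewrite -[_^T]trmxK -pairing_mulmx trmxK -mulmxA realLK.
  by case: ifP; rewrite ?mulmx1 // mulmx0 pairing0l.
exists (z *m (realmx (K l))^T); rewrite E eqxx; split=> // _ /hexverts_realP[m [w' [wh' ->]]] ne.
rewrite E; case: eqP => [ml|//]; apply: zw => //.
by apply: contraNneq ne => ->; rewrite ml.
Qed.

Lemma hexhull_vertices : vertices (hexhull L) = [set` [seq to_real R v | v <- hexverts L]].
Proof.
apply/seteqP; split=> [x xV|x].
  by apply: (vertices_generator xV); [exact: sub_hull|exact: vertices_sub].
move=> /hexverts_realP[l [w [wh ->]]]; have [y [_ hy]] := hexvert_exposed l wh.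
by apply: (hull_exposed (y := y)) => //; apply/hexverts_realP; exists l, w.
Qed.

Lemma hexverts_uniq : uniq (hexverts L).
Proof.
apply: allpairs_uniq; [exact: enum_uniq| |].
  rewrite /hexagon /= !inE.
  have e a b c e : (row2 a b == row2 c e :> 'rV[int]_2) = (a == c) && (b == e).
    apply/eqP/andP => [/rowP h|[/eqP-> /eqP->]//].
    by have := h 0; have := h 1; rewrite !mxE /= => -> ->.
  by rewrite !e.
move=> [l w] [l' w'] h h' /= e.
have {h} wh : w \in hexagon by have /allpairsP[[a b] /= [_ bh [_ ->]]] := h.
have {h'} : w' \in hexagon by have /allpairsP[[a b] /= [_ bh [_ ->]]] := h'.
have : w = w' *m (L l' *m K l).
  by rewrite mulmxA -e -mulmxA (splitting_LK LK) eqxx mulmx1.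
rewrite (splitting_LK LK); case: eqP => [->|_]; first by rewrite mulmx1 => ->.
rewrite mulmx0 => w0; have [y [+ _]] := hexagon_exposed R wh.
by rewrite w0 /to_real map_mx0 pairing0l ltxx.
Qed.

Lemma hexverts_size : size (hexverts L) = (k * 6)%N.
Proof. by rewrite size_allpairs size_enum_ord. Qed.

End OneSplitting.

(** The splitting of Z^(2k) that underlies [set_power]. *)
Definition plane k l : 'M[int]_(2, k * 2) := \matrix_(j, c) (c == mxvec_index l j)%:R.

Lemma plane_mul (K : comPzRingType) k (x : 'rV[K]_(k * 2)) l :
  x *m (map_mx intr (plane l))^T = row l (vec_mx x).
Proof.
apply/rowP => j; rewrite !mxE (bigD1 (mxvec_index l j)) //= big1 => [|c cj].
  by rewrite !mxE eqxx mulr1 addr0.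
by rewrite !mxE (negPf cj) mulr0.
Qed.

Lemma plane_splitting k : hex_splitting (@plane k) (fun l => (plane l)^T).
Proof.
have idx l m i j : (mxvec_index l i == mxvec_index m j :> 'I_(k * 2)) = (l == m) && (i == j).
  apply/eqP/andP => [e|[/eqP-> /eqP->]//].
  by move: e => /cast_ord_inj /enum_rank_inj [-> ->].
split=> [l m|].
  apply/matrixP => i j; rewrite mxE (bigD1 (mxvec_index l i)) //= big1 => [|c ci].
    by rewrite !mxE eqxx mul1r addr0 idx; case: eqP => //= _; rewrite mxE // mulr1n.
  by rewrite !mxE (negPf ci) mul0r.
apply/matrixP => a b; rewrite summxE; case/mxvec_indexP: a => l j.
rewrite (bigD1 l) //= big1 ?addr0 => [|m ml].
  rewrite !mxE (bigD1 j) //= big1 ?addr0 => [|i ij].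
    by rewrite !mxE eqxx mul1r eq_sym.
  by rewrite !mxE idx eqxx /= eq_sym (negPf ij) mul0r.
rewrite !mxE big1 // => i _.
by rewrite !mxE idx eq_sym (negPf ml) mul0r.
Qed.

End HexDecomposition.
Arguments hexhull R {k d} L.

(** * Extremal polytopes are free sums of hexagons *)

Section HexIso.
Variable R : realType.
Notation realmx A := (map_mx (intr : int -> R) A).

Lemma sum_mul_sum (K : pzRingType) k m n p q (X : 'I_k -> 'M[K]_(m, n)) (P : 'I_k -> 'M[K]_(n, q))
    (Q : 'I_k -> 'M[K]_(q, n)) (Y : 'I_k -> 'M[K]_(n, p)) :
  (forall l m, P l *m Q m = if l == m then 1%:M else 0) ->
  (\sum_l X l *m P l) *m (\sum_l Q l *m Y l) = \sum_l X l *m Y l.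
Proof.
move=> PQ; rewrite mulmx_suml; apply: eq_bigr => l _.
rewrite mulmx_sumr (bigD1 l) //= big1 ?addr0 => [|r rl].
  by rewrite -mulmxA (mulmxA (P l)) PQ eqxx mul1mx.
by rewrite -mulmxA (mulmxA (P l)) PQ eq_sym (negPf rl) mul0mx mulmx0.
Qed.

Lemma flip_mul (K : pzRingType) : flip K *m flip K = 1%:M.
Proof.
rewrite /flip; apply/matrixP => i j; rewrite mul_diag_mx !mxE.
case: (i == j); last by rewrite !mulr0n mulr0.
by rewrite !mulr1n; case: ifP; rewrite ?mulr1 // mulrNN mulr1.
Qed.

Lemma map_flip : realmx (flip int) = flip R.
Proof.
apply/matrixP => i j; rewrite !mxE; case: (i == j); rewrite ?mulr0n ?mulr1n //.
by case: ifP.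
Qed.

Lemma splitting_KL_tr k d (L : 'I_k -> 'M[int]_(2, d)) K : hex_splitting L K ->
  \sum_l (L l)^T *m (K l)^T = 1%:M.
Proof.
move=> LK; rewrite -trmx1 -(splitting_KL LK) linear_sum /=.
by apply: eq_bigr => l _; rewrite trmx_mul.
Qed.

(** The dual is a product of hexagons by [hexhull_dual], one in each plane of the dual
    lattice; the isomorphism maps these planes to the standard ones, with a flip in each. *)
Lemma hexhull_lattice_iso k d (L : 'I_k -> 'M[int]_(2, d)) K : hex_splitting L K ->
  lattice_iso (dual (hexhull R L)) (set_power (Z2 R) k).
Proof.
move=> LK; have JJ := @plane_splitting k.
pose A := \sum_l (L l)^T *m flip int *m plane l.
pose B := \sum_l (plane l)^T *m (flip int *m (K l)^T).
have AB : A *m B = 1%:M.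
  rewrite sum_mul_sum; last exact: (splitting_LK JJ).
  rewrite -(splitting_KL_tr LK); apply: eq_bigr => l _.
  by rewrite -mulmxA (mulmxA (flip int)) flip_mul mul1mx.
have BA : B *m A = 1%:M.
  have -> : B = \sum_l ((plane l)^T *m flip int) *m (K l)^T.
    by apply: eq_bigr => l _; rewrite mulmxA.
  have -> : A = \sum_l (L l)^T *m (flip int *m plane l).
    by apply: eq_bigr => l _; rewrite mulmxA.
  rewrite sum_mul_sum => [|l m].
    rewrite -(splitting_KL JJ); apply: eq_bigr => l _.
    by rewrite -mulmxA (mulmxA (flip int)) flip_mul mul1mx.
  by rewrite -trmx_mul (splitting_LK LK) eq_sym; case: ifP; rewrite ?trmx1 ?trmx0.
exists A, B; split=> //.
have rowA (x : 'rV[R]_d) l : row l (vec_mx (x *m realmx A)) *m flip R = x *m (realmx (L l))^T.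
  rewrite -plane_mul -!mulmxA; congr (x *m _); rewrite -map_flip !matrix.map_trmx -!map_mxM.
  congr (map_mx _ _); rewrite mulmxA mulmx_suml (bigD1 l) //= big1 ?addr0 => [|r rl].
    by rewrite -(mulmxA _ (plane l)) (splitting_LK JJ) eqxx mulmx1 -mulmxA flip_mul mulmx1.
  by rewrite -(mulmxA _ (plane r)) (splitting_LK JJ) (negPf rl) mulmx0.
rewrite hexhull_dual; apply/seteqP; split=> [_ [x /= hx <-] l|z hz].
  by apply/Z2P; rewrite rowA.
exists (z *m realmx B); last by rewrite -mulmxA -map_mxM BA map_mx1 mulmx1.
move=> l; rewrite -rowA -mulmxA -map_mxM BA map_mx1 mulmx1; exact/Z2P.
Qed.

Lemma hull_dual_inj d (s t : seq 'rV[R]_d) : s != [::] -> t != [::] ->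
  positively_spans s -> positively_spans t ->
  dual (hull [set` s]) = dual (hull [set` t]) -> hull [set` s] = hull [set` t].
Proof.
move=> s0 t0 sp tp e; apply/seteqP; split=> x hx.
  apply: polar_hull => // y hy; have : dual (hull [set` t]) y by rewrite dual_hull.
  by rewrite -e; apply.
apply: polar_hull => // y hy; have : dual (hull [set` s]) y by rewrite dual_hull.
by rewrite e; apply.
Qed.

(** The transposes of the given isomorphisms decompose Z^d into planes, and the polytope is
    determined by its dual. *)
Lemma lattice_iso_hexhull k d (s : seq 'rV[R]_d) : (0 < k)%N -> s != [::] ->
  positively_spans s -> lattice_iso (dual (hull [set` s])) (set_power (Z2 R) k) ->
  exists (L : 'I_k -> 'M[int]_(2, d)) K, hex_splitting L K /\ hull [set` s] = hexhull R L.
Proof.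
move=> k0 s0 sp [A [B [AB BA img]]]; have JJ := @plane_splitting k.
pose L l := flip int *m plane l *m A^T.
pose K l := B^T *m (plane l)^T *m flip int.
have LK : hex_splitting L K.
  split=> [l m|].
    rewrite /L /K !mulmxA -(mulmxA _ A^T) -trmx_mul BA trmx1 mulmx1.
    rewrite -(mulmxA _ (plane l)) (splitting_LK JJ); case: ifP => _.
      by rewrite mulmx1 flip_mul.
    by rewrite mulmx0 mul0mx.
  transitivity (B^T *m (\sum_l (plane l)^T *m plane l) *m A^T); last first.
    by rewrite (splitting_KL JJ) mulmx1 -trmx_mul AB trmx1.
  rewrite mulmx_sumr mulmx_suml; apply: eq_bigr => l _.
  by rewrite /L /K !mulmxA -(mulmxA _ (flip int) (flip int)) flip_mul mulmx1.
exists L, K; split=> //; apply: hull_dual_inj => //; [exact: hexverts_neq_nil|exact: (hexverts_spans LK)|].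
rewrite -/(hexhull R L) hexhull_dual.
have LE (y : 'rV[R]_d) l : y *m (realmx (L l))^T = row l (vec_mx (y *m realmx A)) *m flip R.
  rewrite -plane_mul -!mulmxA; congr (y *m _); rewrite -map_flip !matrix.map_trmx -!map_mxM.
  by congr (map_mx _ _); rewrite /L !trmx_mul trmxK mulmxA /flip tr_diag_mx mulmxA.
have img' y : dual (hull [set` s]) y <-> set_power (Z2 R) k (y *m realmx A).
  rewrite -img; split=> [hy|[x hx xy]]; first by exists y.
  suff -> : y = x by [].
  by rewrite -[y]mulmx1 -[x]mulmx1 -(map_mx1 (intr : int -> R)) -AB map_mxM !mulmxA xy.
apply/seteqP; split=> y.
  by move/img' => hy l; rewrite LE; apply/Z2P.
by move=> hy; apply/img' => l; apply/Z2P; rewrite -LE.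
Qed.

(** Each orbit is represented by its smaller element a l. *)
Lemma fixfree_involution_pairs d (s : 'I_d -> 'I_d) :
  (forall i, s i != i) -> (forall i, s (s i) = i) ->
  ~~ odd d /\ exists a : 'I_d./2 -> 'I_d,
    bijective (fun p : 'I_d./2 * 'I_2 => if p.2 == 0 then a p.1 else s (a p.1)).
Proof.
move=> sn ss; pose A : {set 'I_d} := [set i : 'I_d | (i < s i)%N]%SET.
have sinj : injective s by move=> i j e; rewrite -(ss i) -(ss j) e.
have AC : (~: A = [set s i | i in A])%SET.
  apply/setP => i; rewrite !inE -leqNgt; apply/idP/imsetP => [h|[j]].
    exists (s i); last by rewrite ss.
    by rewrite inE ss ltn_neqAle h andbT (inj_eq val_inj).
  by rewrite inE => h ->; rewrite ss ltnW.
have dA : d = (#|A| * 2)%N.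
  by have := cardsC A; rewrite AC card_imset // card_ord => h; rewrite muln2 -addnn h.
have d2 : #|A| = d./2 by have := congr1 half dA; rewrite muln2 doubleK.
split; first by have := congr1 odd dA; rewrite muln2 odd_double => ->.
pose a l := enum_val (cast_ord (esym d2) l).
have aA l : (a l < s (a l))%N by have := enum_valP (cast_ord (esym d2) l); rewrite inE.
exists a; apply: inj_card_bij; last first.
  by rewrite card_prod !card_ord -d2 -dA.
move=> [l i] [m j] /=.
have ainj : injective a by move=> u v /enum_val_inj /cast_ord_inj.
have i2 (u v : 'I_2) : (u == 0) = (v == 0) -> u = v.
  by move: u v => [[|[|]]// ?] [[|[|]]// ?] //= _; apply/val_inj.
case: ifP => hi; case: ifP => hj.
- by move/ainj => ->; rewrite (i2 i j) ?hi ?hj.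
- by move=> e; have := aA l; have := aA m; rewrite -e e ss; lia.
- by move=> e; have := aA l; have := aA m; rewrite -e ss e; lia.
- by move/sinj/ainj => ->; rewrite (i2 i j) ?hi ?hj.
Qed.

Lemma integral_matrix m n (A : 'M[R]_(m, n)) : (forall i j, isint (A i j)) ->
  exists B : 'M[int]_(m, n), A = realmx B.
Proof.
move=> h; have [f fE] : exists f : 'I_m * 'I_n -> int, forall p, A p.1 p.2 = (f p)%:~R.
  exists (fun p => projT1 (cid (h p.1 p.2))) => p; exact: (projT2 (cid (h p.1 p.2))).
by exists (\matrix_(i, j) f (i, j)); apply/matrixP => i j; rewrite !mxE -fE.
Qed.

Lemma realmx_inj m n : injective (fun A : 'M[int]_(m, n) => realmx A).
Proof.
move=> A B /matrixP h; apply/matrixP => i j; have := h i j; rewrite !mxE; exact: intr_inj.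
Qed.

(** With e_i the rows of E, the vertices are e_i, - e_i and e_(s i) - e_i by
    [extremal_vertices]. For each orbit of s, the vectors e_i and - e_(s i) span a plane in
    which the vertices form the hexagon. These planes decompose the lattice because the
    coordinates with respect to E are integral on it. *)
Lemma extremal_hexhull d (s : seq 'rV[R]_d) E :
  simplicial_reflexive s (range (@to_real R d)) -> facet_basis s E -> opposed s E ->
  size s = (3 * d)%N ->
  ~~ odd d /\ exists (L : 'I_d./2 -> 'M[int]_(2, d)) K, hex_splitting L K /\
    hull [set` s] = hexhull R L.
Proof.
move=> VP fE oE sz; have [t [tn tt cint sP]] := extremal_vertices VP fE oE sz.
have [od [a bij]] := fixfree_involution_pairs tn tt; split=> //.
have [uE sE _] := fE; set b := fun p => _ in bij.
have [Ez EzE] : exists B, E = realmx B.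
  apply: integral_matrix => i j; have [m _ me] := vert_lat VP (sE i).
  exists (m 0 j); have /rowP/(_ j) := me; by rewrite !mxE => ->.
have [Kz KzE] : exists B, invmx E = realmx B.
  apply: integral_matrix => i j.
  have := cint (to_real R (delta_mx 0 i)) j (imageT _ _).
  rewrite /coords /to_real map_delta_mx -rowE mxE; exact.
have EK : Ez *m Kz = 1%:M.
  have : realmx (Ez *m Kz) = realmx 1%:M by rewrite map_mxM -EzE -KzE mulmxV // map_mx1.
  exact: realmx_inj.
have KE : Kz *m Ez = 1%:M.
  have : realmx (Kz *m Ez) = realmx 1%:M by rewrite map_mxM -EzE -KzE mulVmx // map_mx1.
  exact: realmx_inj.
pose sg (j : 'I_2) : int := if j == 0 then 1 else -1.
have sg2 j : sg j * sg j = 1 by rewrite /sg; case: ifP.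
pose L l : 'M[int]_(2, d) := \matrix_(j, c) (sg j * Ez (b (l, j)) c).
pose K l : 'M[int]_(d, 2) := \matrix_(r, j) (Kz r (b (l, j)) * sg j).
have LK : hex_splitting L K.
  split=> [l m|].
    apply/matrixP => i j.
    transitivity (sg i * sg j * (Ez *m Kz) (b (l, i)) (b (m, j))).
      rewrite !mxE mulr_sumr; apply: eq_bigr => c _; rewrite !mxE; ring.
    rewrite EK mxE (inj_eq (bij_inj bij)) xpair_eqE; case: (l == m) => /=; rewrite !mxE.
      by case: eqP => [->|_]; rewrite ?sg2 ?mulr1n ?mulr0n ?mulr0.
    by rewrite mulr0.
  apply/matrixP => r c; rewrite summxE -KE mxE.
  rewrite [RHS](reindex b) /=; last exact: onW_bij.
  transitivity (\sum_l \sum_j Kz r (b (l, j)) * Ez (b (l, j)) c); last first.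
    by rewrite pair_big /=; apply: eq_bigr => -[].
  apply: eq_bigr => l _; rewrite mxE; apply: eq_bigr => j _; rewrite !mxE.
  by rewrite mulrA -(mulrA (Kz _ _)) sg2 mulr1.
have rowL a1 c l : to_real R (row2 a1 c) *m realmx (L l) =
    a1%:~R *: row (b (l, 0)) E - c%:~R *: row (b (l, 1)) E.
  apply/rowP => x; rewrite !mxE big_ord_recl big_ord1 !mxE /=.
  have -> : lift ord0 ord0 = 1 :> 'I_2 by apply/val_inj.
  by rewrite /sg /= mul1r mulN1r rmorphN mulrN EzE !mxE.
have b01 l : b (l, 1) = t (b (l, 0)) by [].
have b10 l : b (l, 0) = t (b (l, 1)) by rewrite b01 tt.
have inH a1 c l : row2 a1 c \in hexagon ->
    a1%:~R *: row (b (l, 0)) E - c%:~R *: row (b (l, 1)) E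
      \in [seq to_real R v | v <- hexverts L].
  by move=> h; apply/hexverts_realP; exists l, (row2 a1 c); rewrite rowL.
exists L, K; split=> //; congr hull; apply/seteqP; split=> v; last first.
  move=> /hexverts_realP[l [w [wh ->]]]; apply/sP; move: wh; rewrite !inE.
  move=> /or4P[|||/orP[|/orP[]]] => /eqP ->; rewrite rowL.
  - by exists (b (l, 0)); constructor 1; rewrite scale1r scale0r subr0.
  - by exists (b (l, 1)); constructor 2; rewrite scale1r scale0r sub0r.
  - by exists (b (l, 1)); constructor 3; rewrite !scale1r b10.
  - by exists (b (l, 0)); constructor 2; rewrite rmorphN scaleN1r scale0r subr0.
  - by exists (b (l, 1)); constructor 1; rewrite rmorphN scaleN1r scale0r sub0r opprK.
  - by exists (b (l, 0)); constructor 3; rewrite rmorphN !scaleN1r opprK addrC b01.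
have [b' bK b'K] := bij; move=> vs; case: ((sP v).1 vs) => i.
case: (b' i) (b'K i) => l [[|[|//]] j2] <- {i}; set j := Ordinal j2.
  have -> : j = 0 by apply/val_inj.
  have h1 := inH 1 0 l; have h2 := inH (-1) 0 l; have h3 := inH (-1) (-1) l.
  move: h1 h2 h3; rewrite !inE !eqxx !orbT => /(_ isT) h1 /(_ isT) h2 /(_ isT) h3 [] ->.
  - by move: h1; rewrite scale1r scale0r subr0.
  - by move: h2; rewrite rmorphN scaleN1r scale0r subr0.
  - by move: h3; rewrite rmorphN !scaleN1r opprK addrC b01.
have -> : j = 1 by apply/val_inj.
have h1 := inH 0 (-1) l; have h2 := inH 0 1 l; have h3 := inH 1 1 l.
move: h1 h2 h3; rewrite !inE !eqxx !orbT => /(_ isT) h1 /(_ isT) h2 /(_ isT) h3 [] ->.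
- by move: h1; rewrite rmorphN scaleN1r scale0r sub0r opprK.
- by move: h2; rewrite scale1r scale0r sub0r.
- by move: h3; rewrite !scale1r b10.
Qed.

End HexIso.

(** * Cones of the face fan *)

Section Cones.
Variables (R : realType) (d : nat).
Implicit Types (A : set 'rV[R]_d) (s t : seq 'rV[R]_d) (x y z : 'rV[R]_d).

Lemma pos_ge A x z : pos A x -> (forall v, A v -> 0 <= pairing v z) -> 0 <= pairing x z.
Proof.
move=> [n [c [p [c0 [Ap ->]]]]] h; rewrite pairing_suml; apply: sumr_ge0 => i _.
by rewrite pairingZl mulr_ge0 // h.
Qed.

Lemma posP s x : pos [set` s] x <->
  forall z, (forall v, v \in s -> 0 <= pairing v z) -> 0 <= pairing x z.
Proof.
split=> [hx z hz|h]; first exact: (pos_ge hx).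
have [z hz|c c0 ->] := @farkas _ _ (size s) (nth 0 s) x.
  have := h z^T; rewrite !pairingE trmxK; apply => v vs.
  by rewrite pairingE trmxK -(nth_index 0 vs); apply: hz; rewrite index_mem.
exists (size s), (fun i => c i), (fun i => nth 0 s i); split=> //; split=> // i.
exact: mem_nth.
Qed.

(** For y in the dual polytope, the vertices on the face that y cuts out. *)
Definition tight s y : seq 'rV[R]_d := [seq v <- s | pairing v y == -1].

Lemma mem_tight s y v : v \in tight s y = (pairing v y == -1) && (v \in s).
Proof. exact: mem_filter. Qed.

(** The cones on both sides are compared through their dual cones. If a form z is nonnegative
    on the tight generators, the polytope lies in the lexicographic half-space given by y
    and then z, so z is nonnegative on the face. *)
Lemma pos_face s y : (forall v, v \in s -> -1 <= pairing v y) ->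
  pos [set x | hull [set` s] x /\ pairing x y = -1] = pos [set` tight s y].
Proof.
move=> hy; apply/seteqP; split=> x.
  move=> hx; apply/posP => z hz; apply: (pos_ge hx) => v [hv vy].
  pose Q := [set v : 'rV[R]_d | 0 <= pairing v z].
  have cQ : convex_set Q.
    apply/convex_setP => a b r /= qa qb /andP[r0 r1].
    by rewrite /Q /= pairingDl !pairingZl addr_ge0 // mulr_ge0 // subr_ge0.
  have : [set x : 'rV[R]_d | -1 < pairing x y \/ pairing x y = -1 /\ Q x] v.
    apply: hv; split=> [|w /= ws]; first exact: convex_lex.
    have := hy w ws; rewrite le_eqVlt => /orP[/eqP e|]; last by left.
    by right; split=> //; apply: hz; rewrite mem_tight -e eqxx.
  by case=> [|[]//]; rewrite vy ltxx.
move=> [n [c [p [c0 [tp ->]]]]]; exists n, c, p; split=> //; split=> // i.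
have := tp i; rewrite /= mem_tight => /andP[/eqP e ps]; split=> //; exact: sub_hull.
Qed.

Lemma hull0 s : s != [::] -> positively_spans s -> hull [set` s] 0.
Proof. by move=> s0 sp; apply: polar_hull => // y _; rewrite pairing0l lerN10. Qed.

(** As 0 is in the interior, the bound in the definition of a proper face is positive, and
    scaling it to 1 turns the form into a point of the dual polytope. *)
Lemma face_fanP s sigma : s != [::] -> positively_spans s ->
  face_fan (hull [set` s]) sigma <->
  exists y, (forall v, v \in s -> -1 <= pairing v y) /\ sigma = pos [set` tight s y].
Proof.
move=> s0 sp; have P0 := hull0 s0 sp; have /positively_spansP sp' := sp.
split=> [[F [[a [b [le_b FE]]] nF] <-]|[y [hy ->]]]; last first.
  exists [set x | hull [set` s] x /\ pairing x y = -1]; last exact: pos_face.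
  split.
    exists (- y), 1; split=> [x hx|]; first by rewrite pairingNr lerNl (hull_ge hy).
    by apply/seteqP; split=> x /= [hx]; rewrite pairingNr => h; split=> //; lra.
  move=> e; have := P0; rewrite -e => -[_]; rewrite pairing0l => /eqP.
  by rewrite eq_sym oppr_eq0 oner_eq0.
have b0 : 0 <= b by rewrite -(pairing0l a) le_b.
have b1 : 0 < b.
  rewrite lt_neqAle b0 andbT; apply/eqP => be; apply: nF.
  have [a0|an0] := eqVneq a 0.
    by rewrite FE -be a0; apply/seteqP; split=> x /=; [case|rewrite pairing0r].
  have [|v vs] := sp' (- a); first by rewrite oppr_eq0.
  rewrite pairingNr oppr_lt0 ltNge => /negP[]; rewrite be; apply: le_b.
  exact: sub_hull.
pose y := - (b^-1 *: a).
have yE x : pairing x y = - (b^-1 * pairing x a) by rewrite pairingNr pairingZr.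
have hy v : v \in s -> -1 <= pairing v y.
  by move=> vs; rewrite yE lerN2 -ler_pdivlMl ?invr_gt0 // invrK mulr1 le_b //; exact: sub_hull.
exists y; split=> //; rewrite -pos_face //; congr pos; rewrite FE.
apply/seteqP; split=> x /= [hx e]; split=> //.
  by rewrite yE e mulVf // gt_eqF.
move: e; rewrite yE => /oppr_inj e; have bn := lt0r_neq0 b1.
by apply: (mulfI (invr_neq0 bn)); rewrite e mulVf.
Qed.

End Cones.

Local Notation coord := Defs.coord.

(** * Morphisms and charts of toric varieties *)
Section Morphisms.
Variable C : fieldType.

(** Locally a regular function is a quotient of two coordinate functions, so it suffices to
    pull these back, on suitable charts. *)
Lemma morphism_charts (X Y : prevariety C) (phi : pt X -> pt Y) :
  (forall x (j : chart Y), dom j (phi x) -> exists i : chart X,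
    [/\ dom i x, forall x', dom i x' -> dom j (phi x') &
     forall g, coord j g -> exists2 g', coord i g' &
       forall x', dom i x' -> g (phi x') = g' x']) ->
  is_morphism phi.
Proof.
move=> h V oV; split=> [x Vx|f rf x Vx].
  have [j [g [gj [dj gn0] gV]]] := oV _ Vx; have [i [ix ij pull]] := h x j dj.
  have [g' g'i gE] := pull g gj; exists i, g'; split=> //.
    by split=> //; rewrite -gE.
  by move=> x' [ix' g'n0]; apply: gV; split; [exact: ij|rewrite gE].
have [j [g1 [g2 [gj1 gj2 [dj gn0] gV fE]]]] := rf _ Vx; have [i [ix ij pull]] := h x j dj.
have [g1' g1i g1E] := pull g1 gj1; have [g2' g2i g2E] := pull g2 gj2.
exists i, g1', g2'; split=> //; first by split=> //; rewrite -g2E.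
  by move=> x' [ix' g'n0]; apply: gV; split; [exact: ij|rewrite g2E].
move=> x' [ix' g'n0] /=; rewrite fE ?g1E ?g2E //; split; first exact: ij.
by rewrite g2E.
Qed.

Lemma morphism_comp (X Y Z : prevariety C) (phi : pt X -> pt Y) (psi : pt Y -> pt Z) :
  is_morphism phi -> is_morphism psi -> is_morphism (psi \o phi).
Proof.
move=> hphi hpsi V oV; have [oV1 r1] := hpsi V oV; have [oV2 r2] := hphi _ oV1.
by split=> // f /r1 /r2.
Qed.

Lemma isomorphic_sym (X Y : prevariety C) : isomorphic X Y -> isomorphic Y X.
Proof. by move=> [phi [psi [h1 h2 h3 h4]]]; exists psi, phi. Qed.

Lemma isomorphic_trans (X Y Z : prevariety C) :
  isomorphic X Y -> isomorphic Y Z -> isomorphic X Z.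
Proof.
move=> [f [g [h1 h2 h3 h4]]] [f' [g' [h1' h2' h3' h4']]]; exists (f' \o f), (g \o g').
by split; [exact: morphism_comp|exact: morphism_comp|exact: can_comp|exact: can_comp].
Qed.

End Morphisms.

Section ToricCoord.
Variables (R : realType) (d : nat) (Sigma : set (set 'rV[R]_d)).
Local Notation C := R[i].
Local Notation X := (toric_variety Sigma).
Implicit Types (sigma : chart X) (p : pt X) (m : 'rV[int]_d).

Lemma toric_pt_inj p q : sval p = sval q -> p = q.
Proof. by case: p q => [p hp] [q hq] /= e; subst q; congr exist; exact: Prop_irrelevance. Qed.

(** A Laurent polynomial as a function; lists of terms can be concatenated and multiplied
    more easily than families indexed by ordinals. *)
Definition laurent (s : seq (C * 'rV[int]_d)) : pt X -> C :=
  fun p => \sum_(t <- s) t.1 * (sval p).2 t.2.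

Lemma coordP sigma f : coord sigma f <-> exists2 s : seq (C * 'rV[int]_d),
  (forall t, t \in s -> dual_cone (sval sigma) t.2) & f = laurent s.
Proof.
split=> [[n [c [m [hm ->]]]]|[s hs ->]].
  exists [seq (c j, m j) | j <- enum 'I_n] => [_ /mapP[j _ ->]|]; first exact: hm.
  by apply/funext => p; rewrite /laurent big_map big_enum.
exists (size s), (fun j => (tnth (in_tuple s) j).1), (fun j => (tnth (in_tuple s) j).2).
split=> [j|]; first by apply: hs; exact: mem_tnth.
by apply/funext => p; rewrite /laurent big_tnth.
Qed.

Lemma dom_dual_cone sigma p m : dom sigma p -> dual_cone (sval sigma) m -> dual_cone (sval p).1 m.
Proof. by move=> sp hm x /sp; exact: hm. Qed.

Lemma charD sigma p m n : dom sigma p -> dual_cone (sval sigma) m -> dual_cone (sval sigma) n ->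
  (sval p).2 (m + n) = (sval p).2 m * (sval p).2 n.
Proof.
move=> sp hm hn; case: (svalP p) => _ _ h _; apply: h; exact: (dom_dual_cone sp).
Qed.

Lemma char0 p : (sval p).2 0 = 1. Proof. by case: (svalP p). Qed.

Lemma dual_coneD (tau : set 'rV[R]_d) m n : dual_cone tau m -> dual_cone tau n -> dual_cone tau (m + n).
Proof. by move=> hm hn x hx; rewrite to_realD pairingDr addr_ge0 ?hm ?hn. Qed.

Lemma dual_cone0 (tau : set 'rV[R]_d) : dual_cone tau 0.
Proof. by move=> x _; rewrite /to_real map_mx0 pairing0r. Qed.

(** Points are characters only on their own dual cones, so products of coordinate functions
    are coordinate functions only after restriction to the chart. *)
Definition on_chart sigma (f : pt X -> C) : Prop :=
  exists2 g, coord sigma g & forall p, dom sigma p -> f p = g p.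

Lemma coord_on_chart sigma f : coord sigma f -> on_chart sigma f.
Proof. by exists f. Qed.

Lemma on_chartD sigma f g : on_chart sigma f -> on_chart sigma g ->
  on_chart sigma (fun p => f p + g p).
Proof.
move=> [f' /coordP[s hs ->] fE] [g' /coordP[t ht ->] gE].
exists (laurent (s ++ t)).
  by apply/coordP; exists (s ++ t) => // a; rewrite mem_cat => /orP[/hs|/ht].
by move=> p hp; rewrite fE // gE // /laurent big_cat.
Qed.

Lemma on_chartM sigma f g : on_chart sigma f -> on_chart sigma g ->
  on_chart sigma (fun p => f p * g p).
Proof.
move=> [f' /coordP[s hs ->] fE] [g' /coordP[t ht ->] gE].
pose r := [seq (a.1 * b.1, a.2 + b.2) | a <- s, b <- t].
exists (laurent r).
  apply/coordP; exists r => // _ /allpairsP[[a b] /= [/hs ha /ht hb ->]].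
  exact: dual_coneD.
move=> p hp; rewrite fE // gE // /laurent big_allpairs_dep mulr_suml.
rewrite big_seq [RHS]big_seq; apply: eq_bigr => a /hs ha.
rewrite mulr_sumr big_seq [RHS]big_seq; apply: eq_bigr => b /ht hb /=.
by rewrite (charD hp ha hb); ring.
Qed.

Lemma on_chart_const sigma (c : C) : on_chart sigma (fun=> c).
Proof.
exists (laurent [:: (c, 0)]).
  apply/coordP; exists [:: (c, 0)] => // t; rewrite inE => /eqP -> /=; exact: dual_cone0.
by move=> p _; rewrite /laurent big_seq1 char0 mulr1.
Qed.

Lemma on_chart_ext sigma f g : (forall p, dom sigma p -> f p = g p) -> on_chart sigma g ->
  on_chart sigma f.
Proof. by move=> e [h ch hE]; exists h => // p hp; rewrite e // hE. Qed.

Lemma on_chart_sum sigma n (f : 'I_n -> pt X -> C) : (forall j, on_chart sigma (f j)) ->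
  on_chart sigma (fun p => \sum_j f j p).
Proof.
elim: n f => [|n IH] f h.
  by apply: (@on_chart_ext _ _ (fun=> 0)); [move=> p _; rewrite big_ord0|exact: on_chart_const].
apply: (@on_chart_ext _ _ (fun p => f ord0 p + \sum_j f (lift ord0 j) p)).
  by move=> p _; rewrite big_ord_recl.
by apply: on_chartD; [|apply: IH].
Qed.

Lemma on_chart_prod sigma n (f : 'I_n -> pt X -> C) : (forall j, on_chart sigma (f j)) ->
  on_chart sigma (fun p => \prod_j f j p).
Proof.
elim: n f => [|n IH] f h.
  by apply: (@on_chart_ext _ _ (fun=> 1)); [move=> p _; rewrite big_ord0|exact: on_chart_const].
apply: (@on_chart_ext _ _ (fun p => f ord0 p * \prod_j f (lift ord0 j) p)).
  by move=> p _; rewrite big_ord_recl.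
by apply: on_chartM; [|apply: IH].
Qed.

End ToricCoord.

(** * The variety of a free sum of hexagons *)

Section Product.
Variables (R : realType) (k d : nat) (L : 'I_k -> 'M[int]_(2, d)) (K : 'I_k -> 'M[int]_(d, 2)).
Hypotheses (LK : hex_splitting L K) (k0 : (0 < k)%N).
Notation realmx A := (map_mx (intr : int -> R) A).
Local Notation C := R[i].
Local Notation Sigma := (face_fan (hexhull R L)).
Local Notation Theta := (face_fan (Z2 R)).
Local Notation hexr := [seq to_real R w | w <- hexagon].
Implicit Types (sigma : set 'rV[R]_d) (tau : set 'rV[R]_2).

Lemma hexr_spans : positively_spans hexr.
Proof.
apply/positively_spansP => y /hexagon_span[w wh wy].
by exists (to_real R w); rewrite ?map_f.
Qed.

Lemma Z2_fanP tau : Theta tau <-> exists y, hexpolar y /\ tau = pos [set` tight hexr y].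
Proof.
rewrite Z2_hull face_fanP //; last exact: hexr_spans.
split=> -[y [hy ->]]; exists y; split=> //.
  by move=> w wh; apply: hy; exact: map_f.
by move=> _ /mapP[w wh ->]; exact: hy.
Qed.

Definition product_cone (tau : 'I_k -> set 'rV[R]_2) : set 'rV[R]_d :=
  [set x | forall l, tau l (x *m realmx (K l))].

Definition component l sigma : set 'rV[R]_2 := [set x | sigma (x *m realmx (L l))].

Let mulLK (x : 'rV[R]_2) l m :
  x *m realmx (L l) *m realmx (K m) = if l == m then x else 0.
Proof.
by rewrite -mulmxA (realLK R LK); case: ifP; rewrite ?mulmx1 ?mulmx0.
Qed.

Let pairingL (x : 'rV[R]_2) l z : pairing (x *m realmx (L l)) z = pairing x (z *m (realmx (L l))^T).
Proof. exact: pairing_mulmx. Qed.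

Let pairingK (x : 'rV[R]_d) l z : pairing (x *m realmx (K l)) z = pairing x (z *m (realmx (K l))^T).
Proof. exact: pairing_mulmx. Qed.

Let pairing_split (x z : 'rV[R]_d) :
  pairing x z = \sum_l pairing (x *m realmx (K l)) (z *m (realmx (L l))^T).
Proof.
rewrite {1}(splitting_sum LK x) pairing_suml; apply: eq_bigr => l _.
exact: pairingL.
Qed.

(** A vertex w *m L l is tight at y exactly when w is tight at the l-th component of y, and
    nonnegativity of a form on cones can be tested on generators. *)
Lemma pos_tight_product (y : 'rV[R]_d) :
  pos [set` tight [seq to_real R v | v <- hexverts L] y] =
  product_cone (fun l => pos [set` tight hexr (y *m (realmx (L l))^T)]).
Proof.
apply/seteqP; split=> x.
  move/posP => h l; apply/posP => z hz; rewrite pairingK; apply: h => v.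
  rewrite mem_tight => /andP[/eqP vy /hexverts_realP[m [w [wh e]]]].
  rewrite -pairingK e mulLK; case: eqP => [ml|_]; last by rewrite pairing0l.
  apply: hz; rewrite mem_tight map_f // andbT -pairingL -ml -e vy //.
move=> h; apply/posP => z hz; rewrite pairing_split; apply: sumr_ge0 => l _.
have /posP := h l; apply => v; rewrite mem_tight => /andP[vy /mapP[w wh e]].
rewrite -pairingL; apply: hz; rewrite mem_tight pairingL vy /=.
by apply/hexverts_realP; exists l, w; rewrite -e.
Qed.

(** Points of the dual of a free sum are tuples of points of the duals of the summands. *)
Lemma hexhull_fanP sigma : Sigma sigma <-> exists2 tau : 'I_k -> set 'rV[R]_2,
  forall l, Theta (tau l) & sigma = product_cone tau.
Proof.
rewrite face_fanP; [|exact: hexverts_neq_nil|exact: (hexverts_spans LK)].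
split=> [[y [hy ->]]|[tau hT ->]].
  rewrite pos_tight_product.
  exists (fun l => pos [set` tight hexr (y *m (realmx (L l))^T)]) => // l.
  by apply/Z2_fanP; exists (y *m (realmx (L l))^T); split=> //; exact: (proj1 (hexpolar_dual _ _) hy).
have /choice[y hy] l : exists y, hexpolar y /\ tau l = pos [set` tight hexr y].
  exact/Z2_fanP.
pose z := \sum_l y l *m (realmx (K l))^T.
have zl l : z *m (realmx (L l))^T = y l.
  rewrite mulmx_suml (bigD1 l) //= big1 ?addr0 => [|m ml].
    by rewrite -mulmxA -trmx_mul (realLK R LK) eqxx trmx1 mulmx1.
  by rewrite -mulmxA -trmx_mul (realLK R LK) eq_sym (negPf ml) trmx0 mulmx0.
exists z; split; first by apply/hexpolar_dual => l; rewrite zl; case: (hy l).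
rewrite pos_tight_product; congr product_cone; apply/funext => l.
by rewrite zl; case: (hy l).
Qed.

Lemma Z2_fan0 tau : Theta tau -> tau 0.
Proof. by move=> /Z2_fanP[y [_ ->]]; apply/posP => z _; rewrite pairing0l. Qed.

Lemma component_product (tau : 'I_k -> set 'rV[R]_2) l : (forall l, Theta (tau l)) ->
  component l (product_cone tau) = tau l.
Proof.
move=> hT; apply/seteqP; split=> x; first by move/(_ l); rewrite mulLK eqxx.
move=> hx m; rewrite mulLK; case: eqP => [<-//|_]; exact: Z2_fan0.
Qed.

Lemma product_component sigma : Sigma sigma -> product_cone (fun l => component l sigma) = sigma.
Proof.
move=> /hexhull_fanP[tau hT ->]; congr product_cone; apply/funext => l.
exact: component_product.
Qed.

Lemma component_fan sigma l : Sigma sigma -> Theta (component l sigma).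
Proof. by move=> /hexhull_fanP[tau hT ->]; rewrite component_product. Qed.

Lemma product_fan (tau : 'I_k -> set 'rV[R]_2) : (forall l, Theta (tau l)) -> Sigma (product_cone tau).
Proof. by move=> hT; apply/hexhull_fanP; exists tau. Qed.

Implicit Types (n : 'rV[int]_d) (m : 'rV[int]_2).

Let to_realLt n l : to_real R (n *m (L l)^T) = to_real R n *m (realmx (L l))^T.
Proof. by rewrite to_real_mul matrix.map_trmx. Qed.
Let to_realKt m l : to_real R (m *m (K l)^T) = to_real R m *m (realmx (K l))^T.
Proof. by rewrite to_real_mul matrix.map_trmx. Qed.

Lemma split_char n : n = \sum_l n *m (L l)^T *m (K l)^T.
Proof.
by rewrite -[LHS]mulmx1 -(splitting_KL_tr LK) mulmx_sumr; apply: eq_bigr => l _; rewrite mulmxA.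
Qed.

Lemma dual_component sigma l n : dual_cone sigma n -> dual_cone (component l sigma) (n *m (L l)^T).
Proof. by move=> h x hx; rewrite to_realLt -pairingL; exact: h. Qed.

Lemma dual_embed sigma l m : Sigma sigma -> dual_cone (component l sigma) m ->
  dual_cone sigma (m *m (K l)^T).
Proof.
move=> /hexhull_fanP[tau hT ->]; rewrite component_product // => h x hx.
by rewrite to_realKt -pairingK; apply: h; exact: hx.
Qed.

Lemma dual_product sigma n : Sigma sigma ->
  (forall l, dual_cone (component l sigma) (n *m (L l)^T)) -> dual_cone sigma n.
Proof.
move=> /hexhull_fanP[tau hT ->] h x hx; rewrite pairing_split; apply: sumr_ge0 => l _.
by rewrite -to_realLt; apply: h; rewrite component_product //; exact: hx.
Qed.

Lemma orthogonal_product sigma n : Sigma sigma ->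
  (forall l, orthogonal_lattice (component l sigma) (n *m (L l)^T)) -> orthogonal_lattice sigma n.
Proof.
move=> /hexhull_fanP[tau hT ->] h x hx; rewrite pairing_split big1 // => l _.
by rewrite -to_realLt; apply: h; rewrite component_product //; exact: hx.
Qed.

Lemma orthogonal_dual e (sg : set 'rV[R]_e) c : orthogonal_lattice sg c -> dual_cone sg c.
Proof. by move=> h x hx; rewrite h. Qed.

Local Notation X := (toric_variety Sigma).
Local Notation S := (S3 R).

Lemma char_sum (p : pt X) r (f : 'I_r -> 'rV[int]_d) :
  (forall l, dual_cone (sval p).1 (f l)) ->
  dual_cone (sval p).1 (\sum_l f l) /\ (sval p).2 (\sum_l f l) = \prod_l (sval p).2 (f l).
Proof.
case: (svalP p) => _ one mult _; elim: r f => [|r IH] f hf.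
  by rewrite !big_ord0; split=> //; exact: dual_cone0.
rewrite !big_ord_recl; have [h1 h2] := IH (fun l => f (lift ord0 l)) (fun l => hf _).
by split; [exact: dual_coneD|rewrite mult // h2].
Qed.

Lemma restrict_toric (p : pt X) l : toric_point Theta
  (component l (sval p).1, fun m => (sval p).2 (m *m (K l)^T)).
Proof.
case: (svalP p) => hS one mult orth; split=> /=.
- exact: component_fan.
- by rewrite mul0mx.
- by move=> m m' hm hm'; rewrite mulmxDl; apply: mult; exact: dual_embed.
- move=> m /orth h x hx; have := h _ hx.
  by rewrite to_realKt -pairingK mulLK eqxx.
Qed.

(** Restriction of a point, as a multiplicative function on characters, to the characters of
    the l-th plane. *)
Definition split_point (p : pt X) : 'I_k -> pt S :=
  fun l => exist _ _ (restrict_toric p l).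

Lemma glue_toric (q : 'I_k -> pt S) : toric_point Sigma
  (product_cone (fun l => (sval (q l)).1), fun n => \prod_l (sval (q l)).2 (n *m (L l)^T)).
Proof.
have hT l : Theta (sval (q l)).1 by case: (svalP (q l)).
have hS := product_fan hT; split=> //=.
- by rewrite big1 // => l _; rewrite mul0mx; case: (svalP (q l)).
- move=> n n' hn hn'; rewrite -big_split /=; apply: eq_bigr => l _; rewrite mulmxDl.
  have [_ _ mult _] := svalP (q l); apply: mult.
    by have := @dual_component (product_cone (fun l => (sval (q l)).1)) l _ hn; rewrite component_product.
  by have := @dual_component (product_cone (fun l => (sval (q l)).1)) l _ hn'; rewrite component_product.
- move=> n; rewrite prodf_seq_neq0 => /allP h; apply: orthogonal_product => // l.
  rewrite component_product //; have [_ _ _] := svalP (q l); apply.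
  exact: h (mem_index_enum _).
Qed.

Definition glue_point (q : 'I_k -> pt S) : pt X := exist _ _ (glue_toric q).

Lemma split_pointK : cancel split_point glue_point.
Proof.
move=> p; apply: toric_pt_inj => /=; have [hS one mult orth] := svalP p.
rewrite [RHS]surjective_pairing; congr pair; first exact: product_component.
apply/funext => n.
have [hn|hn] := EM (dual_cone (sval p).1 n).
  have [|_ <-] := @char_sum p k (fun l => n *m (L l)^T *m (K l)^T).
    by move=> l; apply: dual_embed => //; exact: dual_component.
  by rewrite -split_char.
(* Off the dual cone of p both sides vanish, since a point is supported on the orthogonal
   lattice of its cone. *)
have z : (sval p).2 n = 0.
  by apply: contra_notP hn => /eqP/orth; exact: orthogonal_dual.
rewrite z; apply: contra_notP hn => /eqP; rewrite prodf_seq_neq0 => /allP h.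
apply: dual_product => // l; apply: orthogonal_dual => x hx.
have := orth _ (h l (mem_index_enum _)) (x *m realmx (L l)) hx.
by rewrite to_realKt -pairingK mulLK eqxx.
Qed.

Lemma glue_pointK : cancel glue_point split_point.
Proof.
move=> q; apply/funext => l; apply: toric_pt_inj => /=.
have hT j : Theta (sval (q j)).1 by case: (svalP (q j)).
rewrite [RHS]surjective_pairing; congr pair; first exact: component_product.
apply/funext => m; rewrite (bigD1 l) //= big1 ?mulr1 => [|j jl].
  by rewrite -mulmxA -trmx_mul (splitting_LK LK) eqxx trmx1 mulmx1.
rewrite -mulmxA -trmx_mul (splitting_LK LK) (negPf jl) trmx0 mulmx0.
by case: (svalP (q j)).
Qed.

Lemma split_point_morphism : @is_morphism C X (variety_power S k) split_point.
Proof.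
apply: morphism_charts => p j hj.
pose tau l := sval (j l).
have hT l : Theta (tau l) by exact: (svalP (j l)).
have hS := product_fan hT; pose i : chart X := exist _ _ hS; exists i.
have pS : Sigma (sval p).1 by case: (svalP p).
split=> [x hx l|p' hp' l x hx|g].
- apply: (hj l); rewrite /= -(product_component pS) in hx; exact: hx.
- by have := hp' _ hx => /(_ l); rewrite mulLK eqxx.
move=> [n [c [g0 [hg ->]]]].
suff [g' gi gE] : on_chart i (fun p => \sum_(a < n) c a * \prod_l g0 a l (split_point p l)).
  by exists g'.
apply: on_chart_sum => a; apply: on_chartM; first exact: on_chart_const.
apply: on_chart_prod => l; have /coordP[s hs ->] := hg a l.
exists (laurent [seq (t.1, t.2 *m (K l)^T) | t <- s]).
  apply/coordP; exists [seq (t.1, t.2 *m (K l)^T) | t <- s] => //.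
  move=> _ /mapP[t ts ->]; apply: dual_embed => //.
  by rewrite component_product //; exact: hs.
by move=> p' _; rewrite /laurent big_map.
Qed.

Lemma glue_point_morphism : @is_morphism C (variety_power S k) X glue_point.
Proof.
apply: morphism_charts => q j hj; have jS : Sigma (sval j) := svalP j.
pose i l : chart S := exist _ _ (component_fan l jS).
have hT l : Theta (sval (q l)).1 by case: (svalP (q l)).
exists i; split=> [l x hx|q' hq' x hx|g].
- by apply: hj; rewrite -[(sval (q l)).1](component_product l hT) in hx; exact: hx.
- by rewrite -(product_component jS) => l; apply: (hq' l); exact: hx.
move=> [n [c [m [hm ->]]]].
exists (fun q => \sum_(a < n) c a * \prod_l (sval (q l)).2 (m a *m (L l)^T)) => //.
exists n, c, (fun a l (p : pt S) => (sval p).2 (m a *m (L l)^T)); split=> // a l.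
apply/coordP; exists [:: (1, m a *m (L l)^T)].
  by move=> t; rewrite inE => /eqP -> /=; apply: dual_component; exact: hm.
by apply/funext => p; rewrite /laurent big_seq1 mul1r.
Qed.

(** The cones of the fan are the products of cones of the factors, every character is a sum
    of characters of the planes, and on charts the coordinate ring of a product is spanned
    by products of characters. *)
Lemma hexhull_variety : isomorphic X (variety_power S k).
Proof.
exists split_point, glue_point; split; [exact: split_point_morphism
  |exact: glue_point_morphism|exact: split_pointK|exact: glue_pointK].
Qed.

End Product.

(** * Rational functions of one variable *)

Section OneVariable.
Variable C : numClosedFieldType.
Implicit Types (p q h : {poly C}) (c f g : C -> C) (s x : C) (P Q : C -> Prop).

Local Notation hornS := (hornerD, hornerN, hornerM, hornerC, hornerX, hornerZ, hornerXn, hornerMn, horner0).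

Lemma poly_all0 p : (forall x, p.[x] = 0) -> p = 0.
Proof.
move=> h; apply/eqP; apply: contraT => p0.
have := @max_poly_roots _ p [seq i%:R | i <- iota 0 (size p)] p0.
rewrite size_map size_iota ltnn; apply.
  by apply/allP => x _; rewrite /root h.
by rewrite map_inj_uniq ?iota_uniq // => i j /eqP; rewrite eqr_nat => /eqP.
Qed.

(** Open sets of the affine line are complements of zero sets of polynomials. *)
Definition near_at s0 P : Prop := exists2 h, h.[s0] != 0 & forall s, h.[s] != 0 -> P s.
Definition generically P : Prop := exists2 h, h != 0 & forall s, h.[s] != 0 -> P s.

Lemma near_generically s0 P : near_at s0 P -> generically P.
Proof.
move=> [h h0 hP]; exists h => //; apply: contraNneq h0 => ->; by rewrite horner0.
Qed.

Lemma near_at_self s0 P : near_at s0 P -> P s0.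
Proof. by move=> [h h0]; apply. Qed.

Lemma near_at_sub s0 P Q : (forall s, P s -> Q s) -> near_at s0 P -> near_at s0 Q.
Proof. by move=> PQ [h h0 hP]; exists h => // s /hP /PQ. Qed.

Lemma near_at_neq s0 x : s0 != x -> near_at s0 (fun s => s != x).
Proof.
move=> sx; exists ('X - x%:P); first by rewrite !hornS subr_eq0.
by move=> s; rewrite !hornS subr_eq0.
Qed.

Lemma generically_and P Q : generically P -> generically Q -> generically (fun s => P s /\ Q s).
Proof.
move=> [h h0 hP] [h' h0' hQ]; exists (h * h'); first exact: mulf_neq0.
by move=> s; rewrite hornerM mulf_eq0 negb_or => /andP[/hP ? /hQ ?].
Qed.

Lemma generically_sub P Q : (forall s, P s -> Q s) -> generically P -> generically Q.
Proof. by move=> PQ [h h0 hP]; exists h => // s /hP /PQ. Qed.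

Lemma generically_ex P : generically P -> ~ (forall s, P s -> False).
Proof.
move=> [h h0 hP] n; case/eqP: h0; apply: poly_all0 => x.
by apply/eqP; apply: contraT => /hP /n.
Qed.

Lemma poly_generic_eq p q : generically (fun s => p.[s] = q.[s]) -> p = q.
Proof.
move=> [h h0 hP]; apply/eqP; rewrite -subr_eq0 -(mulIr_eq0 _ (mulIf h0)); apply/eqP.
apply: poly_all0 => x; rewrite !hornS.
have [->|/hP ->] := eqVneq h.[x] 0; first by rewrite mulr0.
by rewrite subrr mul0r.
Qed.

(** A function that is rational near s0, with its derivative there, computed algebraically
    from any fraction that represents it. *)
Definition rderiv c s0 (d : C) : Prop := exists p q, [/\ q.[s0] != 0,
  forall s, q.[s] != 0 -> c s = p.[s] / q.[s] &
  d = (p^`().[s0] * q.[s0] - p.[s0] * q^`().[s0]) / q.[s0] ^+ 2].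

Definition rational_at c s0 : Prop := exists d, rderiv c s0 d.

Lemma rational_atP c s0 : rational_at c s0 <->
  exists p q, q.[s0] != 0 /\ forall s, q.[s] != 0 -> c s = p.[s] / q.[s].
Proof.
split=> [[d [p [q [h1 h2 _]]]]|[p [q [h1 h2]]]]; first by exists p, q.
by eexists; exists p, q; split.
Qed.

Lemma rderiv_unique c s0 d d' : rderiv c s0 d -> rderiv c s0 d' -> d = d'.
Proof.
move=> [p [q [q0 cE ->]]] [p' [q' [q0' cE' ->]]].
have e : p * q' = p' * q.
  apply: poly_generic_eq; exists (q * q').
    by apply: contraNneq q0 => /eqP; rewrite mulf_eq0 => /orP[/eqP ->|/eqP h];
      rewrite ?horner0 //; move: q0'; rewrite h horner0 eqxx.
  move=> s; rewrite hornerM mulf_eq0 negb_or => /andP[h h'].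
  have := cE s h; rewrite (cE' s h') !hornerM => e.
  by have := congr1 (fun z => z * q.[s] * q'.[s]) e; rewrite divfK // mulrAC divfK // => ->; rewrite mulrC.
have e0 := congr1 (fun r => r.[s0]) e; rewrite !hornerM in e0.
have e1 := congr1 (fun r : {poly C} => r^`().[s0]) e; rewrite !derivM !hornS in e1.
apply/eqP; rewrite eqr_div ?expf_neq0 //; apply/eqP.
move: e0 e1; move: p.[s0] q.[s0] p'.[s0] q'.[s0] p^`().[s0] q^`().[s0] p'^`().[s0] q'^`().[s0].
move=> P Q P' Q' dP dQ dP' dQ' e0 e1.
have -> : (dP * Q - P * dQ) * Q' ^+ 2 = (dP * Q' + P * dQ') * Q * Q' - P * Q' * (dQ * Q' + Q * dQ').
  by ring.
rewrite e0 e1; ring.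
Qed.

Lemma rderiv_local c c' s0 d : near_at s0 (fun s => c s = c' s) -> rderiv c s0 d -> rderiv c' s0 d.
Proof.
move=> [h h0 hE] [p [q [q0 cE ->]]]; exists (p * h), (q * h); split.
- by rewrite hornerM mulf_neq0.
- move=> s; rewrite !hornerM mulf_eq0 negb_or => /andP[qs hs].
  by rewrite -hE // cE // -mulf_div divff // mulr1.
by rewrite !derivM !hornS; field; rewrite q0 h0.
Qed.

Lemma rational_local c c' s0 : near_at s0 (fun s => c s = c' s) -> rational_at c s0 -> rational_at c' s0.
Proof. by move=> h [d /(rderiv_local h) hd]; exists d. Qed.

Lemma rderiv_const (a : C) s0 : rderiv (fun=> a) s0 0.
Proof.
exists a%:P, 1%:P; rewrite !hornS oner_eq0; split=> //.
  by move=> s _; rewrite !hornS divr1.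
by rewrite !derivC !hornS; field.
Qed.

Lemma rderivD c c' s0 d d' : rderiv c s0 d -> rderiv c' s0 d' ->
  rderiv (fun s => c s + c' s) s0 (d + d').
Proof.
move=> [p [q [q0 cE ->]]] [p' [q' [q0' cE' ->]]].
exists (p * q' + p' * q), (q * q'); split; first by rewrite hornerM mulf_neq0.
  move=> s; rewrite !hornS mulf_eq0 negb_or => /andP[h h'].
  by rewrite cE // cE' // addf_div // mulrC [q.[s] * _]mulrC.
by rewrite !poly.derivE !hornS; field; rewrite q0 q0'.
Qed.

Lemma rderivM c c' s0 d d' : rderiv c s0 d -> rderiv c' s0 d' ->
  rderiv (fun s => c s * c' s) s0 (d * c' s0 + c s0 * d').
Proof.
move=> [p [q [q0 cE ->]]] [p' [q' [q0' cE' ->]]].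
exists (p * p'), (q * q'); split; first by rewrite hornerM mulf_neq0.
  move=> s; rewrite !hornS mulf_eq0 negb_or => /andP[h h'].
  by rewrite cE // cE' // mulf_div.
rewrite cE // cE' // !poly.derivE !hornS.
by field; rewrite ?q0 ?q0'.
Qed.

Lemma rderivV c s0 d : c s0 != 0 -> rderiv c s0 d -> rderiv (fun s => (c s)^-1) s0 (- d / c s0 ^+ 2).
Proof.
move=> c0 [p [q [q0 cE ->]]].
have p0 : p.[s0] != 0 by apply: contraNneq c0 => h; rewrite cE // h mul0r.
exists (q * q), (p * q); split; first by rewrite hornerM mulf_neq0.
  move=> s; rewrite !hornS mulf_eq0 negb_or => /andP[h h'].
  by rewrite cE // invf_div -mulf_div divff // mulr1.
rewrite cE // !poly.derivE !hornS; by field; rewrite q0 p0.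
Qed.

Lemma rational_const (a : C) s0 : rational_at (fun=> a) s0.
Proof. by exists 0; exact: rderiv_const. Qed.
Lemma rationalD c c' s0 : rational_at c s0 -> rational_at c' s0 -> rational_at (fun s => c s + c' s) s0.
Proof. by move=> [d h] [d' h']; exists (d + d'); exact: rderivD. Qed.
Lemma rationalM c c' s0 : rational_at c s0 -> rational_at c' s0 -> rational_at (fun s => c s * c' s) s0.
Proof. by move=> [d h] [d' h']; exists (d * c' s0 + c s0 * d'); exact: rderivM. Qed.
Lemma rationalV c s0 : c s0 != 0 -> rational_at c s0 -> rational_at (fun s => (c s)^-1) s0.
Proof. by move=> c0 [d h]; exists (- d / c s0 ^+ 2); exact: rderivV. Qed.

Lemma rderivX n s0 : rderiv (fun s => s ^+ n) s0 (n%:R * s0 ^+ n.-1).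
Proof.
exists 'X^n, 1%:P; rewrite !hornS oner_eq0; split=> //.
  by move=> s _; rewrite !hornS divr1.
by rewrite derivXn derivC !hornS expr1n divr1 mulr0 subr0 mulr1 mulr_natl.
Qed.

Lemma rational_expz (z : int) s0 : s0 != 0 -> rational_at (fun s => s ^ z) s0.
Proof.
move=> s00; case: z => n; first by exists (n%:R * s0 ^+ n.-1); exact: rderivX.
apply: rationalV; first by rewrite expf_neq0.
by exists (n.+1%:R * s0 ^+ n); exact: rderivX.
Qed.

Lemma rderiv_expz (z : int) : rderiv (fun s => s ^ z) 1 z%:~R.
Proof.
case: z => n; first by have := rderivX n 1; rewrite expr1n mulr1.
have := rderivV (c := fun s => s ^+ n.+1) _ (rderivX n.+1 1).
rewrite !expr1n mulr1 divr1 NegzE rmorphN; apply; exact: oner_neq0.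
Qed.

(** Clearing denominators leaves an identity between polynomials, which holds everywhere if
    it holds generically. *)
Lemma rational_eq c c' s0 : rational_at c s0 -> rational_at c' s0 ->
  generically (fun s => c s = c' s) -> near_at s0 (fun s => c s = c' s).
Proof.
move=> /rational_atP[p [q [q0 cE]]] /rational_atP[p' [q' [q0' cE']]] g.
have qn (r : {poly C}) : r.[s0] != 0 -> r != 0 by apply: contraNneq => ->; rewrite horner0.
have e : p * q' = p' * q.
  apply: poly_generic_eq.
  have g' : generically (fun s => q.[s] != 0 /\ q'.[s] != 0).
    by apply: generically_and; [exists q|exists q'] => //; exact: qn.
  apply: generically_sub (generically_and g g') => s [e [h h']].
  rewrite cE // cE' // in e; rewrite !hornerM.
  by have := congr1 (fun z => z * q.[s] * q'.[s]) e; rewrite divfK // mulrAC divfK // => ->; rewrite mulrC.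
exists (q * q'); first by rewrite hornerM mulf_neq0.
move=> s; rewrite hornerM mulf_eq0 negb_or => /andP[h h'].
rewrite cE // cE' //; apply/eqP; rewrite eqr_div //.
by rewrite -!hornerM e.
Qed.

(** In lowest terms the denominator has no root, so c is a polynomial, and regularity at
    infinity, expressed through c', bounds its degree by 0. *)
Lemma rational_proper_const c c' : (forall s0, rational_at c s0) -> rational_at c' 0 ->
  (forall s, s != 0 -> c' s = c s^-1) -> forall s, c s = c 1.
Proof.
move=> rc rc' cc'.
have [p [q [q0 cE]]] := (rational_atP c 1).1 (rc 1).
have qn : q != 0 by apply: contraNneq q0 => ->; rewrite horner0.
pose r := gcdp p q; have rn : r != 0 by rewrite gcdp_eq0 negb_and qn orbT.
pose p1 := p %/ r; pose q1 := q %/ r.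
have pE : p = p1 * r by rewrite divpK // dvdp_gcdl.
have qE : q = q1 * r by rewrite divpK // dvdp_gcdr.
have cop : coprimep p1 q1 by rewrite /p1 /q1 coprimep_div_gcd // qn orbT.
have val s : q1.[s] != 0 /\ c s = p1.[s] / q1.[s].
  have [u [v [v0 cE']]] := (rational_atP c s).1 (rc s).
  have e : p1 * v = u * q1.
    apply: poly_generic_eq; exists (q * v).
      by rewrite mulf_neq0 //; apply: contraNneq v0 => ->; rewrite horner0.
    move=> x; rewrite hornerM mulf_eq0 negb_or => /andP[hq hv].
    have := cE x hq; rewrite (cE' x hv).
    move: hq; rewrite pE qE !hornerM mulf_eq0 negb_or => /andP[hq1 hr].
    rewrite -mulf_div divff // mulr1 => /eqP; rewrite eqr_div // => /eqP ->.
    by rewrite mulrC.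
  have q1s : q1.[s] != 0.
    have : q1 %| v.
      rewrite -(Gauss_dvdpr _ (q := p1)) 1?coprimep_sym //.
      by rewrite e dvdp_mulIr.
    move=> /dvdpP[w wE]; apply: contraNneq v0 => h.
    by rewrite wE hornerM h mulr0.
  have := congr1 (fun r => r.[s]) e; rewrite !hornerM => es.
  by split=> //; rewrite cE' //; apply/eqP; rewrite eqr_div // es.
have q1c : size q1 == 1%N.
  by apply: contraT => /closed_rootP[x]; rewrite /root; have [/negPf ->] := val x.
have [a a0 q1E] := size_poly1P _ q1c.
pose P := a^-1 *: p1.
have PE s : c s = P.[s].
  by have [_ ->] := val s; rewrite q1E hornerC hornerZ mulrC.
have [u [v [v0 c'E]]] := (rational_atP c' 0).1 rc'.
(* Q is the polynomial P with its coefficients reversed, so Q.[0] is the leading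
   coefficient of P. *)
pose n := (size P).-1; pose Q := \poly_(i < n.+1) P`_(n - i).
have [P0|Pn] := eqVneq P 0; first by move=> s; rewrite !PE P0 !horner0.
have sP : size P = n.+1 by rewrite prednK // size_poly_gt0.
have QE s : s != 0 -> Q.[s] = s ^+ n * P.[s^-1].
  move=> s0; rewrite horner_poly (reindex_inj rev_ord_inj) /=.
  rewrite horner_coef sP mulr_sumr; apply: eq_bigr => i _.
  rewrite subSS subKn; last by rewrite -ltnS ltn_ord.
  by rewrite mulrCA exprVn -expfB_cond ?(negPf s0) // -ltnS ltn_ord.
have e : Q * v = 'X^n * u.
  apply: poly_generic_eq; exists ('X * v).
    by rewrite mulf_neq0 ?polyX_eq0 //; apply: contraNneq v0 => ->; rewrite horner0.
  move=> s; rewrite hornerM hornerX mulf_eq0 negb_or => /andP[s0 vs].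
  rewrite !hornerM hornerXn QE // -PE -cc' // c'E //.
  by rewrite mulrAC -!mulrA [_ * (u.[s] / _)]mulrC divfK.
have Q0 : Q.[0] != 0.
  rewrite horner_coef0 coef_poly /= subn0 -lead_coefE lead_coef_eq0 //.
have n0 : n = 0%N.
  apply/eqP; rewrite -leqn0 leqNgt; apply/negP => npos.
  have := congr1 (fun w => w.[0]) e; rewrite !hornerM hornerXn expr0n.
  by rewrite gtn_eqF // mul0r => /eqP; rewrite mulf_eq0 (negPf Q0) (negPf v0).
have /size1_polyC Pc : (size P <= 1)%N by rewrite sP n0.
by move=> s; rewrite !PE Pc !hornerC.
Qed.

(** The vector field s d/ds on the multiplicative group. *)
Definition euler p : {poly C} := 'X * p^`().

Lemma eulerM p q : euler (p * q) = euler p * q + p * euler q.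
Proof. by rewrite /euler derivM; ring. Qed.
Lemma eulerXn n : euler 'X^n = n%:R *: 'X^n.
Proof.
rewrite /euler derivXn; case: n => [|n]; first by rewrite mulr0n mulr0 scale0r.
by rewrite /= mulrnAr -exprS scaler_nat.
Qed.
Lemma euler_lin a p b q : euler (a *: p - b *: q) = a *: euler p - b *: euler q.
Proof. by rewrite /euler derivB !derivZ mulrBr !scalerAr. Qed.

Lemma coef_euler p i : (euler p)`_i = p`_i *+ i.
Proof. by rewrite /euler coefXM; case: i => [|i] /=; rewrite ?mulr0n // coef_deriv. Qed.

Lemma size_euler p : (size (euler p) <= size p)%N.
Proof.
by apply/leq_sizeP => i hi; rewrite coef_euler nth_default // mul0rn.
Qed.

Lemma coefM_top p q m n : (size p <= m.+1)%N -> (size q <= n.+1)%N ->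
  (p * q)`_(m + n) = p`_m * q`_n.
Proof.
move=> hp hq; rewrite coefM (bigD1 (inord m)) //= inordK ?ltnS ?leq_addr // addKn.
rewrite big1 ?addr0 // => i im; have im' : (i : nat) != m.
  by apply: contra im => /eqP h; apply/eqP/val_inj; rewrite /= inordK // ltnS leq_addr.
have [lt|le] := ltnP m i; first by rewrite nth_default ?mul0r // (leq_trans hp).
rewrite [q`_ _]nth_default ?mulr0 // (leq_trans hq) //.
have {}le : (i < m)%N by rewrite ltn_neqAle im' le.
by clear -le; lia.
Qed.

(** The operator multiplies the coefficient of degree i by i, so the leading coefficients of
    the two products do not cancel unless the degrees agree. *)
Lemma euler_wronskian_top p q : p != 0 -> q != 0 ->
  (euler p * q - p * euler q)`_((size p).-1 + (size q).-1) =
  ((size p).-1%:R - (size q).-1%:R) * (lead_coef p * lead_coef q).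
Proof.
move=> p0 q0; set m := (size p).-1; set n := (size q).-1.
have sp : size p = m.+1 by rewrite prednK // size_poly_gt0.
have sq : size q = n.+1 by rewrite prednK // size_poly_gt0.
rewrite coefB !coefM_top ?sp ?sq //; try by rewrite -?sp -?sq size_euler.
rewrite !coef_euler -!lead_coefE -mulr_natl -[_ *+ n]mulr_natl; ring.
Qed.

(** The top coefficients give xi = deg p - deg q. After multiplication by powers of 'X both
    polynomials have the same degree and a vanishing Wronskian; the combination r of them
    that has lower degree has a vanishing Wronskian with q1 too, so it is 0. *)
Lemma euler_eigen p q (xi : C) : p != 0 -> q != 0 ->
  euler p * q - p * euler q = xi *: (p * q) ->
  exists m n a, [/\ xi = m%:R - n%:R, a != 0 & 'X^n * p = a *: ('X^m * q)].
Proof.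
move=> p0 q0 e; set m := (size p).-1; set n := (size q).-1.
have lp : lead_coef p != 0 by rewrite lead_coef_eq0.
have lq : lead_coef q != 0 by rewrite lead_coef_eq0.
have sp : size p = m.+1 by rewrite prednK // size_poly_gt0.
have sq : size q = n.+1 by rewrite prednK // size_poly_gt0.
have xiE : xi = m%:R - n%:R.
  have := euler_wronskian_top p0 q0; rewrite e coefZ coefM_top ?sp ?sq //=.
  rewrite -!lead_coefE => /(mulIf _); apply; exact: mulf_neq0.
pose p1 := 'X^n * p; pose q1 := 'X^m * q.
have q10 : q1 != 0 by rewrite mulf_neq0 // monic_neq0 ?monicXn.
have e1 : euler p1 * q1 = p1 * euler q1.
  apply/eqP; rewrite -subr_eq0 /p1 /q1 !eulerM !eulerXn; apply/eqP.
  transitivity ('X^n * 'X^m * ((n%:R - m%:R) *: (p * q) + (euler p * q - p * euler q))).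
    rewrite -!mul_polyC; ring.
  by rewrite e xiE -scalerDl addrA subrK subrr scale0r mulr0.
pose r := lead_coef q *: p1 - lead_coef p *: q1.
have [r0|rn] := eqVneq r 0.
  exists m, n, (lead_coef p / lead_coef q); split=> //.
    by rewrite mulf_neq0 ?invr_neq0.
  apply: (scalerI lq); rewrite scalerA mulrCA divff // mulr1.
  by apply/eqP; rewrite -subr_eq0 -/p1 -/q1 -/r r0.
exfalso; have er : euler r * q1 - r * euler q1 = 0.
  by rewrite /r euler_lin !mulrBl -!scalerAl e1 [euler q1 * q1]mulrC subrr.
have sz (u : {poly C}) i : u != 0 -> size ('X^i * u) = (i + size u)%N.
  by move=> u0; rewrite mulrC size_mulXn // addnC.
have sq1 : size q1 = (m + n).+1 by rewrite sz // sq addnS.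
have sr : (size r < (m + n).+1)%N.
  rewrite ltnS; apply/leq_sizeP => i hi; rewrite /r coefB !coefZ !coefXnM.
  have [im|mi] := eqVneq i (m + n)%N.
    rewrite im ltnNge leq_addl ltnNge leq_addr /= addnK addKn -!lead_coefE; ring.
  have hi' : (m + n < i)%N by rewrite ltn_neqAle eq_sym mi.
  rewrite !ifN -?leqNgt; try lia.
  by rewrite !nth_default ?mulr0 ?subrr // ?sp ?sq; lia.
have := euler_wronskian_top rn q10; rewrite er coef0 sq1 => /esym/eqP.
rewrite mulf_eq0 mulf_eq0 !lead_coef_eq0 (negPf rn) (negPf q10) !orbF subr_eq0 eqr_nat.
by move/eqP => h; move: sr; rewrite -[size r]prednK ?size_poly_gt0 // h /= ltnn.
Qed.

(** Writing c = p / q turns the hypothesis into the equation of [euler_eigen]. *)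
Lemma rational_eigen c (xi : C) : rational_at c 1 -> c 1 != 0 ->
  generically (fun s0 => rderiv (fun s => c (s * s0)) 1 (xi * c s0)) ->
  exists z : int, xi = z%:~R /\ generically (fun s => c s = c 1 * s ^ z).
Proof.
move=> /rational_atP[p [q [q1 cE]]] c1 g.
have qn : q != 0 by apply: contraNneq q1 => ->; rewrite horner0.
have p1 : p.[1] != 0 by apply: contraNneq c1 => h; rewrite cE // h mul0r.
have pn : p != 0 by apply: contraNneq p1 => ->; rewrite horner0.
have e : euler p * q - p * euler q = xi *: (p * q).
  apply: poly_generic_eq.
  have gq : generically (fun s => q.[s] != 0) by exists q.
  apply: generically_sub (generically_and g gq) => s [hd qs].
  have hd' : rderiv (fun x => c (x * s)) 1
      (s * (p^`().[s] * q.[s] - p.[s] * q^`().[s]) / q.[s] ^+ 2).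
    exists (p \Po (s *: 'X)), (q \Po (s *: 'X)).
    rewrite !deriv_comp !hornerM !horner_comp !hornS mulr1; split=> //.
      by move=> x; rewrite !horner_comp !hornS [s * x]mulrC; exact: cE.
    rewrite !derivZ !derivX !hornS; congr (_ / _); ring.
  have := rderiv_unique hd hd'; rewrite cE // => h.
  rewrite /euler !hornS.
  have := congr1 (fun z => z * q.[s] ^+ 2) h; rewrite divfK ?expf_neq0 // => h'.
  transitivity (s * (p^`().[s] * q.[s] - p.[s] * q^`().[s])); first by ring.
  by rewrite -h'; field.
have [m [n [a [-> a0 pq]]]] := euler_eigen pn qn e.
exists (m%:Z - n%:Z); split; first by rewrite rmorphB.
have ac : a = c 1.
  have := congr1 (fun r => r.[1]) pq; rewrite hornerZ !hornerM !hornerXn !expr1n !mul1r.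
  by rewrite cE // => ->; rewrite mulfK.
exists ('X * q); first by rewrite mulf_neq0 ?polyX_eq0.
move=> s; rewrite hornerM hornerX mulf_eq0 negb_or => /andP[s0 qs].
have := congr1 (fun r => r.[s]) pq; rewrite hornerZ !hornerM !hornerXn => h.
rewrite cE // -ac expfzDr // -exprnN -exprnP.
apply: (mulIf qs); rewrite divfK //; apply: (mulfI (expf_neq0 n s0)).
rewrite h; have := expf_neq0 n s0; move: (s ^+ n) (s ^+ m) => v u v0.
by field.
Qed.

End OneVariable.

(** * One-parameter subgroups of the torus and their vector fields *)

Lemma rational_nonzero (C : numClosedFieldType) (c : C -> C) s0 :
  rational_at c s0 -> c s0 != 0 -> near_at s0 (fun s => c s != 0).
Proof.
move=> /rational_atP[p [q [q0 cE]]] c0.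
have p0 : p.[s0] != 0 by apply: contraNneq c0 => h; rewrite cE // h mul0r.
exists (p * q); first by rewrite hornerM mulf_neq0.
by move=> s; rewrite hornerM mulf_eq0 negb_or => /andP[h h']; rewrite cE // mulf_neq0 ?invr_neq0.
Qed.

Section Germs.
Variable C : fieldType.

Definition regular_at (X : prevariety C) (f : pt X -> C) (x : pt X) : Prop :=
  exists (i : chart X) (g h : pt X -> C), [/\ coord i g, coord i h, basic_open i h x &
    forall y, basic_open i h y -> f y = g y / h y].

Lemma morphism_regular (X Y : prevariety C) (phi : pt X -> pt Y) f x :
  is_morphism phi -> regular_at f (phi x) -> regular_at (f \o phi) x.
Proof.
move=> hphi [i [g [h [gi hi xh fE]]]].
have oV : zariski_open (basic_open i h) by move=> y yh; exists i, h; split.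
have rf : regular_on (basic_open i h) f by move=> y yh; exists i, g, h; split.
have [_ r] := hphi _ oV; have [j [g' [h' [g'j h'j xh' _ e]]]] := r f rf x xh.
by exists j, g', h'.
Qed.

End Germs.

Section ToricCurves.
Variables (R : realType) (d : nat) (Sigma : set (set 'rV[R]_d)).
Local Notation C := R[i].
Local Notation X := (toric_variety Sigma).
Implicit Types (p x : pt X) (m n mu : 'rV[int]_d) (s z : C) (f : pt X -> C).

Definition chi m : pt X -> C := fun p => (sval p).2 m.

(** The action of the torus below is indexed by all s, with s = 0 acting as 1. *)
Definition unitv (s : C) : C := if s == 0 then 1 else s.

Lemma unitv_neq0 s : unitv s != 0.
Proof. by rewrite /unitv; case: ifP => [_|->//]; rewrite oner_neq0. Qed.

Lemma unitvE s : s != 0 -> unitv s = s.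
Proof. by rewrite /unitv => /negPf ->. Qed.

Lemma act_toric mu s p : toric_point Sigma ((sval p).1, fun m => chi m p * unitv s ^ pairing mu m).
Proof.
have [h1 h2 h3 h4] := svalP p; split=> //=.
- by rewrite /chi h2 pairing0r expr0z mulr1.
- by move=> m n hm hn; rewrite /chi h3 // pairingDr expfzDr ?unitv_neq0 // mulrACA.
- by move=> m; rewrite mulf_eq0 negb_or => /andP[/h4].
Qed.

(** The action of the one-parameter subgroup mu of the torus at time s. *)
Definition act mu s p : pt X := exist _ _ (act_toric mu s p).

Lemma chi_act m mu s p : s != 0 -> chi m (act mu s p) = chi m p * s ^ pairing mu m.
Proof. by move=> s0; rewrite /chi /= unitvE. Qed.

Lemma chi_actE m mu s p : chi m (act mu s p) = chi m p * unitv s ^ pairing mu m.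
Proof. by []. Qed.

Lemma pt_eq p q : (sval p).1 = (sval q).1 -> (forall m, chi m p = chi m q) -> p = q.
Proof.
move=> e1 e2; apply: toric_pt_inj.
rewrite (surjective_pairing (sval p)) (surjective_pairing (sval q)) e1; congr pair.
by apply/funext => m; exact: e2.
Qed.

Lemma act1 mu p : act mu 1 p = p.
Proof. by apply: pt_eq => [//|m]; rewrite chi_actE unitvE ?oner_neq0 // exp1rz mulr1. Qed.

Lemma actM mu s z p : s != 0 -> z != 0 -> act mu (s * z) p = act mu s (act mu z p).
Proof.
move=> s0 z0; apply: pt_eq => [//|m]; rewrite !chi_actE !unitvE ?mulf_neq0 //.
by rewrite expfzMl -mulrA [_ ^ _ * _]mulrC.
Qed.

Lemma act_add mu nu s p : act (mu + nu) s p = act mu s (act nu s p).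
Proof.
apply: pt_eq => [//|m]; rewrite !chi_actE pairingDl expfzDr ?unitv_neq0 //.
by rewrite -mulrA [_ ^ _ * _]mulrC.
Qed.

Lemma act_comm mu nu s z p : act mu s (act nu z p) = act nu z (act mu s p).
Proof. by apply: pt_eq => [//|m]; rewrite !chi_actE mulrAC. Qed.

Lemma actN mu s p : s != 0 -> act (- mu) s p = act mu s^-1 p.
Proof.
move=> s0; apply: pt_eq => [//|m]; rewrite !chi_actE !unitvE ?invr_neq0 //.
by rewrite pairingNl exprz_inv.
Qed.

(** The monomial m is an eigenvector, of weight <mu, m>, of the vector field of mu. *)
Definition dlaurent mu (t : seq (C * 'rV[int]_d)) : seq (C * 'rV[int]_d) :=
  [seq (a.1 * (pairing mu a.2)%:~R, a.2) | a <- t].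

Lemma laurent_cons a (t : seq (C * 'rV[int]_d)) p :
  laurent (Sigma := Sigma) (a :: t) p = a.1 * chi a.2 p + laurent t p.
Proof. by rewrite /laurent big_cons. Qed.

Lemma near1_neq0 : near_at (1 : C) (fun s => s != 0).
Proof. exact: near_at_neq (oner_neq0 _). Qed.

Lemma laurent_rderiv mu t p : rderiv (fun s => laurent t (act mu s p)) 1 (laurent (dlaurent mu t) p).
Proof.
elim: t => [|a t IH].
  have E s : laurent [::] (act mu s p) = 0 by rewrite /laurent big_nil.
  rewrite [laurent _ p]big_nil; apply: rderiv_local (rderiv_const 0 1).
  by exists 1 => [|s _]; rewrite ?hornerE ?oner_neq0 ?E.
rewrite laurent_cons /=.
apply: (@rderiv_local _ (fun s => a.1 * chi a.2 p * s ^ pairing mu a.2 + laurent t (act mu s p))).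
  by apply: near_at_sub near1_neq0 => s s0; rewrite laurent_cons chi_act // mulrA.
apply: rderivD => //.
have := rderivM (rderiv_const (a.1 * chi a.2 p) 1) (rderiv_expz R[i] (pairing mu a.2)).
by rewrite mul0r add0r mulrAC.
Qed.

Lemma laurent_rational mu t p s0 : s0 != 0 -> rational_at (fun s => laurent t (act mu s p)) s0.
Proof.
move=> s00; elim: t => [|a t IH].
  apply: rational_local (rational_const 0 s0).
  by exists 1 => [|s _]; rewrite ?hornerE ?oner_neq0 // /laurent big_nil.
apply: (@rational_local _ (fun s => a.1 * chi a.2 p * s ^ pairing mu a.2 + laurent t (act mu s p))).
  by apply: near_at_sub (near_at_neq s00) => s hs; rewrite laurent_cons chi_act // mulrA.
by apply: rationalD => //; apply: rationalM; [exact: rational_const|exact: rational_expz].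
Qed.

Lemma basic_open_near mu (i : chart X) h p s0 : s0 != 0 -> coord i h ->
  basic_open i h (act mu s0 p) -> near_at s0 (fun s => basic_open i h (act mu s p)).
Proof.
move=> s00 /coordP[t ht ->] [hd h0].
have := rational_nonzero (laurent_rational mu t p s00) h0.
by apply: near_at_sub => s hs; split.
Qed.

Lemma open_near mu (V : set (pt X)) p s0 : s0 != 0 -> zariski_open V -> V (act mu s0 p) ->
  near_at s0 (fun s => V (act mu s p)).
Proof.
move=> s00 oV /oV[i [h [hi hp hV]]].
by apply: near_at_sub (basic_open_near s00 hi hp) => s; exact: hV.
Qed.

Lemma regular_rational mu f p s0 : s0 != 0 -> regular_at f (act mu s0 p) ->
  rational_at (fun s => f (act mu s p)) s0.
Proof.
move=> s00 [i [g [h [gi hi ph fE]]]].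
have ne := basic_open_near s00 hi ph.
have /coordP[tg _ gE] := gi; have /coordP[th _ hE] := hi.
apply: (@rational_local _ (fun s => laurent tg (act mu s p) * (laurent th (act mu s p))^-1)).
  by apply: near_at_sub ne => s /fE ->; rewrite gE hE.
apply: rationalM; first exact: laurent_rational.
by apply: rationalV; [case: ph; rewrite hE|exact: laurent_rational].
Qed.

(** The derivative at s = 1 along the orbits of mu. *)
Definition vfield mu f : pt X -> C :=
  fun x => xget 0 [set e | rderiv (fun s => f (act mu s x)) 1 e].

Lemma vfieldE mu f x e : rderiv (fun s => f (act mu s x)) 1 e -> vfield mu f x = e.
Proof.
move=> h; rewrite /vfield; case: xgetP => [y _ hy|/(_ e)//].
exact: rderiv_unique hy h.
Qed.

Lemma vfieldP mu f x : regular_at f x -> rderiv (fun s => f (act mu s x)) 1 (vfield mu f x).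
Proof.
move=> rf; have [|e he] := @regular_rational mu f x 1 (oner_neq0 _); first by rewrite act1.
by rewrite (vfieldE he).
Qed.

Lemma vfield_quotient mu f (i : chart X) tg th x :
  (forall y, basic_open i (laurent th) y -> f y = laurent tg y / laurent th y) ->
  coord i (laurent th) -> basic_open i (laurent th) x ->
  vfield mu f x = (laurent (dlaurent mu tg) x * laurent th x -
                   laurent tg x * laurent (dlaurent mu th) x) / laurent th x ^+ 2.
Proof.
move=> fE hi xh; have [xi xn] := xh; apply: vfieldE.
have ne : near_at 1 (fun s => basic_open i (laurent th) (act mu s x)).
  by apply: basic_open_near; rewrite ?oner_neq0 ?act1.
apply: (@rderiv_local _ (fun s => laurent tg (act mu s x) * (laurent th (act mu s x))^-1)).
  by apply: near_at_sub ne => s /fE ->.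
have hV := rderivV (c := fun s => laurent th (act mu s x)) _ (laurent_rderiv mu th x).
rewrite act1 in hV; have := rderivM (laurent_rderiv mu tg x) (hV xn).
rewrite !act1; set e := (X in rderiv _ _ X -> _); set e' := (X in _ -> rderiv _ _ X).
suff -> : e = e' by [].
by rewrite /e /e'; field.
Qed.

(** By the quotient rule, which keeps denominators invertible where they were. *)
Lemma vfield_regular mu f x : regular_at f x -> regular_at (vfield mu f) x.
Proof.
move=> [i [g [h [gi hi xh fE]]]].
have [tg htg gE] := (coordP i g).1 gi; have [th hth hE] := (coordP i h).1 hi; subst g h.
have hd t : (forall a, a \in t -> dual_cone (sval i) a.2) -> coord i (laurent (dlaurent mu t)).
  by move=> ht; apply/coordP; exists (dlaurent mu t) => // _ /mapP[a /ht ha ->].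
have oc t : coord i (laurent (Sigma := Sigma) t) -> on_chart i (laurent t) by exact: coord_on_chart.
have [g' g'i g'E] : on_chart i (fun p => laurent (dlaurent mu tg) p * laurent th p +
    -1 * (laurent tg p * laurent (dlaurent mu th) p)).
  apply: on_chartD; first by apply: on_chartM; apply: oc => //; exact: hd.
  apply: on_chartM; first exact: on_chart_const.
  by apply: on_chartM; apply: oc => //; exact: hd.
have [h' h'i h'E] : on_chart i (fun p => laurent th p * laurent th p).
  by apply: on_chartM; exact: oc.
have bo y : basic_open i h' y -> basic_open i (laurent th) y.
  move=> [yi]; rewrite -h'E // mulf_eq0 negb_or => /andP[yn _]; by split.
exists i, g', h'; split=> //.
  by have [xi xn] := xh; split=> //; rewrite -h'E // mulf_neq0.
move=> y yh'; have yh := bo y yh'; rewrite (vfield_quotient mu fE hi yh).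
by have [yi _] := yh; rewrite -g'E // -h'E // mulN1r expr2.
Qed.

Lemma vfield_add mu nu f x : regular_at f x -> vfield (mu + nu) f x = vfield mu f x + vfield nu f x.
Proof.
move=> [i [g [h [gi hi xh fE]]]].
have [tg htg gE] := (coordP i g).1 gi; have [th hth hE] := (coordP i h).1 hi; subst g h.
have dD t : laurent (Sigma := Sigma) (dlaurent (mu + nu) t) x =
    laurent (dlaurent mu t) x + laurent (dlaurent nu t) x.
  rewrite /laurent !big_map -big_split /=; apply: eq_bigr => a _.
  by rewrite pairingDl intrD; ring.
rewrite !(vfield_quotient _ fE hi xh) !dD; have [_ xn] := xh.
by field.
Qed.

End ToricCurves.

(** * The torus is dense *)

Section TorusPoints.
Variables (R : realType) (d : nat) (Sigma : set (set 'rV[R]_d)).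
Local Notation C := R[i].
Local Notation X := (toric_variety Sigma).
Implicit Types (p x : pt X) (m n mu : 'rV[int]_d) (s z : C) (f : pt X -> C).

Definition torus : set (pt X) := [set p | (sval p).1 `<=` [set 0]].

Lemma torus_dual p m : torus p -> dual_cone (sval p).1 m.
Proof. by move=> tp x /tp ->; rewrite pairing0l. Qed.

Lemma chi_torusD p m n : torus p -> chi (m + n) p = chi m p * chi n p.
Proof. by move=> tp; have [_ _ h _] := svalP p; apply: h; exact: torus_dual. Qed.

Lemma chi0 p : chi 0 p = 1. Proof. by have [_ h _ _] := svalP p. Qed.

Lemma chi_torus_neq0 p m : torus p -> chi m p != 0.
Proof.
move=> tp; apply/eqP => h; have := chi_torusD m (- m) tp.
by rewrite subrr chi0 h mul0r => /eqP; rewrite oner_eq0.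
Qed.

Lemma act_torus p mu s : torus p -> torus (act mu s p).
Proof. by []. Qed.

Lemma chi_torusX p m (a : int) : torus p -> chi (a *: m) p = chi m p ^ a.
Proof.
move=> tp; have X0 (k : nat) : chi (k%:Z *: m) p = chi m p ^+ k.
  elim: k => [|k IH]; first by rewrite scale0r chi0.
  by rewrite intS scalerDl scale1r chi_torusD // IH exprS.
case: a => k; first exact: X0.
rewrite NegzE; apply: (mulfI (chi_torus_neq0 (k.+1%:Z *: m) tp)).
by rewrite -chi_torusD // scaleNr subrr chi0 X0 -exprnN divff // expf_neq0 // chi_torus_neq0.
Qed.

Lemma chi_torus_sum p r (g : 'I_r -> 'rV[int]_d) : torus p ->
  chi (\sum_i g i) p = \prod_i chi (g i) p.
Proof.
move=> tp; elim: r g => [|r IH] g; first by rewrite !big_ord0 chi0.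
by rewrite !big_ord_recl chi_torusD // IH.
Qed.

Lemma chi_torus_basis p m : torus p -> chi m p = \prod_i chi (delta_mx 0 i) p ^ m 0 i.
Proof.
move=> tp; rewrite {1}(row_sum_delta m) chi_torus_sum //.
by apply: eq_bigr => i _; rewrite chi_torusX.
Qed.

Lemma chi_regular p m : dual_cone (sval p).1 m -> regular_at (chi m) p.
Proof.
move=> hm; have hp : Sigma (sval p).1 by have [] := svalP p.
pose i : chart X := exist _ _ hp.
have c1 : coord i (laurent [:: (1, 0)]).
  by apply/coordP; exists [:: (1, 0)] => // t; rewrite inE => /eqP ->; exact: dual_cone0.
have l1 y : laurent (Sigma := Sigma) [:: (1, 0)] y = 1.
  by rewrite /laurent big_seq1 /= [_.2 0]chi0 mulr1.
exists i, (laurent [:: (1, m)]), (laurent [:: (1, 0)]); split=> //.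
- by apply/coordP; exists [:: (1, m)] => // t; rewrite inE => /eqP ->.
- by split=> //; rewrite l1 oner_neq0.
- by move=> y _; rewrite l1 divr1 /laurent big_seq1 mul1r.
Qed.

Hypothesis fan0 : forall sigma, Sigma sigma -> sigma 0.
Hypothesis fanO : Sigma [set 0].

Lemma torus_open : zariski_open torus.
Proof.
move=> p tp; pose i : chart X := exist _ _ fanO.
exists i, (laurent [:: (1, 0)]); split.
- by apply/coordP; exists [:: (1, 0)] => // t; rewrite inE => /eqP ->; exact: dual_cone0.
- by split=> //; rewrite /laurent big_seq1 /= [_.2 0]chi0 mulr1 oner_neq0.
- by move=> y [].
Qed.

Lemma torus_eq p q : torus p -> torus q -> (forall i, chi (delta_mx 0 i) p = chi (delta_mx 0 i) q) -> p = q.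
Proof.
move=> tp tq e; apply: pt_eq => [|m].
  have f0 (r : pt X) : Sigma (sval r).1 by have [] := svalP r.
  by apply/seteqP; split=> x; [move/tp|move/tq] => ->; exact: fan0.
rewrite !chi_torus_basis //.
by apply: eq_bigr => i _; rewrite e.
Qed.

Lemma torpt_toric (z : 'I_d -> C) : toric_point Sigma
  ([set 0], fun m => \prod_i unitv (z i) ^ m 0 i).
Proof.
split=> //=.
- by rewrite big1 // => i _; rewrite mxE expr0z.
- by move=> m n _ _; rewrite -big_split; apply: eq_bigr => i _; rewrite mxE expfzDr ?unitv_neq0.
- by move=> m _ x /= ->; rewrite pairing0l.
Qed.

Definition torpt (z : 'I_d -> C) : pt X := exist _ _ (torpt_toric z).

Lemma torpt_torus (z : 'I_d -> C) : torus (torpt z). Proof. by []. Qed.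

Lemma chi_torpt (z : 'I_d -> C) m : (forall i, z i != 0) -> chi m (torpt z) = \prod_i z i ^ m 0 i.
Proof. by move=> z0; rewrite /chi /=; apply: eq_bigr => i _; rewrite unitvE. Qed.

(** Multiplication by s ^ B with B large turns the sum into a polynomial. *)
Lemma laurent1_coef (t : seq (C * int)) (e0 : int) :
  (forall s, s != 0 -> \sum_(a <- t) a.1 * s ^ a.2 = 0) ->
  \sum_(a <- t) a.1 * (a.2 == e0)%:R = 0.
Proof.
move=> h; pose B : nat := (\sum_(a <- (1%R, e0) :: t) absz a.2)%N.
have Bge a : a \in (1, e0) :: t -> exists k : nat, a.2 + B%:Z = k%:Z.
  move=> ha; exists (absz (a.2 + B%:Z)); rewrite gez0_abs //.
  have : (absz a.2 <= B)%N by rewrite /B (big_rem a) //= leq_addr.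
  by lia.
pose k (a : C * int) := absz (a.2 + B%:Z).
have kE a : a \in (1, e0) :: t -> (k a)%:Z = a.2 + B%:Z.
  by move=> /Bge[j hj]; rewrite /k hj.
have : \sum_(a <- t) a.1 *: 'X^(k a) = 0 :> {poly C}.
  apply: poly_generic_eq; exists 'X; first by rewrite polyX_eq0.
  move=> s; rewrite hornerX => s0; rewrite horner_sum horner0.
  rewrite -[RHS](mul0r (s ^+ B)) -[X in _ = X * _](h s s0) mulr_suml big_seq [RHS]big_seq.
  apply: eq_bigr => a ha; rewrite hornerZ hornerXn -mulrA; congr (_ * _).
  by rewrite -[s ^+ B]/(s ^ B%:Z) -expfzDr // -kE // inE ha orbT.
move/(congr1 (fun p : {poly C} => p`_(k (1, e0)))); rewrite coef_sum coef0 => e.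
rewrite -[RHS]e big_seq [RHS]big_seq; apply: eq_bigr => a ha.
rewrite coefZ coefXn; congr (_ * (_ : bool)%:R).
rewrite -eqz_nat !kE ?inE ?ha ?eqxx ?orbT //= eq_sym.
by apply/eqP/eqP => [->//|/addIr].
Qed.

(** Independence of characters, by extracting the coefficient of one variable at a time. *)
Lemma laurent_coef (t : seq (C * 'rV[int]_d)) (m0 : 'rV[int]_d) :
  (forall y, torus y -> laurent t y = 0) -> \sum_(a <- t) a.1 * (a.2 == m0)%:R = 0.
Proof.
move=> h.
have Q (j : nat) (z : 'I_d -> C) : (forall i, z i != 0) ->
    \sum_(a <- t) a.1 * \prod_(i < d) (if (i < j)%N then (a.2 0 i == m0 0 i)%:R else z i ^ a.2 0 i) = 0.
  move=> z0; elim: j z z0 => [|j IH] z z0.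
    rewrite -[RHS](h (torpt z) (@torpt_torus z)) /laurent; apply: eq_bigr => a _.
    by rewrite -/(chi a.2 (torpt z)) chi_torpt.
  have [jd|dj] := ltnP j d; last first.
    rewrite -[RHS](IH z z0); apply: eq_bigr => a _; congr (_ * _); apply: eq_bigr => i _.
    by rewrite !ifT // ?(leq_trans (ltn_ord i)) // leqW.
  pose oj := Ordinal jd.
  pose rest (a : C * 'rV[int]_d) : C :=
    \prod_(i < d | i != oj) (if (i < j)%N then (a.2 0 i == m0 0 i)%:R else z i ^ a.2 0 i).
  have := @laurent1_coef [seq (a.1 * rest a, a.2 0 oj) | a <- t] (m0 0 oj).
  rewrite big_map => e; rewrite -[RHS]e => [|s s0].
    apply: eq_bigr => a _ /=; rewrite (bigD1 oj) //= ltnSn mulrA mulrAC; congr (_ * _ * _).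
    apply: eq_bigr => i ij; rewrite ltnS leq_eqVlt.
    by rewrite (negPf (_ : (i : nat) != j)) //; apply: contra ij => /eqP h'; apply/eqP/val_inj.
  rewrite big_map -[RHS](IH (fun i => if i == oj then s else z i)) => [|i]; last by case: ifP.
  apply: eq_bigr => a _ /=; rewrite [in RHS](bigD1 oj) //= ltnn eqxx -mulrA; congr (_ * _).
  rewrite mulrC; congr (_ * _); apply: eq_bigr => i /negPf ij; by rewrite ij.
rewrite -[RHS](Q d (fun=> 1) (fun=> oner_neq0 _)); apply: eq_bigr => a _; congr (_ * _).
have [->|ne] := eqVneq a.2 m0.
  by rewrite big1 // => i _; rewrite ltn_ord eqxx.
have [i hi] : exists i, a.2 0 i != m0 0 i.
  apply/existsP; apply: contraNT ne; rewrite negb_exists => /forallP hh.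
  by apply/eqP/rowP => i; have := hh i; rewrite negbK => /eqP.
by rewrite (bigD1 i) //= ltn_ord (negPf hi) mul0r.
Qed.

(** Grouped by characters, a coordinate function that vanishes on the torus has only zero
    coefficients, so it vanishes everywhere. *)
Lemma torus_dense (i : chart X) h p : coord i h -> basic_open i h p ->
  exists y, torus y /\ basic_open i h y.
Proof.
move=> /coordP[t ht ->] [pi]; apply: contra_neqP => nh.
have h0 y : torus y -> laurent t y = 0.
  move=> ty; apply/eqP; apply: contra_notT nh => yn; exists y; split=> //; split=> //.
  by move=> x /ty ->; exact: fan0 (svalP i).
pose U := undup [seq a.2 | a <- t].
have -> : laurent t p = \sum_(m <- U) chi m p * \sum_(a <- t) a.1 * (a.2 == m)%:R.
  transitivity (\sum_(a <- t) \sum_(m <- U) chi m p * (a.1 * (a.2 == m)%:R)).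
    rewrite /laurent big_seq [RHS]big_seq; apply: eq_bigr => a ha.
    have aU : a.2 \in U by rewrite mem_undup map_f.
    rewrite (bigD1_seq a.2) ?undup_uniq //= eqxx mulr1 mulrC big1 ?addr0 // => m /negPf am.
    by rewrite eq_sym am !mulr0.
  by rewrite exchange_big; apply: eq_bigr => m _; rewrite mulr_sumr.
by rewrite big1 // => m _; rewrite laurent_coef ?mulr0.
Qed.

End TorusPoints.

(** * Limits along rays *)

Section LimitPoints.
Variables (R : realType) (d : nat) (Sigma : set (set 'rV[R]_d)).
Local Notation C := R[i].
Local Notation X := (toric_variety Sigma).
Implicit Types (p x y : pt X) (m n v : 'rV[int]_d) (s : C) (f : pt X -> C).

Definition ray v : set 'rV[R]_d := pos [set to_real R v].

Lemma ray_gen v : ray v (to_real R v).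
Proof. by exists 1%N, (fun=> 1), (fun=> to_real R v); rewrite big_ord1 scale1r. Qed.

Lemma dual_ray v m : dual_cone (ray v) m <-> 0 <= pairing v m.
Proof.
split=> [/(_ _ (ray_gen v))|h x]; first by rewrite pairing_to_real ler0z.
by move/pos_ge; apply=> w ->; rewrite pairing_to_real ler0z.
Qed.

Lemma orthogonal_ray v m : pairing v m = 0 -> orthogonal_lattice (ray v) m.
Proof.
move=> h x hx; apply: le_anti; apply/andP; split.
  rewrite -oppr_ge0 -pairingNr; apply: (pos_ge hx) => w ->.
  by rewrite pairingNr pairing_to_real h oppr0.
by apply: (pos_ge hx) => w ->; rewrite pairing_to_real h.
Qed.

Section OneLimit.
Variables (v : 'rV[int]_d) (y : pt X).
Hypotheses (hv : Sigma (ray v)) (ty : torus y).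

Lemma limit_toric : toric_point Sigma (ray v, fun m => if pairing v m == 0 then chi m y else 0).
Proof.
split=> //=; first by rewrite pairing0r eqxx chi0.
- move=> m n /dual_ray hm /dual_ray hn; rewrite pairingDr addr_eq0.
  have [m0|mn] := eqVneq (pairing v m) 0.
    by rewrite m0 eq_sym oppr_eq0; case: ifP => _; rewrite ?mulr0 // chi_torusD.
  rewrite mul0r ifF //; apply/negbTE; apply: contra mn => /eqP h.
  by apply/eqP; move: h hm hn; move: (pairing v m) (pairing v n) => a b; lia.
- move=> m; case: (pairing v m =P 0) => [h _|_]; [exact: (orthogonal_ray h)|by rewrite eqxx].
Qed.

(** The limit of act v s y as s tends to 0: the characters with positive weight tend to 0,
    and those orthogonal to v are constant along the orbit. *)
Definition limit_point : pt X := exist _ _ limit_toric.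

Definition ray_curve s : pt X := if s == 0 then limit_point else act v s y.

Lemma ray_curve0 : ray_curve 0 = limit_point. Proof. by rewrite /ray_curve eqxx. Qed.

Lemma ray_curveE s : s != 0 -> ray_curve s = act v s y.
Proof. by rewrite /ray_curve => /negPf ->. Qed.

Lemma chi_limit m : pairing v m = 0 -> chi m limit_point = chi m y.
Proof. by move=> h; rewrite /chi /= h eqxx. Qed.

Lemma chi_ray_curve m s : 0 <= pairing v m -> chi m (ray_curve s) = chi m y * s ^ pairing v m.
Proof.
rewrite /ray_curve; case: eqP => [-> h|/eqP s0 _]; last exact: chi_act.
rewrite exp0rz /chi /=; by case: eqP => _; rewrite ?mulr1 ?mulr0.
Qed.

Lemma laurent_ray_curve (t : seq (C * 'rV[int]_d)) :
  (forall a, a \in t -> 0 <= pairing v a.2) -> rational_at (fun s => laurent t (ray_curve s)) 0.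
Proof.
elim: t => [|a t IH] ht.
  apply: rational_local (rational_const 0 0).
  by exists 1 => [|s _]; rewrite ?hornerE ?oner_neq0 // /laurent big_nil.
apply: (@rational_local _ (fun s => chi a.2 y * a.1 * s ^+ absz (pairing v a.2)
    + laurent t (ray_curve s))).
  exists 1 => [|s _]; first by rewrite hornerE oner_neq0.
  have ha := ht a (mem_head _ _); rewrite laurent_cons chi_ray_curve // -[in RHS](gez0_abs ha).
  by rewrite mulrCA mulrA.
apply: rationalD; last by apply: IH => b hb; apply: ht; rewrite inE hb orbT.
by apply: rationalM; [exact: rational_const|eexists; exact: rderivX].
Qed.

Hypothesis fan0 : forall sigma, Sigma sigma -> sigma 0.

(** On the chart of the limit point all characters have nonnegative weight, so the
    coordinate functions are polynomials in s along the curve. *)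
Lemma regular_ray_curve f : regular_at f limit_point -> rational_at (fun s => f (ray_curve s)) 0.
Proof.
move=> [i [g [h [gi hi [di hn] fE]]]].
have [tg htg gE] := (coordP i g).1 gi; have [th hth hE] := (coordP i h).1 hi; subst g h.
have ge0 (t : seq (C * 'rV[int]_d)) : (forall a, a \in t -> dual_cone (sval i) a.2) ->
    forall a, a \in t -> 0 <= pairing v a.2.
  move=> ht a /ht h; apply/dual_ray => x hx; exact: h (di x hx).
have dc s : dom i (ray_curve s).
  by rewrite /ray_curve; case: ifP => // _ x /ty ->; exact: fan0 (svalP i).
have rh := laurent_ray_curve (ge0 _ hth).
apply: (@rational_local _ (fun s => laurent tg (ray_curve s) * (laurent th (ray_curve s))^-1)).
  have := rational_nonzero rh; rewrite ray_curve0 => /(_ hn).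
  by apply: near_at_sub => s hs; rewrite fE //; split.
by apply: rationalM; [exact: laurent_ray_curve (ge0 _ htg)|apply: rationalV; rewrite ?ray_curve0].
Qed.

End OneLimit.
End LimitPoints.

Lemma additive_basis d (V : zmodType) (g : 'rV[int]_d -> V) :
  (forall m n, g (m + n) = g m + g n) -> forall m, g m = \sum_i g (delta_mx 0 i) *~ m 0 i.
Proof.
move=> gD; have g0 : g 0 = 0 by apply: (addrI (g 0)); rewrite -gD !addr0.
have gN m : g (- m) = - g m by apply: (addrI (g m)); rewrite -gD !subrr.
have gX (k : nat) m : g (k%:Z *: m) = g m *+ k.
  elim: k => [|k IH]; first by rewrite scale0r g0.
  by rewrite intS scalerDl scale1r gD IH mulrS.
have gZ (z : int) m : g (z *: m) = g m *~ z.
  by case: z => k; rewrite ?NegzE ?scaleNr ?gN gX.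
have gS r (f : 'I_r -> 'rV[int]_d) : g (\sum_i f i) = \sum_i g (f i).
  by elim: r f => [|r IH] f; rewrite ?big_ord0 // !big_ord_recl gD IH.
by move=> m; rewrite {1}(row_sum_delta m) gS; apply: eq_bigr => i _; rewrite gZ.
Qed.

(** * Isomorphisms of toric varieties are equivariant *)

Lemma generically_all (C : numClosedFieldType) n (P : 'I_n -> C -> Prop) :
  (forall i, generically (P i)) -> generically (fun s => forall i, P i s).
Proof.
move=> /fin_all_exists2[h h0 hP]; exists (\prod_i h i).
  by rewrite prodf_seq_neq0; apply/allP => i _ /=; exact: h0.
by move=> s; rewrite horner_prod prodf_seq_neq0 => /allP hs i; apply: hP; exact: hs (mem_index_enum _).
Qed.

Lemma generically_neq0 (C : numClosedFieldType) : generically (fun s : C => s != 0).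
Proof. by exists 'X; [rewrite polyX_eq0|move=> s; rewrite hornerX]. Qed.

(** As c (s ^ 2) = 2 c s, comparing leading coefficients would give 1 = 2 if c were not 0: a
    rational function cannot behave like a logarithm. *)
Lemma rational_log0 (C : numClosedFieldType) (c : C -> C) : rational_at c 1 ->
  (forall s t, s != 0 -> t != 0 -> c (s * t) = c s + c t) -> forall s, s != 0 -> c s = 0.
Proof.
move=> /rational_atP[p [q [q1 cE]]] cM.
have qn : q != 0 by apply: contraNneq q1 => ->; rewrite horner0.
have sX2 : (1 < size ('X^2 : {poly C}))%N by rewrite size_polyXn.
have cn (u : {poly C}) : u != 0 -> u \Po 'X^2 != 0.
  by move=> u0; rewrite -lead_coef_eq0 lead_coef_comp // lead_coefXn expr1n mulr1 lead_coef_eq0.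
have e : (p \Po 'X^2) * q = 2%:R *: (p * (q \Po 'X^2)).
  apply: poly_generic_eq; exists ('X * (q * (q \Po 'X^2))).
    by rewrite !mulf_neq0 ?polyX_eq0 ?cn.
  move=> s; rewrite !hornerM hornerX horner_comp hornerXn !mulf_eq0 !negb_or.
  move=> /and3P[s0 qs qs2]; rewrite hornerZ !hornerM !horner_comp hornerXn.
  have := cM s s s0 s0; rewrite -expr2 !cE // => h.
  have := congr1 (fun z => z * q.[s ^+ 2] * q.[s]) h; rewrite divfK // => ->.
  by field.
have p0 : p = 0.
  apply/eqP; apply: contraT => pn.
  have := congr1 lead_coef e; rewrite lead_coefZ !lead_coefM !lead_coef_comp //.
  rewrite lead_coefXn !expr1n !mulr1 => /eqP; rewrite -subr_eq0 -{1}[_ * _]mul1r -mulrBl mulf_eq0.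
  rewrite mulf_eq0 !lead_coef_eq0 (negPf pn) (negPf qn) !orbF.
  by rewrite mulr2n opprD addrA subrr sub0r oppr_eq0 oner_eq0.
have c0 : generically (fun s => c s = 0).
  by exists q => // s qs; rewrite cE // p0 horner0 mul0r.
move=> s s0; have [h hn h0] := c0.
have hs : h \Po (s *: 'X) != 0.
  rewrite -lead_coef_eq0 lead_coef_comp ?size_scale ?size_polyX //.
  by rewrite lead_coefZ lead_coefX mulr1 mulf_neq0 ?expf_neq0 ?lead_coef_eq0.
apply: contrapT => cs; apply: (@generically_ex C (fun t => h.[t] != 0 /\ h.[s * t] != 0 /\ t != 0)).
  apply: generically_and; first by exists h.
  apply: generically_and; last exact: generically_neq0.
  by exists (h \Po (s *: 'X)) => // t; rewrite horner_comp hornerZ hornerX.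
move=> t [ht [hst t0]]; apply: cs; have := cM s t s0 t0.
by rewrite (h0 _ ht) (h0 _ hst) addr0 => <-.
Qed.

Lemma expz_generic1 (C : numClosedFieldType) (z : int) :
  generically (fun s : C => s ^ z = 1) -> z = 0.
Proof.
move=> g; have X1 n : 'X^(n.+1) <> 1 :> {poly C}.
  by move/(congr1 (fun u : {poly C} => size u)); rewrite size_polyXn size_poly1.
case: z g => [[|n]|n] // g; case: (X1 n); apply: poly_generic_eq.
  by apply: generically_sub g => s h; rewrite hornerXn -polyC1 hornerC.
apply: generically_sub g => s; rewrite NegzE -exprnN => h.
by rewrite hornerXn -polyC1 hornerC -[LHS]invrK h invr1.
Qed.

Section Equivariance.
Variables (R : realType) (d : nat) (Sigma Theta : set (set 'rV[R]_d)).
Local Notation C := R[i].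
Local Notation X := (toric_variety Sigma).
Local Notation Y := (toric_variety Theta).
Variables (phi : pt X -> pt Y) (psi : pt Y -> pt X).
Hypotheses (hphi : is_morphism phi) (hpsi : is_morphism psi).
Hypotheses (phiK : cancel phi psi) (psiK : cancel psi phi).
Hypotheses (Theta0 : forall sigma, Theta sigma -> sigma 0) (ThetaO : Theta [set 0]).
Implicit Types (x : pt X) (y : pt Y) (mu m n v : 'rV[int]_d) (s : C) (a b : 'I_d).
Local Notation e_ a := (delta_mx 0 a : 'rV[int]_d).

Local Opaque act chi ray_curve.
Local Hint Resolve act_torus | 0 : core.

(** The vector field mu of X, carried over to Y by the isomorphism. *)
Definition transport mu (f : pt Y -> C) : pt Y -> C := vfield mu (f \o phi) \o psi.

Lemma transport_regular mu f y : regular_at f y -> regular_at (transport mu f) y.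
Proof.
move=> rf; apply: (morphism_regular hpsi); apply: vfield_regular.
by apply: (morphism_regular hphi); rewrite psiK.
Qed.

Lemma near_torus mu x s0 : s0 != 0 -> torus (phi (act mu s0 x)) ->
  near_at s0 (fun s => torus (phi (act mu s x))).
Proof.
move=> s00 t0; have [oV _] := hphi (torus_open ThetaO).
exact: (open_near (V := phi @^-1` torus (Sigma := Theta)) s00 oV t0).
Qed.

Lemma chi_phi_regular n x : torus (phi x) -> regular_at (chi n \o phi) x.
Proof.
by move=> t; apply: (morphism_regular hphi); apply: chi_regular; exact: torus_dual.
Qed.

Lemma transport_chiD mu m n y : torus y -> transport mu (chi (m + n)) y =
  transport mu (chi m) y * chi n y + chi m y * transport mu (chi n) y.
Proof.
move=> ty; apply: vfieldE; have t' : torus (phi (psi y)) by rewrite psiK.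
have h := rderivM (vfieldP mu (chi_phi_regular m t')) (vfieldP mu (chi_phi_regular n t')).
rewrite act1 /= psiK in h; apply: rderiv_local h.
have : near_at 1 (fun s => torus (phi (act mu s (psi y)))).
  by apply: near_torus; rewrite ?oner_neq0 // act1.
by apply: near_at_sub => s ts /=; rewrite chi_torusD.
Qed.

(** The logarithmic derivative of a character, which is invertible on the torus of Y, along
    the transported vector field. *)
Definition logder mu n y : C := transport mu (chi n) y * (chi n y)^-1.

Lemma logderD mu m n y : torus y -> logder mu (m + n) y = logder mu m y + logder mu n y.
Proof.
move=> ty; rewrite /logder transport_chiD // chi_torusD //.
by field; rewrite !chi_torus_neq0.
Qed.

Lemma logder_curve0 mu n v y (hv : Theta (ray v)) (ty : torus y) : pairing v n = 0 ->
  rational_at (fun s => logder mu n (ray_curve hv ty s)) 0.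
Proof.
move=> vn; have dn : dual_cone (ray (R := R) v) n by apply/dual_ray; rewrite vn.
have rl : regular_at (chi n) (limit_point hv ty) by exact: chi_regular.
apply: rationalM; first by apply: regular_ray_curve => //; exact: transport_regular.
apply: rationalV; last exact: regular_ray_curve.
by rewrite ray_curve0 chi_limit // chi_torus_neq0.
Qed.

Lemma logder_rational mu n v y s0 : s0 != 0 -> torus y ->
  rational_at (fun s => logder mu n (act v s y)) s0.
Proof.
move=> s00 ty; have rc : regular_at (chi n) (act v s0 y).
  by apply: chi_regular; exact: torus_dual.
apply: rationalM; first by apply: regular_rational => //; exact: transport_regular.
by apply: rationalV; [exact: chi_torus_neq0|exact: regular_rational].
Qed.

(** The orbit of y under v, with its limits along the rays v and - v, is a projective line
    on which the character n, being orthogonal to v, has no zero or pole. So its logarithmic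
    derivative is regular on this line, hence constant. *)
Lemma logder_ray mu n v y s : Theta (ray v) -> Theta (ray (- v)) -> pairing v n = 0 ->
  torus y -> s != 0 -> logder mu n (act v s y) = logder mu n y.
Proof.
move=> hv hv' vn ty s0; pose c s := logder mu n (ray_curve hv ty s).
pose c' s := logder mu n (ray_curve hv' ty s).
have rc s1 : rational_at c s1.
  have [->|s10] := eqVneq s1 0; first exact: logder_curve0.
  apply: rational_local (logder_rational mu n v s10 ty).
  by apply: near_at_sub (near_at_neq s10) => t t0; rewrite /c ray_curveE.
have rc' : rational_at c' 0 by apply: logder_curve0; rewrite pairingNl vn oppr0.
have cc' t : t != 0 -> c' t = c t^-1.
  by move=> t0; rewrite /c /c' !ray_curveE ?invr_neq0 // actN.
have := rational_proper_const rc rc' cc' s.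
by rewrite /c !ray_curveE ?oner_neq0 // act1.
Qed.

Hypothesis axis_rays : forall a, Theta (ray (e_ a)) /\ Theta (ray (- e_ a)).
Hypothesis diagonal_rays : forall a, exists2 b, b != a &
  Theta (ray (e_ a + e_ b)) /\ Theta (ray (- (e_ a + e_ b))).

Lemma pairing_e a b : pairing (e_ a) (e_ b) = (a == b)%:R.
Proof. by rewrite pairing_delta mxE eqxx eq_sym. Qed.

(** For b != a the character e_a is orthogonal to e_b and [logder_ray] applies. For b = a
    it does not. Let f and g be the logarithmic derivatives of e_a and e_b, where the rays
    of e_a + e_b and its negative are in the fan. Then f - g is invariant under e_a + e_b,
    so f grows along e_a by as much as g along e_b. As g is invariant under e_a, this
    growth depends additively on the time, and [rational_log0] shows that it is 0. *)
Lemma logder_axis mu a b y s : torus y -> s != 0 ->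
  logder mu (e_ a) (act (e_ b) s y) = logder mu (e_ a) y.
Proof.
have neq a' b' y' s' : b' != a' -> torus y' -> s' != 0 ->
    logder mu (e_ a') (act (e_ b') s' y') = logder mu (e_ a') y'.
  move=> ba ty s0; have [h1 h2] := axis_rays b'.
  by apply: logder_ray => //; rewrite pairing_e (negPf ba).
have [->|ba] := eqVneq b a; last exact: neq.
move=> {b} ty s0; have [b ba [h1 h2]] := diagonal_rays a.
pose f := logder mu (e_ a); pose g := logder mu (e_ b); pose u := logder mu (e_ a - e_ b).
have fE y' : torus y' -> f y' = u y' + g y'.
  by move=> ty'; rewrite -logderD // subrK.
have uinv y' s' : torus y' -> s' != 0 -> u (act (e_ a + e_ b) s' y') = u y'.
  move=> ty' s0'; apply: logder_ray => //.
  by rewrite pairingDl !pairingDr !pairingNr !pairing_e !eqxx (negPf ba) eq_sym (negPf ba); ring.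
have ab : a != b by rewrite eq_sym.
have D y' s' : torus y' -> s' != 0 ->
    f (act (e_ a) s' y') - f y' = g (act (e_ b) s' y') - g y'.
  move=> ty' s0'.
  have e1 : f (act (e_ a) s' y') = f (act (e_ a + e_ b) s' y').
    rewrite (act_add (e_ a) (e_ b)) (act_comm (e_ a) (e_ b)).
    exact: esym (neq a b (act (e_ a) s' y') s' ba ty' s0').
  have e2 : g (act (e_ a + e_ b) s' y') = g (act (e_ b) s' y').
    by rewrite (act_add (e_ a) (e_ b)); exact: (neq b a (act (e_ b) s' y') s' ab ty' s0').
  by rewrite e1 fE // uinv // e2 fE //; ring.
pose c s' := f (act (e_ a) s' y) - f y.
have cM s' t : s' != 0 -> t != 0 -> c (s' * t) = c s' + c t.
  move=> s0' t0; rewrite /c (actM (e_ a) y s0' t0).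
  have -> : f (act (e_ a) s' (act (e_ a) t y)) - f y =
    (f (act (e_ a) s' (act (e_ a) t y)) - f (act (e_ a) t y)) + (f (act (e_ a) t y) - f y) by ring.
  have e1 : g (act (e_ b) s' (act (e_ a) t y)) = g (act (e_ b) s' y).
    rewrite (act_comm (e_ b) (e_ a)).
    exact: (neq b a (act (e_ b) s' y) t ab ty t0).
  have e2 : g (act (e_ a) t y) = g y by exact: (neq b a y t ab ty t0).
  by rewrite D // e1 e2 -(D y s').
have rc : rational_at c 1.
  apply: rationalD; last exact: rational_const.
  by apply: logder_rational; rewrite ?oner_neq0.
by apply/eqP; rewrite -subr_eq0; apply/eqP; exact: (rational_log0 rc cM s0).
Qed.

(** Any point of the torus is reached from any other along the coordinate directions. *)
Lemma logder_const mu a y y' : torus y -> torus y' -> logder mu (e_ a) y = logder mu (e_ a) y'.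
Proof.
move=> ty ty'; pose s i := chi (e_ i) y' / chi (e_ i) y.
have s0 i : s i != 0 by rewrite mulf_neq0 ?invr_neq0 ?chi_torus_neq0.
pose move_ r := foldr (fun i p => act (e_ i) (s i) p) y r.
have t r : torus (move_ r) by elim: r.
have inv r : logder mu (e_ a) (move_ r) = logder mu (e_ a) y.
  by elim: r => // i r IH /=; rewrite logder_axis.
have chiE r b : chi (e_ b) (move_ r) = chi (e_ b) y * \prod_(i <- r) s i ^ (i == b)%:R.
  elim: r => [|i r IH]; first by rewrite big_nil mulr1.
  by rewrite big_cons /= chi_act // -/(move_ r) IH pairing_e; ring.
rewrite -(inv (enum 'I_d)); congr (logder mu (e_ a) _).
apply: torus_eq => // b; rewrite chiE big_enum /= (bigD1 b) //= eqxx big1 => [|i /negPf ->].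
  by rewrite mulr1 /s mulrCA divff ?mulr1 ?chi_torus_neq0.
by rewrite expr0z.
Qed.

Variable x1 : pt X.
Hypotheses (tx1 : torus x1) (ty1 : torus (phi x1)).
Local Notation y1 := (phi x1).
(** The common value of the logarithmic derivatives on the torus: the character n is an
    eigenfunction of the transported field mu, with this eigenvalue. *)
Definition xi mu n : C := logder mu n y1.

Lemma transport_chi mu n y : torus y -> transport mu (chi n) y = xi mu n * chi n y.
Proof.
move=> ty; have -> : xi mu n = logder mu n y; last by rewrite /logder divfK // chi_torus_neq0.
rewrite /xi !(additive_basis (g := fun n => logder mu n _)); try by move=> *; exact: logderD.
by apply: eq_bigr => i _; rewrite (logder_const mu i ty1 ty).
Qed.

Lemma xiDr mu m n : xi mu (m + n) = xi mu m + xi mu n.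
Proof. exact: logderD. Qed.

Lemma xiDl mu nu n : xi (mu + nu) n = xi mu n + xi nu n.
Proof.
rewrite /xi /logder -mulrDl; congr (_ * _); apply: vfield_add.
by apply: chi_phi_regular; rewrite psiK.
Qed.

(** Along an orbit of mu the function chi n \o phi is a rational eigenfunction of the Euler
    field, hence a monomial. *)
Lemma xi_int mu n : exists z : int, xi mu n = z%:~R /\
  generically (fun s => chi n (phi (act mu s x1)) = chi n y1 * s ^ z).
Proof.
pose c s := chi n (phi (act mu s x1)).
have c1 : c 1 = chi n y1 by rewrite /c act1.
rewrite -c1; apply: (rational_eigen (c := c)).
- apply: (regular_rational (f := chi n \o phi)); first exact: oner_neq0.
  by rewrite act1; exact: chi_phi_regular.
- by rewrite c1 chi_torus_neq0.
have nt : near_at 1 (fun s => torus (phi (act mu s x1))).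
  by apply: near_torus; rewrite ?oner_neq0 ?act1.
apply: generically_sub (generically_and (near_generically nt) (@generically_neq0 C)).
move=> s0 [ts0 s00]; have r := vfieldP mu (chi_phi_regular n ts0).
have -> : xi mu n * c s0 = vfield mu (chi n \o phi) (act mu s0 x1).
  by rewrite /c -transport_chi // /transport /= phiK.
apply: rderiv_local r; apply: near_at_sub (near1_neq0 R) => s hs.
by rewrite /c /= actM.
Qed.

Lemma xi_matrix : exists A : 'M[int]_d, forall mu n, xi mu n = (pairing (mu *m A) n)%:~R.
Proof.
have [f fE] : exists f : 'I_d * 'I_d -> int, forall p, xi (e_ p.1) (e_ p.2) = (f p)%:~R.
  exists (fun p => projT1 (cid (xi_int (e_ p.1) (e_ p.2)))) => p.
  by have [] := projT2 (cid (xi_int (e_ p.1) (e_ p.2))).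
exists (\matrix_(i, j) f (i, j)) => mu n.
rewrite (additive_basis (xiDr mu)) /pairing rmorph_sum; apply: eq_bigr => j _.
rewrite (additive_basis (g := fun mu => xi mu (e_ j))); last by move=> *; exact: xiDl.
rewrite !mxE mulr_suml rmorph_sum mulrz_suml; apply: eq_bigr => i _.
transitivity ((f (i, j))%:~R * (mu 0 i)%:~R * (n 0 j)%:~R : C).
  by rewrite (mulrzr _ (mu 0 i)) (mulrzr _ (n 0 j)) -(fE (i, j)).
by rewrite !mxE !rmorphM /=; ring.
Qed.

Variable A : 'M[int]_d.
Hypothesis xiA : forall mu n, xi mu n = (pairing (mu *m A) n)%:~R.

(** For generic s the characters of the standard basis agree at both points by [xi_int], and
    these determine a point of the torus. *)
Lemma phi_orbit mu : generically (fun s => s != 0 /\ phi (act mu s x1) = act (mu *m A) s y1).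
Proof.
have nt : near_at 1 (fun s => torus (phi (act mu s x1))).
  by apply: near_torus; rewrite ?oner_neq0 ?act1.
have g : generically (fun s => forall i,
    chi (e_ i) (phi (act mu s x1)) = chi (e_ i) y1 * s ^ pairing (mu *m A) (e_ i)).
  apply: generically_all => i; have [z [zE hz]] := xi_int mu (e_ i).
  suff -> : pairing (mu *m A) (e_ i) = z by [].
  by apply: (@intr_inj C); rewrite -xiA -zE.
have := generically_and g (generically_and (near_generically nt) (@generically_neq0 C)).
apply: generically_sub => s [h [ts s0]]; split=> //.
by apply: torus_eq => // i; rewrite h chi_act.
Qed.

(** If mu *m A = 0 the orbit of x1 under mu would be constant. *)
Lemma xi_matrix_inj mu : mu *m A = 0 -> mu = 0.
Proof.
move=> h; apply/rowP => i; rewrite mxE; apply: (@expz_generic1 C).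
apply: generically_sub (phi_orbit mu) => s [s0]; rewrite h => e.
have a0 : act 0 s y1 = y1.
  by apply: pt_eq => [//|m]; rewrite chi_actE pairing0l expr0z mulr1.
rewrite a0 in e; have := congr1 (chi (e_ i) \o psi) e; rewrite /= !phiK chi_act //.
rewrite pairing_delta -[RHS]mulr1; apply: mulfI; exact: chi_torus_neq0.
Qed.

End Equivariance.

Section RayImages.
Variables (R : realType) (d : nat) (Sigma Theta : set (set 'rV[R]_d)).
Local Notation C := R[i].
Local Notation X := (toric_variety Sigma).
Local Notation Y := (toric_variety Theta).
Variables (phi : pt X -> pt Y) (psi : pt Y -> pt X).
Hypotheses (hphi : is_morphism phi) (hpsi : is_morphism psi).
Hypotheses (phiK : cancel phi psi) (psiK : cancel psi phi).
Hypotheses (Theta0 : forall sigma, Theta sigma -> sigma 0) (ThetaO : Theta [set 0]).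
Local Notation e_ a := (delta_mx 0 a : 'rV[int]_d).
Hypothesis axis_rays : forall a, Theta (ray (e_ a)) /\ Theta (ray (- e_ a)).
Hypothesis diagonal_rays : forall a, exists2 b, b != a &
  Theta (ray (e_ a + e_ b)) /\ Theta (ray (- (e_ a + e_ b))).
Variable x1 : pt X.
Hypotheses (tx1 : torus x1) (ty1 : torus (phi x1)).
Local Notation y1 := (phi x1).
Local Notation xi := (xi phi psi x1).
Variable A : 'M[int]_d.
Hypothesis xiA : forall mu n, xi mu n = (pairing (mu *m A) n)%:~R.
Implicit Types (mu m n v lam : 'rV[int]_d).
Local Opaque act chi ray_curve.
Local Hint Resolve act_torus | 0 : core.

Lemma xi_matrix_det : \det A != 0.
Proof.
apply/negP => /det0P[mu mu0 muA]; case/negP: mu0; apply/eqP.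
exact: (xi_matrix_inj hphi hpsi phiK psiK Theta0 ThetaO axis_rays diagonal_rays tx1 ty1 xiA muA).
Qed.

Lemma solve_direction v : exists (N : nat) lam, (0 < N)%N /\ lam *m A = N%:Z *: v.
Proof.
exists (absz (\det A)), (sgz (\det A) *: (v *m \adj A)); split.
  by rewrite absz_gt0 xi_matrix_det.
by rewrite -scalemxAl -mulmxA mul_adj_mx mul_mx_scalar scalerA abszEsg mulrC.
Qed.

(** * The preimage of a ray *)
Section OneRay.
Variables (v lam : 'rV[int]_d) (N : nat).
Hypotheses (v0 : v != 0) (hv : Theta (ray v)) (N0 : (0 < N)%N) (lamA : lam *m A = N%:Z *: v).
(** Up to the factor N the direction v corresponds to lam under A. The lemmas below show
    that tau, the cone of the preimage of the limit point along v, spans the same line as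
    lam. *)
Local Notation yv := (limit_point hv ty1).
Local Notation x0 := (psi yv).
Local Notation tau := (sval x0).1.

(** After the substitution of s ^ N for s, the preimage of the orbit of y1 under v is the
    orbit of x1 under lam, along which the character m is a multiple of s ^ <lam, m>. As m
    is regular at the limit x0 of this orbit, the exponent cannot be negative. *)
Lemma ray_image_dual m : dual_cone tau m -> 0 <= pairing lam m.
Proof.
move=> hm; have rf : regular_at (chi m \o psi) yv.
  by apply: (morphism_regular hpsi); exact: chi_regular.
have [p [q [q0 cE]]] := (rational_atP _ _).1 (regular_ray_curve Theta0 rf).
have qn : q != 0 by apply: contraNneq q0 => ->; rewrite horner0.
have kn := chi_torus_neq0 m tx1.
rewrite leNgt; apply/negP => neg; have [k zk] : exists k : nat, pairing lam m = - k.+1%:Z.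
  by exists (absz (pairing lam m)).-1; move: neg; move: (pairing lam m) => z; lia.
have sXN : (1 < size ('X^N : {poly C}))%N by rewrite size_polyXn.
have qN : q \Po 'X^N != 0.
  by rewrite -lead_coef_eq0 lead_coef_comp // lead_coefXn expr1n mulr1 lead_coef_eq0.
have e : (p \Po 'X^N) * 'X^(k.+1) = chi m x1 *: (q \Po 'X^N).
  apply: poly_generic_eq.
  have gq : generically (fun s : C => (q \Po 'X^N).[s] != 0) by exists (q \Po 'X^N).
  have go := phi_orbit hphi hpsi phiK psiK Theta0 ThetaO axis_rays diagonal_rays ty1 xiA lam.
  apply: generically_sub (generically_and gq go) => s [].
  rewrite horner_comp hornerXn => qs [s0]; rewrite lamA => orb.
  have sN : s ^+ N != 0 by rewrite expf_neq0.
  have curve : ray_curve hv ty1 (s ^+ N) = act (N%:Z *: v) s y1.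
    rewrite ray_curveE //; apply: pt_eq => [//|n].
    by rewrite !chi_act // pairingZl -[s ^+ N]/(s ^ N%:Z) exprz_exp.
  have := cE _ qs; rewrite /= curve -orb phiK chi_act // zk => h.
  rewrite hornerM hornerZ !horner_comp !hornerXn.
  have := congr1 (fun z => z * q.[s ^+ N]) h; rewrite divfK // => <-.
  rewrite -exprnN; have := expf_neq0 k.+1 s0; move: (s ^+ k.+1) => u u0.
  by field.
have := congr1 (fun u => u.[0]) e; rewrite hornerM hornerZ !horner_comp !hornerXn exprS mul0r mulr0.
rewrite expr0n eqn0Ngt N0 /= => /esym/eqP; rewrite mulf_eq0 (negPf q0) orbF => /eqP k0.
by rewrite k0 eqxx in kn.
Qed.

Lemma ray_image_fixed mu : tau (to_real R mu) -> forall s, act mu s x0 = x0.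
Proof.
move=> hmu s; apply: pt_eq => [//|m]; rewrite chi_actE.
have [->|cn] := eqVneq (chi m x0) 0; first by rewrite mul0r.
have [_ _ _ orth] := svalP x0; have := orth m cn _ hmu.
by rewrite pairing_to_real => /eqP; rewrite intr_eq0 => /eqP ->; rewrite expr0z mulr1.
Qed.

(** The directions mu in tau fix x0, so the transported field of mu vanishes at the limit
    point, where every character orthogonal to v is regular and nonzero; hence the
    eigenvalue of such a character is 0. *)
Lemma ray_image_orth mu n : tau (to_real R mu) -> pairing v n = 0 -> pairing (mu *m A) n = 0.
Proof.
move=> hmu vn; have dn : dual_cone (ray (R := R) v) n by apply/dual_ray; rewrite vn.
have rn : regular_at (chi n) yv by exact: chi_regular.
have rH : regular_at (transport phi psi mu (chi n)) yv by exact: transport_regular.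
have r1 := regular_ray_curve Theta0 rH.
have r2 := rationalM (rational_const (xi mu n) 0) (regular_ray_curve Theta0 rn).
have g : generically (fun s : C => transport phi psi mu (chi n) (ray_curve hv ty1 s) =
    xi mu n * chi n (ray_curve hv ty1 s)).
  apply: generically_sub (@generically_neq0 C) => s s0; rewrite ray_curveE //.
  exact: (transport_chi hphi hpsi psiK Theta0 ThetaO axis_rays diagonal_rays ty1).
have := near_at_self (rational_eq r1 r2 g); rewrite !ray_curve0 chi_limit //.
have -> : transport phi psi mu (chi n) yv = 0.
  apply: vfieldE; apply: rderiv_local (rderiv_const (chi n (phi x0)) 1).
  by exists 1 => [|s _]; rewrite ?hornerE ?oner_neq0 //= (ray_image_fixed hmu).
move=> /esym/eqP; rewrite mulf_eq0 (negPf (chi_torus_neq0 n ty1)) orbF xiA intr_eq0.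
by move/eqP.
Qed.

Lemma ray_image_span mu : tau (to_real R mu) ->
  exists a b : int, a != 0 /\ a *: mu = b *: lam.
Proof.
move=> hmu; have [i vi] : exists i, v 0 i != 0.
  apply/existsP; apply: contraNT v0; rewrite negb_exists => /forallP h.
  by apply/eqP/rowP => i; have := h i; rewrite negbK mxE => /eqP.
exists (N%:Z * v 0 i), ((mu *m A) 0 i); split; first by rewrite mulf_neq0 // -lt0n.
have e : v 0 i *: (mu *m A) = (mu *m A) 0 i *: v.
  apply/rowP => j; rewrite mxE [RHS]mxE.
  have := @ray_image_orth mu (v 0 i *: e_ j - v 0 j *: e_ i) hmu.
  rewrite !pairingDr !pairingNr !pairingZr !pairing_delta => h.
  by apply/eqP; rewrite -subr_eq0 [_ * v 0 j]mulrC h // mulrC subrr.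
apply/eqP; rewrite -subr_eq0; apply/eqP.
apply: (xi_matrix_inj hphi hpsi phiK psiK Theta0 ThetaO axis_rays diagonal_rays tx1 ty1 xiA).
by rewrite mulmxBl -!scalemxAl lamA -scalerA e !scalerA mulrC subrr.
Qed.

End OneRay.
End RayImages.

(** * Counting rays *)

Section RayCount.
Variables (R : realType) (d : nat).
Local Notation C := R[i].
Local Notation realmx A := (map_mx (intr : int -> R) A).

Lemma face_fan_contains0 (P : set 'rV[R]_d) sigma : face_fan P sigma -> sigma 0.
Proof.
by move=> [F _ <-]; exists 0%N, (fun=> 1), (fun=> 0); rewrite big_ord0; split=> //; split=> // -[].
Qed.

Lemma face_fan_origin (s : seq 'rV[R]_d) : s != [::] -> positively_spans s ->
  face_fan (hull [set` s]) [set 0].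
Proof.
move=> s0 sp; apply/face_fanP => //; exists 0; split=> [v _|].
  by rewrite pairing0r lerN10.
have -> : tight s 0 = [::].
  apply/eqP; rewrite -[_ == _]negbK -has_filter -all_predC; apply/allP => v _ /=.
  by rewrite pairing0r eq_sym oppr_eq0 oner_eq0.
apply/seteqP; split=> [x ->|x [[|n] [c [p [_ [hp ->]]]]]].
- by exists 0%N, (fun=> 1), (fun=> 0); rewrite big_ord0; split=> //; split=> // -[].
- by rewrite big_ord0.
- by have := hp ord0.
Qed.

Section OneIsomorphism.
Variables (s : seq 'rV[R]_d) (Theta : set (set 'rV[R]_d)).
Hypotheses (s0 : s != [::]) (sp : positively_spans s).
Hypothesis slat : forall w, w \in s -> range (@to_real R d) w.
Local Notation Sigma := (face_fan (hull [set` s])).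
Local Notation X := (toric_variety Sigma).
Local Notation Y := (toric_variety Theta).
Variables (phi : pt X -> pt Y) (psi : pt Y -> pt X).
Hypotheses (hphi : is_morphism phi) (hpsi : is_morphism psi).
Hypotheses (phiK : cancel phi psi) (psiK : cancel psi phi).
Hypotheses (Theta0 : forall sigma, Theta sigma -> sigma 0) (ThetaO : Theta [set 0]).

(** The tori are open and dense, so the preimage of one meets the other. *)
Lemma common_torus_point : exists x1, torus x1 /\ torus (phi x1).
Proof.
have SO := face_fan_origin s0 sp.
have [oV _] := hpsi (torus_open SO).
have /oV[i [h [hc hb sub]]] : torus (psi (phi (torpt SO (fun=> 1)))).
  by rewrite phiK; exact: torpt_torus.
have [y [ty hy]] := torus_dense Theta0 ThetaO hc hb.
by exists (psi y); split; [exact: sub|rewrite psiK].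
Qed.

Local Notation e_ a := (delta_mx 0 a : 'rV[int]_d).
Hypothesis axis_rays : forall a, Theta (ray (e_ a)) /\ Theta (ray (- e_ a)).
Hypothesis diagonal_rays : forall a, exists2 b, b != a &
  Theta (ray (e_ a + e_ b)) /\ Theta (ray (- (e_ a + e_ b))).

(** Let tau be the cone of the preimage of the limit point along v. It is generated by the
    vertices of s tight at some y. By [ray_image_span] these are proportional to lam, so
    there is at most one; by [ray_image_dual] applied to - lam there is at least one, and
    applied to that vertex it shows that the factor is positive. *)
Lemma ray_images : exists A : 'M[int]_d, forall v, v != 0 -> Theta (ray v) ->
  exists w, w \in s /\ exists2 r : R, 0 < r & to_real R v = r *: (w *m realmx A).
Proof.
have [x1 [tx1 ty1]] := common_torus_point.
have [A xiA] := xi_matrix hphi hpsi phiK psiK Theta0 ThetaO axis_rays diagonal_rays ty1.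
exists A => v v0 hv.
have [N [lam [N0 lamA]]] :=
  solve_direction hphi hpsi phiK psiK Theta0 ThetaO axis_rays diagonal_rays tx1 ty1 xiA v.
pose tau := (sval (psi (limit_point hv ty1))).1.
have dualP m : dual_cone tau m -> 0 <= pairing lam m.
  exact: (ray_image_dual hphi hpsi phiK psiK Theta0 ThetaO axis_rays diagonal_rays tx1 xiA
    v0 N0 lamA).
have spanP mu : tau (to_real R mu) -> exists a b : int, a != 0 /\ a *: mu = b *: lam.
  exact: (ray_image_span hphi hpsi phiK psiK Theta0 ThetaO axis_rays diagonal_rays tx1 xiA
    v0 N0 lamA).
have /(face_fanP _ s0 sp)[y [_ tauE]] : Sigma tau.
  by have [] := svalP (psi (limit_point hv ty1)).
have lam0 : lam != 0.
  apply: contra v0 => /eqP l0; move: lamA; rewrite l0 mul0mx => /rowP e.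
  apply/eqP/rowP => i; have := e i; rewrite !mxE => /esym/eqP.
  by rewrite mulf_eq0 -[_%:Z == 0]/(N == 0%N) eqn0Ngt N0 => /eqP.
have Lam0 : to_real R lam != 0.
  by apply: contra lam0 => /eqP h; apply/eqP/(@to_real_inj R); rewrite h /to_real map_mx0.
have tightP w : w \in tight s y ->
    pairing (to_real R lam) y != 0 /\ w = - (pairing (to_real R lam) y)^-1 *: to_real R lam.
  rewrite mem_tight => /andP[/eqP wy ws]; have [mu _ muE] := slat ws.
  have [|a [b [a0 ab]]] := spanP mu.
    rewrite muE tauE; exists 1%N, (fun=> 1), (fun=> w); rewrite big_ord1 scale1r.
    by do 2!split=> //; rewrite /= mem_tight wy eqxx.
  have ar : a%:~R != 0 :> R by rewrite intr_eq0.
  have e : a%:~R *: w = b%:~R *: to_real R lam.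
    have toZ c m : to_real R (c *: m) = c%:~R *: to_real R m by exact: map_mxZ.
    by rewrite -muE -!toZ ab.
  have ey : - a%:~R = b%:~R * pairing (to_real R lam) y.
    by rewrite -pairingZl -e pairingZl wy mulrN1.
  have ly : pairing (to_real R lam) y != 0.
    by apply: contra ar => /eqP l0; rewrite -oppr_eq0 ey l0 mulr0.
  split=> //; apply: (scalerI ar); rewrite e scalerA; congr (_ *: _).
  by apply: (mulIf ly); rewrite -ey mulrN mulNr mulfVK.
have [w wt] : exists w, w \in tight s y.
  have [t0|nt] := eqVneq (tight s y) [::]; last first.
    by case: (tight s y) nt => // w t _; exists w; rewrite mem_head.
  have : 0 <= pairing lam (- lam).
    by apply: dualP => x; rewrite tauE t0 => /pos_ge; apply.
  rewrite -(ler0z R) -pairing_to_real /to_real map_mxN pairingNr oppr_ge0 leNgt.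
  by rewrite pairing_self_gt0.
have [ly wE] := tightP w wt; move: (wt); rewrite mem_tight => /andP[_ ws].
exists w; split=> //; pose c := - (pairing (to_real R lam) y)^-1.
have c0 : c != 0 by rewrite oppr_eq0 invr_eq0.
have cp : 0 < c.
  have [mu _ muE] := slat ws.
  have : 0 <= pairing lam mu.
    apply: dualP => x; rewrite tauE muE => hx; apply: (pos_ge hx) => w' /tightP[_ ->].
    rewrite -wE; have [->|wn] := eqVneq w 0; first by rewrite pairing0l.
    exact: ltW (pairing_self_gt0 wn).
  rewrite -(ler0z R) -pairing_to_real muE wE -/c pairingZr pmulr_lge0 ?pairing_self_gt0 //.
  by rewrite le_eqVlt eq_sym (negPf c0).
have Nr : N%:R != 0 :> R by rewrite pnatr_eq0 -lt0n.
exists ((N%:R * c)^-1); first by rewrite invr_gt0 mulr_gt0 // ltr0n.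
rewrite wE -/c -scalemxAl -to_real_mul lamA.
have -> : to_real R (N%:Z *: v) = N%:R *: to_real R v by apply/rowP => i; rewrite !mxE intrM.
by rewrite !scalerA -mulrA [c * _]mulrC mulVf ?scale1r // mulf_neq0.
Qed.

End OneIsomorphism.

Section Splitting.
Variables (k : nat) (L : 'I_k -> 'M[int]_(2, d)) (K : 'I_k -> 'M[int]_(d, 2)).
Hypotheses (LK : hex_splitting L K) (k0 : (0 < k)%N).

(** A form that is strictly minimal at v, scaled to take the value -1 there. *)
Lemma hexvert_ray v : v \in hexverts L -> face_fan (hexhull R L) (ray v).
Proof.
move=> vL; have /hexvertsP[l [w [wh vE]]] := vL.
have [y [y0 hy]] := hexvert_exposed R LK l wh; rewrite -to_real_mul -vE in y0 hy.
apply/face_fanP; [exact: hexverts_neq_nil|exact: hexverts_spans LK|].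
set c := pairing (to_real R v) y in y0 hy; have cn : c != 0 by rewrite lt_eqF.
exists ((- c)^-1 *: y); have cp : 0 < (- c)^-1 by rewrite invr_gt0 oppr_gt0.
have cE : (- c)^-1 * c = -1 by rewrite invrN mulNr mulVf.
split=> [x xL|].
  rewrite pairingZr -cE ler_pM2l //; have [->//|xv] := eqVneq x (to_real R v).
  exact: ltW (hy _ xL xv).
congr pos; apply/seteqP; split=> x /=; rewrite mem_tight pairingZr.
  by move=> ->; rewrite cE eqxx map_f.
move=> /andP[/eqP + xL]; rewrite -cE => /(mulfI (lt0r_neq0 cp)) xE.
by apply/eqP; apply: contraT => /(hy _ xL); rewrite xE ltxx.
Qed.

Lemma hexverts_proportional v v' (t : R) : v \in hexverts L -> v' \in hexverts L ->
  0 < t -> to_real R v = t *: to_real R v' -> v = v'.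
Proof.
move=> vL vL' t0 e; apply/eqP; apply: contraT => ne; exfalso.
have /hexvertsP[l [w [wh vE]]] := vL; have /hexvertsP[l' [w' [wh' vE']]] := vL'.
have [y [y0 /(_ (to_real R v'))]] := hexvert_exposed R LK l wh.
have [z [z0 /(_ (to_real R v))]] := hexvert_exposed R LK l' wh'.
rewrite -!to_real_mul -vE -vE' in y0 z0 *; rewrite !map_f // !(inj_eq (@to_real_inj R _)).
move=> /(_ isT ne) h1 /(_ isT); rewrite eq_sym => /(_ ne) h2; move: y0 h1 h2.
rewrite e !pairingZl; move: (pairing _ y) (pairing _ z) z0 => p q q0 tp tq p1.
have p0 : p < 0 by rewrite -(pmulr_rlt0 _ t0).
have t1 : t < 1 by nra.
by nra.
Qed.

End Splitting.
End RayCount.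

Lemma plane_row2 k (l : 'I_k) a b : row2 a b *m plane l =
  a *: delta_mx 0 (mxvec_index l 0) + b *: delta_mx 0 (mxvec_index l 1) :> 'rV[int]_(k * 2).
Proof.
apply/rowP => c; rewrite !mxE big_ord_recl big_ord1 !mxE /=.
have -> : lift ord0 ord0 = 1 :> 'I_2 by apply/val_inj.
by [].
Qed.

(** The 6k rays of the standard fan have their preimages in distinct rays spanned by elements
    of s. The axes and the diagonals of the k planes are among these rays, as
    [ray_images] requires. *)
Lemma variety_power_vertices (R : realType) d k (s : seq 'rV[R]_d) : d = (k * 2)%N ->
  (0 < k)%N -> s != [::] -> positively_spans s ->
  (forall w, w \in s -> range (@to_real R d) w) ->
  isomorphic (toric_variety (face_fan (hull [set` s]))) (variety_power (S3 R) k) ->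
  (k * 6 <= size s)%N.
Proof.
move=> dk; move: s; rewrite {}dk => s k0 s0 sp slat iso; have LK := @plane_splitting k.
have := isomorphic_trans iso (isomorphic_sym (hexhull_variety R LK k0)).
move=> [phi [psi [hphi hpsi phiK psiK]]].
have rayT a b (l : 'I_k) : row2 a b \in hexagon ->
    face_fan (hexhull R (@plane k)) (ray (row2 a b *m plane l)).
  by move=> h; apply: (hexvert_ray R LK k0); apply/hexvertsP; exists l, (row2 a b).
have [||||A hA] := ray_images s0 sp slat hphi hpsi phiK psiK.
- exact: face_fan_contains0.
- by apply: face_fan_origin; [exact: hexverts_neq_nil|exact: hexverts_spans LK].
- move=> c; case/mxvec_indexP: c => l j.
  have [->|->] : j = 0 \/ j = 1 by case: j => [[|[|]]//= ?]; [left|right]; apply/val_inj.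
    have := rayT 1 0 l; have := rayT (-1) 0 l; rewrite !plane_row2 !inE !eqxx !orbT.
    by rewrite !scale0r !addr0 scale1r scaleN1r => /(_ isT) ? /(_ isT).
  have := rayT 0 1 l; have := rayT 0 (-1) l; rewrite !plane_row2 !inE !eqxx !orbT.
  by rewrite !scale0r !add0r scale1r scaleN1r => /(_ isT) ? /(_ isT).
- move=> c; case/mxvec_indexP: c => l j.
  have ne : mxvec_index l 0 != mxvec_index l 1 :> 'I_(k * 2).
    by apply/eqP => /cast_ord_inj /enum_rank_inj [].
  have := rayT 1 1 l; have := rayT (-1) (-1) l; rewrite !plane_row2 !inE !eqxx !orbT.
  rewrite !scale1r !scaleN1r -opprD => /(_ isT) hN /(_ isT) hP.
  have [->|->] : j = 0 \/ j = 1 by case: j => [[|[|]]//= ?]; [left|right]; apply/val_inj.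
    by exists (mxvec_index l 1); rewrite 1?eq_sym.
  by exists (mxvec_index l 0); rewrite // [delta_mx _ _ + _]addrC.
pose Q v w := exists2 r : R, 0 < r & to_real R v = r *: (w *m map_mx intr A).
pose f v := nth 0 s (find (fun w => `[< Q v w >]) s).
have fP v : v \in hexverts (@plane k) -> f v \in s /\ Q v (f v).
  move=> vL; have v0 : v != 0.
    apply: contraTneq vL => ->; apply/hexvertsP => -[l [w [wh e]]].
    have [y [+ _]] := hexvert_exposed R LK l wh.
    by rewrite -to_real_mul -e /to_real map_mx0 pairing0l ltxx.
  have [w [ws wQ]] := hA v v0 (hexvert_ray R LK k0 vL).
  have hs : has (fun w => `[< Q v w >]) s by apply/hasP; exists w => //; apply/asboolP.
  by split; [rewrite mem_nth // -has_find|have /asboolP := nth_find 0 hs].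
rewrite -(hexverts_size (@plane k)) -(size_map f); apply: uniq_leq_size.
  rewrite map_inj_in_uniq; first exact: (hexverts_uniq R LK).
  move=> v v' /[dup] vL /fP[_ [r r0 e]] /[dup] vL' /fP[_ [r' r0' e']] ff.
  apply: (hexverts_proportional LK vL vL' (t := r / r')); first exact: divr_gt0.
  by rewrite e e' ff scalerA divfK // gt_eqF.
by move=> _ /mapP[v /fP[? _] ->].
Qed.

(** * The bound and its equality cases *)

Lemma card_seq (T : choiceType) (x0 : T) (s : seq T) : uniq s -> [set` s] #= `I_(size s).
Proof.
move=> us; have -> : [set` s] = nth x0 s @` `I_(size s).
  apply/seteqP; split=> [x /= xs|_ [i /= si <-]]; last exact: mem_nth.
  by exists (index x s); rewrite /= ?index_mem ?nth_index.
apply: inj_card_eq => i j; rewrite !in_setE /= => hi hj /eqP.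
by rewrite nth_uniq // => /eqP.
Qed.

Lemma hexhull_size (R : realType) k d (L : 'I_k -> 'M[int]_(2, d)) K (s : seq 'rV[R]_d) :
  hex_splitting L K -> uniq s -> vertices (hexhull R L) = [set` s] -> size s = (k * 6)%N.
Proof.
move=> LK us hV; rewrite -(hexverts_size L) -(size_map (@to_real R d)); apply/perm_size.
apply: uniq_perm => [//||x]; first by rewrite map_inj_uniq ?(hexverts_uniq R LK) //; exact: to_real_inj.
by apply/idP/idP; move: (congr1 (fun A => A x) hV); rewrite /= (hexhull_vertices R LK) /= => ->.
Qed.

Theorem theorem5p8 (R : realType) (d : nat) (hd : (0 < d)%N)
    (P : set 'rV[R]_d) (hP : reflexive_polytope P) (hsimp : simplicial P)
    (hu : exists u : 'rV[R]_d, vertices (dual P) u /\ dual P (- u)) :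
  vertices P #<= `I_(if odd d then 3 * d - 1 else 3 * d)%N /\
  (~~ odd d ->
     (vertices P #= `I_(3 * d)%N <->
        lattice_iso (dual P) (set_power (Z2 R) d./2)) /\
     (lattice_iso (dual P) (set_power (Z2 R) d./2) <->
        isomorphic (toric_variety (face_fan P)) (variety_power (S3 R) d./2))).
Proof.
have [_ [pP _] int0 _] := hP; have [s [us PE PV]] := polytope_vertices pP.
have sp : positively_spans s by apply: interior_spans; rewrite -PE.
have SR := reflexive_simplicial PE PV hd us hP hsimp.
have [u [uV uN]] := hu; have [E fE uE] := vertex_facet_basis PE sp uV.
have op : opposed s E.
  move=> v vs; have -> : level E v = pairing v (- u) by rewrite pairingNr uE opprK.
  by apply: uN; rewrite PE; exact: sub_hull.
have s0 : s != [::].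
  by have [_ /(_ (Ordinal hd))] := fE; case: (s).
have cV : vertices P #= `I_(size s) by rewrite PV; exact: card_seq 0 _ us.
have extremal := extremal_hexhull SR fE op.
split.
  rewrite (card_le_eql cV) card_le_II; have := size_vert SR fE op.
  case: ifP => // od; rewrite leq_eqVlt => /orP[/eqP/extremal[]|]; first by rewrite od.
  by move=> h; rewrite subn1 -ltnS prednK // muln_gt0 hd.
move=> ev; have dE : d = (d./2 * 2)%N by rewrite muln2 even_halfK.
have k0 : (0 < d./2)%N by lia.
have cE : vertices P #= `I_(3 * d) <-> size s = (3 * d)%N.
  by rewrite (card_eql cV); split=> [/card_eq_II|->] //; exact: card_eqxx.
have hex_size L (K : 'I_d./2 -> _) : hex_splitting L K -> P = hexhull R L -> size s = (3 * d)%N.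
  move=> LK PL; rewrite (hexhull_size LK us); last by rewrite -PL PV.
  lia.
have of_size : size s = (3 * d)%N -> lattice_iso (dual P) (set_power (Z2 R) d./2) /\
    isomorphic (toric_variety (face_fan P)) (variety_power (S3 R) d./2).
  move=> /extremal[_ [L [K [LK PL]]]]; rewrite PE PL; split.
    exact: hexhull_lattice_iso LK.
  exact: hexhull_variety LK k0.
have of_lattice : lattice_iso (dual P) (set_power (Z2 R) d./2) -> size s = (3 * d)%N.
  rewrite PE => /(lattice_iso_hexhull k0 s0 sp)[L [K [LK PL]]].
  by apply: (hex_size L K LK); rewrite PE.
have of_variety : isomorphic (toric_variety (face_fan P)) (variety_power (S3 R) d./2) ->
    size s = (3 * d)%N.
  rewrite PE => iso; apply/eqP; rewrite eqn_leq (size_vert SR fE op) /=.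
  have := variety_power_vertices dE k0 s0 sp (vert_lat SR) iso; lia.
split; first by split=> [/cE/of_size[]|/of_lattice/cE].
by split=> [/of_lattice/of_size[]|/of_variety/of_size[]].
Qed.
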